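(* For every cubic irrational and every quartic irrational flat $3$-torus $T^3$, if a minimal homothetic immersion of $T^3$ into a sphere exists, then it is unique up to congruence.
   Context: A flat $3$-torus is $T^3=\mathbb{R}^3/\Lambda_3$ with $\Lambda_3$ a lattice of rank $3$ in $\mathbb{R}^3$, equipped with the flat metric induced from $\mathbb{R}^3$. Let $(q_{ij})$ be the Gram matrix of $\Lambda_3$ (the matrix of inner products of the vectors of a basis of $\Lambda_3$) and let $K$ be the field extension of $\mathbb{Q}$ generated by all the ratios $q_{ij}/q_{11}$, $1\le i,j\le 3$. The torus is called cubic irrational if $[K:\mathbb{Q}]=3$ and quartic irrational if $[K:\mathbb{Q}]=4$. Spheres are unit round spheres $\mathbb{S}^m$, of any dimension $m$. An immersion of $T^3$ into a sphere is homothetic if the metric it induces on $T^3$ is a positive constant multiple of the flat metric of $T^3$; it is minimal if its image is a minimal (zero mean curvature) immersed submanifold of the sphere. Two immersions $x:T^3\to\mathbb{S}^{m}$ and $x':T^3\to\mathbb{S}^{m'}$ are congruent if, after regarding both spheres as great spheres of a common sphere, there is an isometry $\varphi$ of that sphere with $x'=\varphi\circ x$.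
   Formalization: Uniqueness up to congruence is stated for immersions with equal homothety constant, since u -> x(2u) is another non-congruent minimal homothetic immersion; for different constants, x' is shown congruent to u -> x(tu) with t > 0 rational. *)

(* Defs.v *)
From HB Require Import structures.
From mathcomp Require Import all_boot all_order all_algebra.
From mathcomp Require Import all_classical all_reals all_analysis.

Set Implicit Arguments.
Unset Strict Implicit.
Unset Printing Implicit Defensive.

Import Order.TTheory GRing.Theory Num.Theory.
Import numFieldNormedType.Exports.

Local Open Scope classical_set_scope.
Local Open Scope ring_scope.

(* The norm of mathcomp-analysis on 'rV[R]_n is the sup norm, so the Euclidean
   inner product has to be introduced separately; the topology and the
   derivatives are the usual ones. *)
Definition dot (R : realType) (n : nat) (u v : 'rV[R]_n) : R :=
  \sum_(i < n) u 0 i * v 0 i.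

(* A basis of R^3 is an invertible matrix B, its vectors being the rows of B. *)
Definition lattice (R : realType) (B : 'M[R]_3) : set 'rV[R]_3 :=
  [set u | exists z : 'rV[int]_3, u = map_mx intr z *m B].

Definition gram (R : realType) (B : 'M[R]_3) : 'M[R]_3 :=
  \matrix_(i, j) dot (row i B) (row j B).

(* Every subfield of R contains Q, so the extension of Q generated by G is
   the smallest subfield containing G. *)
Definition subfield (R : realType) (K : set R) : Prop :=
  divring_closed (fun x => x \in K).

Definition generated_field (R : realType) (G : set R) : set R :=
  smallest (@subfield R) G.

Definition degree_over_rat (R : realType) (K : set R) (d : nat) : Prop :=
  exists b : 'I_d -> R,
    (forall i, K (b i)) /\
    (forall y, K y ->
       exists! a : 'rV[rat]_d, y = \sum_(i < d) ratr (a 0 i) * b i).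

Definition gram_ratio_field (R : realType) (B : 'M[R]_3) : set R :=
  generated_field
    [set r | exists i j : 'I_3, r = gram B i j / gram B 0 0].

Definition cubic_irrational (R : realType) (B : 'M[R]_3) : Prop :=
  degree_over_rat (gram_ratio_field B) 3.

Definition quartic_irrational (R : realType) (B : 'M[R]_3) : Prop :=
  degree_over_rat (gram_ratio_field B) 4.

Fixpoint times_differentiable (R : realType) (n : nat) (k : nat)
    (f : 'rV[R]_3 -> 'rV[R]_n.+1) : Prop :=
  match k with
  | 0%N => continuous f
  | k'.+1 => (forall u, differentiable f u) /\
             (forall v, times_differentiable k' (fun u => 'D_v f u))
  end.

Definition smooth (R : realType) (n : nat)
    (f : 'rV[R]_3 -> 'rV[R]_n.+1) : Prop :=
  forall k, times_differentiable k f.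

(* The unit sphere S^m, of dimension m, in R^(m+1). *)
Definition sphere (R : realType) (m : nat) : set 'rV[R]_m.+1 :=
  [set p | dot p p = 1].

(* A map from T^3 = R^3 / lattice B is given by its lift to R^3, a
   lattice-periodic map. *)
Record torus_immersion (R : realType) (B : 'M[R]_3) (m : nat)
    (x : 'rV[R]_3 -> 'rV[R]_m.+1) : Prop := TorusImmersion {
  torus_immersion_smooth : smooth x;
  torus_immersion_periodic : forall u l, lattice B l -> x (u + l) = x u;
  torus_immersion_sphere : forall u, sphere (x u);
  torus_immersion_injective : forall u v, 'D_v x u = 0 -> v = 0
}.

Definition partial (R : realType) (n : nat) (i : 'I_3)
    (f : 'rV[R]_3 -> 'rV[R]_n.+1) : 'rV[R]_3 -> 'rV[R]_n.+1 :=
  fun u => 'D_(delta_mx 0 i) f u.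

(* Matrix of the induced metric in the standard coordinates of R^3, in which
   the flat metric of T^3 is the identity matrix. *)
Definition induced_metric (R : realType) (m : nat)
    (x : 'rV[R]_3 -> 'rV[R]_m.+1) (u : 'rV[R]_3) : 'M[R]_3 :=
  \matrix_(i, j) dot (partial i x u) (partial j x u).

Definition homothetic (R : realType) (m : nat) (c : R)
    (x : 'rV[R]_3 -> 'rV[R]_m.+1) : Prop :=
  0 < c /\ forall u, induced_metric x u = c%:M.

(* Second fundamental form in the sphere: the component of the second
   derivative normal both to the sphere (along the unit vector x u) and to the
   tangent space spanned by the partial k x u, which are orthogonal to x u. *)
Definition second_fundamental_form (R : realType) (m : nat)
    (x : 'rV[R]_3 -> 'rV[R]_m.+1) (u : 'rV[R]_3) (i j : 'I_3)
    : 'rV[R]_m.+1 :=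
  let h := partial i (partial j x) u in
  h - dot h (x u) *: x u
    - \sum_(k < 3) \sum_(l < 3)
        (invmx (induced_metric x u) k l * dot h (partial k x u))
          *: partial l x u.

Definition mean_curvature (R : realType) (m : nat)
    (x : 'rV[R]_3 -> 'rV[R]_m.+1) (u : 'rV[R]_3) : 'rV[R]_m.+1 :=
  3%:R^-1 *: \sum_(i < 3) \sum_(j < 3)
    invmx (induced_metric x u) i j *: second_fundamental_form x u i j.

Definition minimal (R : realType) (m : nat)
    (x : 'rV[R]_3 -> 'rV[R]_m.+1) : Prop :=
  forall u, mean_curvature x u = 0.

(* [c] is the homothety constant: induced metric = c * flat metric. *)
Definition minimal_homothetic_immersion (R : realType) (B : 'M[R]_3) (m : nat)
    (c : R) (x : 'rV[R]_3 -> 'rV[R]_m.+1) : Prop :=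
  [/\ torus_immersion B x, homothetic c x & minimal x].

Definition sphere_dist (R : realType) (m : nat) (p q : 'rV[R]_m.+1) : R :=
  acos (dot p q).

(* The values of phi outside the sphere are irrelevant. *)
Definition sphere_isometry (R : realType) (m : nat)
    (phi : 'rV[R]_m.+1 -> 'rV[R]_m.+1) : Prop :=
  set_bij (@sphere R m) (@sphere R m) phi /\
  (forall p q, sphere p -> sphere q ->
     sphere_dist (phi p) (phi q) = sphere_dist p q).

(* p |-> p *m E is a linear isometric embedding, which identifies S^m with a
   great sphere of S^N. *)
Definition great_sphere_embedding (R : realType) (m N : nat)
    (E : 'M[R]_(m.+1, N.+1)) : Prop :=
  E *m E^T = 1%:M.

Definition congruent (R : realType) (m m' : nat)
    (x : 'rV[R]_3 -> 'rV[R]_m.+1) (x' : 'rV[R]_3 -> 'rV[R]_m'.+1) : Prop :=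
  exists (N : nat) (E : 'M[R]_(m.+1, N.+1)) (E' : 'M[R]_(m'.+1, N.+1))
         (phi : 'rV[R]_N.+1 -> 'rV[R]_N.+1),
    [/\ great_sphere_embedding E, great_sphere_embedding E',
        sphere_isometry phi &
        forall u, x' u *m E' = phi (x u *m E)].

(* Main.v *)
(** A minimal homothetic immersion [x] with metric [c] times the flat one satisfies Laplace's equation
    [Delta x = - 3 c x], so in the coordinates of the lattice its frequencies form a finite symmetric
    set [Y] of integer vectors on which the dual form [xi G^-1 xi^T] is constant, [G] being the Gram
    matrix. The conditions [|x|^2 = 1] and [metric = c] become linear relations between the products
    [<A_xi, A_eta>] of amplitudes; in particular the sum of [|A_xi|^2 xi^T xi] is a multiple of [G].
    Given two immersions, take three independent frequencies as a basis. Then the off-diagonal entries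
    of this identity put the entries of [G], up to a common factor, in a field of degree at most two
    over the rationals, unless all frequencies of both immersions lie on four lines, with the same
    rational ratio [t] on each line. So cubic and quartic irrationality leave four lines, and their
    squares [xi^T xi] are independent. Independence fixes the numbers [|A_xi|] and makes all other
    products vanish, so both immersions are the same combination of eight waves in two orthonormal
    systems, and a reflection exchanges the two systems. *)

Require Import Defs.
From mathcomp Require Import all_boot all_order all_algebra.
From mathcomp Require Import all_classical all_reals all_analysis.
From mathcomp Require Import complex.
From mathcomp Require Import ring lra zify.
Import Order.TTheory GRing.Theory Num.Theory.
Import numFieldNormedType.Exports.
Local Open Scope classical_set_scope.
Local Open Scope ring_scope.

Set Implicit Arguments.
Unset Strict Implicit.
Unset Printing Implicit Defensive.

(** * Mean values of periodic functions *)

(** The frequencies of the second immersion lie on a level set of the same form, but with another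
    constant, so at first they give no rational conditions in the basis normalized by the first
    spectrum. Hence the quotient of the two constants is shown to be rational before any line is
    found: both weighted sums of squares are multiples of one Gram matrix, and a real linear
    relation between integer matrices entails rational ones. After that the two spectra can be
    treated as one set. The degree two has its source in the identity for the Gram matrix, read in
    the basis of three frequencies: the Gram matrix becomes the inverse of the normalized form,
    hence its adjugate up to a factor, and the off-diagonal entries of a 3 by 3 adjugate are
    quadratic in the entries of the matrix. On the analytic side the Laplace equation leaves
    finitely many frequencies, so convergence of series is never at issue; it suffices that a
    continuous periodic function with zero coefficients vanishes. *)

Lemma fmap_ultra (T U : Type) (f : T -> U) (F : set_system T) :
  UltraFilter F -> UltraFilter (f @ F).
Proof.
move=> FU; split=> [|G GF FG]; first exact: fmap_proper_filter.
rewrite predeqE => A; split=> [GA|]; last exact: FG.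
have [//|FnA] := in_ultra_setVsetC (f @^-1` A) FU.
have /(filterI GA) : G (~` A) by exact: FG.
by rewrite setICr => /filter_not_empty.
Qed.

Section Mean.
Variable R : realType.
Implicit Types (h g : 'rV[R]_3 -> R) (z : 'rV[R]_3).

Definition ivec (xi : 'rV[int]_3) : 'rV[R]_3 := map_mx intr xi.

Definition contper h :=
  continuous h /\ forall z k, h (z + ivec k) = h z.

Lemma contper_cst (a : R) : contper (fun=> a).
Proof. by split=> //; exact: cst_continuous. Qed.

Lemma contperD h g : contper h -> contper g -> contper (fun z => h z + g z).
Proof.
move=> [ch ph] [cg pg]; split=> [z|z k]; last by rewrite ph pg.
exact: (cvgD (ch z) (cg z)).
Qed.

Lemma contperM h g : contper h -> contper g -> contper (fun z => h z * g z).
Proof.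
move=> [ch ph] [cg pg]; split=> [z|z k]; last by rewrite ph pg.
exact: (cvgM (ch z) (cg z)).
Qed.

Lemma contperZ (a : R) h : contper h -> contper (fun z => a * h z).
Proof. exact/contperM/contper_cst. Qed.

Lemma contperN h : contper h -> contper (fun z => - h z).
Proof.
move=> /(contperZ (-1)); under [in X in X -> _]eq_fun do rewrite mulN1r; exact.
Qed.

Lemma contperB h g : contper h -> contper g -> contper (fun z => h z - g z).
Proof. by move=> ch cg; apply: contperD => //; apply: contperN. Qed.

Lemma contper_sum (I : Type) (s : seq I) (P : pred I) (F : I -> 'rV[R]_3 -> R) :
  (forall i, contper (F i)) -> contper (fun z => \sum_(i <- s | P i) F i z).
Proof.
move=> cF; elim: s => [|i s IHs].
  by under eq_fun do rewrite big_nil; exact: contper_cst.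
case Pi: (P i).
  by under eq_fun do rewrite big_cons Pi; exact: contperD.
by under eq_fun do rewrite big_cons Pi; exact: IHs.
Qed.

Lemma contperX h n : contper h -> contper (fun z => h z ^+ n).
Proof.
move=> ch; elim: n => [|n IHn].
  by under eq_fun do rewrite expr0; exact: contper_cst.
by under eq_fun do rewrite exprS; exact: contperM.
Qed.

Definition box : set 'rV[R]_3 := [set v | forall i, `[0, 1]%classic (v ord0 i)].

Lemma box_compact : compact box.
Proof. by have := @rV_compact R 3 (fun=> `[0, 1]%classic) (fun=> @segment_compact _ _ _). Qed.

Lemma box_reduce z : exists k, box (z + ivec k).
Proof.
exists (\row_i (- Num.floor (z 0 i))) => i /=; rewrite !mxE in_itv /=.
have /andP[] := floor_itv (z 0 i); rewrite rmorphD rmorphN /=; lra.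
Qed.

Lemma contper_bounded h : contper h -> exists C : R, forall z, `|h z| <= C.
Proof.
move=> [ch ph]; have : {within box, continuous h} by exact: continuous_subspaceT.
move=> /continuous_compact/(_ box_compact)/compact_bounded[M [_ HM]].
exists (M + 1) => z; have [k bk] := box_reduce z; rewrite -(ph z k).
by apply: (HM (M + 1)); [rewrite ltrDl|exists (z + ivec k)].
Qed.

Definition unitv (i : 'I_3) : 'rV[R]_3 := delta_mx 0 i.

(** Compactness of [box] makes the bound uniform there, and periodicity carries it to every [z],
    because both points of the estimate are translated together. *)
Lemma contper_unif i h (e : R) : contper h -> 0 < e ->
  exists2 d : R, 0 < d & forall z s, `|s| < d -> `|h (z + s *: unitv i) - h z| < e.
Proof.
move=> [ch ph] e0.
have /(_ R (nbhs (0:R)) (fun s z => `|h (z + s *: unitv i) - h z| < e) _) []:=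
   (compact_near_coveringP box).1 box_compact.
  move=> z _.
  have : (fun p : 'rV[R]_3 * R => h (p.1 + p.2 *: unitv i) - h p.1) @ (z, 0) --> h (z + 0 *: unitv i) - h z.
    have c1 : {for (z, 0), continuous (fun p : 'rV[R]_3 * R => h p.1)}.
      by apply: continuous_comp; [exact: cvg_fst|exact: ch].
    have c2 : {for (z, 0), continuous (fun p : 'rV[R]_3 * R => h (p.1 + p.2 *: unitv i))}.
      apply: (@continuous_comp _ _ _ (fun p : 'rV[R]_3 * R => p.1 + p.2 *: unitv i) h); last exact: ch.
      apply: cvgD; first exact: cvg_fst.
      by apply: cvgZr_tmp; exact: cvg_snd.
    exact: (cvgB c2 c1).
  rewrite scale0r addr0 subrr => /cvgr0_norm_lt /(_ _ e0).
  by [].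
move=> d /= d0 Hd; exists d => // z s sd.
have [k bk] := box_reduce z; rewrite -(ph z k) -(ph (z + _) k) addrAC.
by apply: (Hd s) => //=; rewrite sub0r normrN.
Qed.

Definition grid (n : nat) (k : 'rV['I_n.+1]_3) : 'rV[R]_3 :=
  \row_i ((k 0 i : nat)%:R / n.+1%:R).

Definition grid_mean (n : nat) h : R :=
  (n.+1%:R ^+ 3)^-1 * \sum_(k : 'rV['I_n.+1]_3) h (grid k).

(** Adding one to the [i]-th index modulo [n.+1] permutes the grid; the carry [q] is an integer
    vector, which periodicity absorbs. *)
Lemma grid_shift n h i : contper h ->
  \sum_(k : 'rV['I_n.+1]_3) h (grid k + n.+1%:R^-1 *: unitv i) =
  \sum_(k : 'rV['I_n.+1]_3) h (grid k).
Proof.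
move=> [_ ph]; pose d : 'rV['I_n.+1]_3 := \row_j (if j == i then inZp 1 else 0).
rewrite [RHS](reindex_inj (addIr d)); apply: eq_bigr => k _ /=.
pose q : 'rV[int]_3 := \row_j (((k ord0 j + (j == i)) %/ n.+1)%N : int).
rewrite -[RHS](ph _ q); congr h; apply/rowP => j; rewrite !mxE /=.
have N0 : (n.+1%:R : R) != 0 by rewrite pnatr_eq0.
apply: (mulIf N0); rewrite !mulrDl -!mulrA mulVf // !mulr1 [_ * n.+1%:R]mulrC mulrA.
rewrite mulVf // mul1r.
have -> : ((k ord0 j + (if j == i then inZp 1 else (0 : 'I_n.+1)%R)) %% n.+1 =
          (k ord0 j + (j == i)) %% n.+1)%N.
  by case: (j == i) => /=; rewrite ?mod0n ?addn0 // modnDmr.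
rewrite -[_%:~R]/(_%:R) -natrM -!natrD; congr _%:R.
by rewrite [RHS]addnC -divn_eq.
Qed.

Lemma grid_meanD n h g :
  grid_mean n (fun z => h z + g z) = grid_mean n h + grid_mean n g.
Proof. by rewrite /grid_mean big_split mulrDr. Qed.

Lemma grid_meanZ n (a : R) h :
  grid_mean n (fun z => a * h z) = a * grid_mean n h.
Proof. by rewrite /grid_mean -mulr_sumr mulrCA. Qed.

Lemma grid_mean1 n : grid_mean n (fun=> 1) = 1.
Proof.
rewrite /grid_mean sumr_const card_mx card_ord mul1n -natrX mulVf //.
Qed.

Lemma grid_mean_le n h g :
  (forall z, h z <= g z) -> grid_mean n h <= grid_mean n g.
Proof.
by move=> hg; rewrite ler_wpM2l ?invr_ge0 ?exprn_ge0 // ler_sum.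
Qed.

Lemma grid_mean_norm n h C : (forall z, `|h z| <= C) -> `|grid_mean n h| <= C.
Proof.
move=> hC; have e a : grid_mean n (fun=> a) = a.
  by rewrite -[in RHS](mulr1 a) -(grid_mean1 n) -grid_meanZ; under [in RHS]eq_fun do rewrite mulr1.
rewrite ler_norml -{1}(e (- C)) -{2}(e C) !grid_mean_le // => z.
  by have := hC z; rewrite ler_norml => /andP[].
by have := hC z; rewrite ler_norml => /andP[].
Qed.

(* The mean over the torus is a limit of averages over the grids [(n^-1 Z / Z)^3]; taking it along an
   ultrafilter makes it exist by compactness, so that no integral is needed. *)
Definition ultra : set_system nat := projT1 (cid (ultraFilterLemma eventually_filter)).

Lemma ultra_ultra : UltraFilter ultra.
Proof. by rewrite /ultra; case: cid => G /= []. Qed.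

Lemma eventually_ultra : \oo `<=` ultra.
Proof. by rewrite /ultra; case: cid => G /= []. Qed.

Instance ultra_proper : ProperFilter ultra.
Proof. by have := ultra_ultra; case. Qed.

Definition mean h : R := lim (grid_mean n h @[n --> ultra]).

Lemma mean_cvg h : contper h -> grid_mean n h @[n --> ultra] --> mean h.
Proof.
move=> /contper_bounded[C hC].
have := @segment_compact R (- C) C; rewrite compact_ultra => /(_ (grid_mean n h @[n --> ultra]) _).
case=> [||p [_ +]].
- exact: fmap_ultra ultra_ultra.
- by apply: (@nearW _ ultra) => n /=; rewrite in_itv /= -ler_norml grid_mean_norm.
- by move=> /= cp; rewrite /mean (cvg_lim _ cp).
Qed.

Lemma meanD h g : contper h -> contper g ->
  mean (fun z => h z + g z) = mean h + mean g.
Proof.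
move=> ch cg; apply: cvg_lim => //.
under eq_fun do rewrite grid_meanD.
by apply: cvgD; exact: mean_cvg.
Qed.

Lemma meanZ (a : R) h : contper h -> mean (fun z => a * h z) = a * mean h.
Proof.
move=> ch; apply: cvg_lim => //.
under eq_fun do rewrite grid_meanZ.
by apply: cvgM; [exact: cvg_cst|exact: mean_cvg].
Qed.

Lemma mean1 : mean (fun=> 1) = 1.
Proof.
apply: cvg_lim => //; under eq_fun do rewrite grid_mean1; exact: cvg_cst.
Qed.

Lemma mean_cst (a : R) : mean (fun=> a) = a.
Proof.
rewrite -[RHS](mulr1 a) -mean1 -meanZ; last exact: contper_cst.
by under [in RHS]eq_fun do rewrite mulr1.
Qed.

Lemma meanN h : contper h -> mean (fun z => - h z) = - mean h.
Proof.
by move=> ch; rewrite -mulN1r -meanZ //; under [in RHS]eq_fun do rewrite mulN1r.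
Qed.

Lemma meanB h g : contper h -> contper g ->
  mean (fun z => h z - g z) = mean h - mean g.
Proof. by move=> ch cg; rewrite meanD ?meanN //; exact: contperN. Qed.

Lemma mean_sum (I : Type) (s : seq I) (P : pred I) (F : I -> 'rV[R]_3 -> R) :
  (forall i, contper (F i)) ->
  mean (fun z => \sum_(i <- s | P i) F i z) = \sum_(i <- s | P i) mean (F i).
Proof.
move=> cF; elim: s => [|i s IHs].
  by rewrite big_nil -[RHS](mean_cst 0); congr mean; apply/funext => z; rewrite big_nil.
rewrite big_cons; case Pi: (P i); rewrite -IHs -?meanD //; try exact: contper_sum;
  by congr mean; apply/funext => z; rewrite big_cons Pi.
Qed.

Lemma mean_le h g : contper h -> contper g -> (forall z, h z <= g z) ->
  mean h <= mean g.
Proof.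
move=> ch cg hg.
have h1 := @mean_cvg _ ch; have h2 := @mean_cvg _ cg.
rewrite /mean; apply: ler_lim.
- by apply/cvg_ex; exists (mean h).
- by apply/cvg_ex; exists (mean g).
- by apply: nearW => n; exact: grid_mean_le.
Qed.

Definition pderiv (i : 'I_3) h g := forall z (s : R),
  is_derive s 1 (fun t => h (z + t *: unitv i)) (g (z + s *: unitv i)).

Lemma pderiv_cont i h g z : pderiv i h g -> continuous (fun t : R => h (z + t *: unitv i)).
Proof.
move=> d s; apply: differentiable_continuous; apply/derivable1_diffP.
by have [] := d z s.
Qed.

(** By the mean value theorem the difference quotient of [h] over one grid step is a value of [g] at
    most one step away, hence uniformly close to [g]; its grid sum is zero by [grid_shift]. *)
Lemma mean_pderiv i h g : pderiv i h g -> contper h -> contper g -> mean g = 0.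
Proof.
move=> d ch cg; apply: cvg_lim => //; apply/cvgr0Pnorm_lt => e e0.
have [dl dl0 Hd] := contper_unif i cg (divr_gt0 e0 (ltr0n _ 2)).
apply: eventually_ultra.
have : \forall n \near \oo, (n.+1%:R : R)^-1 < dl by exact: (near_infty_natSinv_lt (PosNum dl0)).
apply: filterS => n nd; apply: (@le_lt_trans _ _ (e / 2)); last by rewrite gtr_pMr // invf_lt1 // ltr1n.
have nE : n.+1%:R != 0 :> R by rewrite pnatr_eq0.
have -> : grid_mean n g = grid_mean n (fun z => g z - n.+1%:R * (h (z + n.+1%:R^-1 *: unitv i) - h z)).
  rewrite /grid_mean big_split /= sumrN -mulr_sumr big_split /= sumrN grid_shift //.
  by rewrite subrr mulr0 subr0.
apply: grid_mean_norm => z; set s := n.+1%:R^-1 in nd *.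
have s0 : 0 < s by rewrite invr_gt0 ltr0n.
have [||c /= + E] := @MVT_segment R (fun t => h (z + t *: unitv i)) (fun t => g (z + t *: unitv i)) 0 s (ltW s0).
- by move=> x _; exact: d.
- exact/continuous_subspaceT/pderiv_cont.
rewrite in_itv /= => /andP[c0 cs].
have -> : n.+1%:R * (h (z + s *: unitv i) - h z) = g (z + c *: unitv i).
  have := E; rewrite scale0r addr0 subr0 => ->.
  by rewrite mulrC -mulrA mulVf // mulr1.
by rewrite distrC ltW // Hd // ger0_norm // (le_lt_trans cs).
Qed.

(** * Waves and trigonometric kernels *)

Definition phase (xi : 'rV[int]_3) z : R := (\sum_i (xi 0 i)%:~R * z 0 i) * (pi *+ 2).

(** A free phase [phi] keeps the analysis real: cosines and sines form one family, products of its
    members are combinations of members, and differentiation adds [pi / 2] to [phi]. *)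
Definition wave (xi : 'rV[int]_3) (phi : R) z : R := cos (phase xi z + phi).

Lemma phaseD xi z v : phase xi (z + v) = phase xi z + phase xi v.
Proof.
rewrite /phase -mulrDl -big_split /=; congr (_ * _).
by apply: eq_bigr => i _; rewrite mxE mulrDr.
Qed.

Lemma phase_addl xi eta z : phase (xi + eta) z = phase xi z + phase eta z.
Proof.
rewrite /phase -mulrDl -big_split /=; congr (_ * _).
by apply: eq_bigr => i _; rewrite mxE rmorphD mulrDl.
Qed.

Lemma phaseN xi z : phase (- xi) z = - phase xi z.
Proof.
rewrite /phase -mulNr -sumrN; congr (_ * _).
by apply: eq_bigr => i _; rewrite mxE rmorphN mulNr.
Qed.

Lemma phase_ivec xi k : phase xi (ivec k) = (\sum_i xi 0 i * k 0 i)%:~R * (pi *+ 2).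
Proof.
rewrite /phase rmorph_sum; congr (_ * _).
by apply: eq_bigr => i _; rewrite mxE rmorphM.
Qed.

Lemma phase_unitv xi (t : R) i : phase xi (t *: unitv i) = t * ((xi 0 i)%:~R * (pi *+ 2)).
Proof.
rewrite /phase (bigD1 i) //= big1 ?addr0 => [|j ji].
  by rewrite !mxE !eqxx /= mulr1 mulrCA mulrA.
by rewrite !mxE (negbTE ji) andbF !mulr0.
Qed.

Lemma cosDint (k : int) (a : R) : cos (a + k%:~R * (pi *+ 2)) = cos a.
Proof.
have H (n : nat) b : cos (b + n%:R * (pi *+ 2)) = cos b :> R.
  by rewrite mulr_natl (periodicn (@cosD2pi R)).
case: k => n; first exact: H.
by rewrite NegzE rmorphN mulNr -[LHS](H n.+1) subrK.
Qed.

Lemma continuous_phase xi : continuous (phase xi).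
Proof.
have cs (s : seq 'I_3) : continuous (fun z : 'rV[R]_3 => \sum_(i <- s) (xi 0 i)%:~R * z 0 i).
  elim: s => [|i s IHs].
    by under eq_fun do rewrite big_nil; exact: cst_continuous.
  under eq_fun do rewrite big_cons; move=> z.
  apply: (@continuousD _ _ _ (fun z => _ * z 0 i)); last exact: IHs.
  by apply: (@continuousM _ _ (fun=> _)); [exact: cst_continuous|exact: coord_continuous].
move=> z; apply: (@continuousM _ _ _ (fun=> pi *+ 2)); last exact: cst_continuous.
exact: cs.
Qed.

Lemma contper_wave xi phi : contper (wave xi phi).
Proof.
split=> [z|z k]; last by rewrite /wave phaseD phase_ivec addrAC cosDint.
apply: (@continuous_comp _ _ _ (fun z => phase xi z + phi) cos); last exact: continuous_cos.
by apply: (@continuousD _ _ _ (phase xi) (fun=> phi)); [exact: continuous_phase|exact: cst_continuous].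
Qed.

Lemma is_derive_affine (a b s : R) : is_derive s 1 (fun t => a + t * b) b.
Proof.
have := is_deriveD (is_derive_cst a s 1)
  (is_deriveM (is_derive_id s (1:R)) (is_derive_cst b s 1)).
by rewrite /= scaler0 !add0r [_ *: _]mulr1.
Qed.

Lemma is_derive_cos_affine (a b s : R) :
  is_derive s 1 (fun t => cos (a + t * b)) (- sin (a + s * b) * b).
Proof.
exact: (is_derive1_comp (is_derive_cos _) (is_derive_affine a b s)).
Qed.

Lemma pderiv_wave i xi phi : pderiv i (wave xi phi)
  (fun z => (xi 0 i)%:~R * (pi *+ 2) * wave xi (phi + pi / 2) z).
Proof.
move=> z s.
have E t psi : phase xi (z + t *: unitv i) + psi = phase xi z + psi + t * ((xi 0 i)%:~R * (pi *+ 2)).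
  by rewrite phaseD phase_unitv addrAC.
have -> : (fun t => wave xi phi (z + t *: unitv i)) =
    (fun t => cos (phase xi z + phi + t * ((xi 0 i)%:~R * (pi *+ 2)))).
  by apply/funext => t; rewrite /wave E.
apply: is_derive_eq (is_derive_cos_affine _ _ _) _.
by rewrite /wave addrA cosDpihalf E mulrC.
Qed.

Lemma mean_wave xi phi : xi != 0 -> mean (wave xi phi) = 0.
Proof.
move=> x0.
have [i xi0] : exists i, xi 0 i != 0.
  apply/existsP; apply: contraT => /existsPn H; case/eqP: x0; apply/rowP => i.
  by rewrite mxE; have := H i; rewrite negbK => /eqP.
have c0 : (xi 0 i)%:~R * (pi *+ 2) != 0 :> R.
  by rewrite mulf_neq0 ?intr_eq0 // mulrn_eq0 /= gt_eqF // pi_gt0.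
(* Up to a nonzero factor, [wave xi phi] is the derivative of the wave whose phase is lowered by
   [pi / 2]. *)
have := mean_pderiv (pderiv_wave i xi (phi - pi / 2)) (contper_wave _ _) _.
rewrite meanZ ?subrK; last exact: contper_wave.
move=> /(_ (contperZ _ (contper_wave _ _))) /eqP.
by rewrite mulf_eq0 (negbTE c0) /= => /eqP.
Qed.

Lemma waveM xi phi eta psi z : wave xi phi z * wave eta psi z =
  1 / 2 * (wave (xi + eta) (phi + psi) z + wave (xi - eta) (phi - psi) z).
Proof.
rewrite /wave !phase_addl phaseN.
set a := phase xi z; set b := phase eta z.
have -> : a + b + (phi + psi) = (a + phi) + (b + psi) by ring.
have -> : a - b + (phi - psi) = (a + phi) - (b + psi) by ring.
set A := a + phi; set B := b + psi; by rewrite cosD cosB; field.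
Qed.

(* The value at [z] of the Fejer-type kernel centred at [u], in direction [i]. *)
Definition bump (u : 'rV[R]_3) (i : 'I_3) z : R := (1 + cos ((z 0 i - u 0 i) * (pi *+ 2))) / 2.

Lemma bump_wave u i z :
  bump u i z = 1 / 2 + 1 / 2 * wave (delta_mx 0 i) (- (u 0 i * (pi *+ 2))) z.
Proof.
rewrite /bump /wave /phase (bigD1 i) //= big1 ?addr0 => [|j ji].
  by rewrite !mxE !eqxx /= [_%:~R * _]mul1r -mulrBl; field.
by rewrite !mxE (negbTE ji) andbF mul0r.
Qed.

Lemma contper_bump u i : contper (bump u i).
Proof.
rewrite (funext (bump_wave u i)).
by apply: contperD; [exact: contper_cst|apply: contperZ; exact: contper_wave].
Qed.

Lemma bump_ge0 u i z : 0 <= bump u i z.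
Proof. by rewrite /bump divr_ge0 // -lerBlDl sub0r cos_geN1. Qed.

Lemma bump_le1 u i z : bump u i z <= 1.
Proof. by rewrite /bump ler_pdivrMr // mul1r -[2]/(1+1) lerD2l cos_le1. Qed.

(** Integration by parts: [D] is the derivative of [S] in direction [i], since the square of the
    sine is [4 * bump * (1 - bump)], and the vanishing of its mean is the recursion. *)
Lemma mean_bumpS u i n g : contper g ->
  (forall z t, g (z + t *: unitv i) = g z) ->
  mean (fun z => bump u i z ^+ n.+1 * g z) =
  (n.*2.+1%:R / n.*2.+2%:R) * mean (fun z => bump u i z ^+ n * g z).
Proof.
move=> cg ig.
have pi2 : (pi *+ 2 : R) != 0 by rewrite mulrn_eq0 /= gt_eqF // pi_gt0.
have db s c : is_derive s (1 : R) (fun t => cos (c + t * (pi *+ 2))) (- sin (c + s * (pi *+ 2)) * (pi *+ 2)).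
  exact: is_derive_cos_affine.
have ds s c : is_derive s (1 : R) (fun t => sin (c + t * (pi *+ 2))) (cos (c + s * (pi *+ 2)) * (pi *+ 2)).
  exact: (is_derive1_comp (is_derive_sin _) (is_derive_affine _ _ _)).
pose S z := sin ((z 0 i - u 0 i) * (pi *+ 2)) * bump u i z ^+ n * g z.
pose D z := (pi *+ 2) * (n.*2.+2%:R * (bump u i z ^+ n.+1 * g z) - n.*2.+1%:R * (bump u i z ^+ n * g z)).
have cb k : contper (fun z => bump u i z ^+ k * g z).
  by apply: contperM => //; apply: contperX; exact: contper_bump.
have cS : contper S.
  apply: contperM => //; apply: contperM; last by apply: contperX; exact: contper_bump.
  have -> : (fun z : 'rV[R]_3 => sin ((z 0 i - u 0 i) * (pi *+ 2))) =
      wave (delta_mx 0 i) (- (u 0 i * (pi *+ 2)) - pi / 2).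
    apply/funext => z; rewrite /wave addrA cosBpihalf /phase (bigD1 i) //= big1 ?addr0 => [|j ji].
      by rewrite !mxE !eqxx /= mul1r -mulrBl.
    by rewrite !mxE (negbTE ji) andbF mul0r.
  exact: contper_wave.
have cD : contper D.
  by apply: contperZ; apply: contperB; apply: contperZ; exact: cb.
suff pD : pderiv i S D.
  have := mean_pderiv pD cS cD; rewrite /D meanZ; last by apply: contperB; apply: contperZ; exact: cb.
  rewrite meanB ?meanZ //; try by apply: contperZ; exact: cb.
  move=> /eqP; rewrite mulf_eq0 (negbTE pi2) /= subr_eq0 => /eqP E.
  apply: (@mulfI _ (n.*2.+2%:R : R)); first by rewrite pnatr_eq0.
  by rewrite E mulrA mulrCA divff ?pnatr_eq0 // mulr1.
move=> z s; pose c := (z 0 i - u 0 i) * (pi *+ 2).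
have arg t : ((z + t *: unitv i) 0 i - u 0 i) * (pi *+ 2) = c + t * (pi *+ 2).
  by rewrite !mxE !eqxx mulr1 /c; ring.
pose B t : R := (1 + cos (c + t * (pi *+ 2))) / 2.
have -> : (fun t => S (z + t *: unitv i)) = (fun t => sin (c + t * (pi *+ 2))) * B ^+ n * cst (g z).
  by apply/funext => t; rewrite !fctE /S /bump arg ig.
have dB : is_derive s 1 B (- sin (c + s * (pi *+ 2)) * (pi *+ 2) / 2).
  rewrite /B; have := is_deriveM (is_deriveD (is_derive_cst (1:R) s (1:R)) (db s c)) (is_derive_cst (2^-1:R) s 1).
  move=> H; apply: is_derive_eq H _.
  by rewrite /= scaler0 !add0r [LHS]mulrC.
have := is_deriveM (is_deriveM (ds s c) (is_deriveX n dB)) (is_derive_cst (g z) s 1).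
move=> H; apply: is_derive_eq H _.
rewrite /D /bump arg ig -/(B s) scaler0 add0r !fctE /GRing.scale /=.
have C : cos (c + s * (pi *+ 2)) = 2 * B s - 1 by rewrite /B; field.
have S2 : sin (c + s * (pi *+ 2)) ^+ 2 = 4 * B s * (1 - B s) by rewrite sin2cos2 C; ring.
rewrite C; case: (n) => [|m] /=.
  by rewrite !expr0 expr1 -[0.*2.+2]/2%N -[0.*2.+1]/1%N; ring.
rewrite !exprS.
have -> : sin (c + s * (pi *+ 2)) * (m.+1%:R * B s ^+ m * (- sin (c + s * (pi *+ 2)) * (pi *+ 2) / 2)) =
   - (sin (c + s * (pi *+ 2)) ^+ 2) * (m.+1%:R * B s ^+ m * ((pi *+ 2) / 2)) by ring.
by rewrite S2 !doubleS -!addnn; field.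
Qed.

(** The mean of the [2 n]-th power of the cosine over a period: the central binomial coefficient
    divided by [4 ^ n]. *)
Definition wallis (n : nat) : R := \prod_(k < n) (k.*2.+1%:R / k.*2.+2%:R).

Lemma wallis_ge n : (n.*2.+1%:R : R)^-1 <= wallis n.
Proof.
rewrite /wallis; elim: n => [|n IHn]; first by rewrite big_ord0 invr1.
rewrite big_ord_recr /=; apply: (@le_trans _ _ (n.*2.+1%:R^-1 * (n.*2.+1%:R / n.*2.+2%:R))).
  by rewrite mulrA mulVf ?pnatr_eq0 // mul1r lef_pV2 ?posrE ?ltr0n // ler_nat doubleS.
by rewrite ler_wpM2r.
Qed.

Lemma mean_bump u i n g : contper g ->
  (forall z t, g (z + t *: unitv i) = g z) ->
  mean (fun z => bump u i z ^+ n * g z) = wallis n * mean g.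
Proof.
move=> cg ig; elim: n => [|n IHn].
  by rewrite /wallis big_ord0 mul1r; congr mean; apply/funext => z; rewrite mul1r.
by rewrite mean_bumpS // IHn mulrA /wallis big_ord_recr [_ * \prod_(_ < _) _]mulrC.
Qed.

Definition kernel u z := \prod_i bump u i z.

Lemma bump_unitv u i j z t : i != j -> bump u i (z + t *: unitv j) = bump u i z.
Proof. by move=> ij; rewrite /bump !mxE (negbTE ij) andbF mulr0 addr0. Qed.

(** [mean_bump] replaces Fubini: each factor is taken out while the remaining ones are constant in
    its direction. *)
Lemma mean_kernel u n : mean (fun z => kernel u z ^+ n) = wallis n ^+ 3.
Proof.
have -> : (fun z => kernel u z ^+ n) = (fun z => bump u ord0 z ^+ n *
   (bump u (lift ord0 ord0) z ^+ n * (bump u (lift ord0 (lift ord0 ord0)) z ^+ n * 1))).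
  by apply/funext => z; rewrite /kernel !big_ord_recl big_ord0 !(exprMn, expr1n).
have cb i := contperX n (contper_bump u i).
rewrite mean_bump.
- rewrite mean_bump.
  + rewrite (@mean_bump _ _ _ (fun=> 1)) //; last exact: contper_cst.
    by rewrite mean1 mulr1.
  + by apply: contperM => //; exact: contper_cst.
  + by move=> z t; rewrite bump_unitv.
- by apply: contperM => //; apply: contperM => //; exact: contper_cst.
- by move=> z t; rewrite !bump_unitv.
Qed.

Lemma contper_kernel u : contper (kernel u).
Proof.
have -> : kernel u = (fun z => bump u ord0 z * (bump u (lift ord0 ord0) z * (bump u (lift ord0 (lift ord0 ord0)) z * 1))).
  by apply/funext => z; rewrite /kernel !big_ord_recl big_ord0.
have cb := contper_bump u.
by apply: contperM => //; apply: contperM => //; apply: contperM => //; exact: contper_cst.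
Qed.

(** A factor [bump] turns a wave into a combination of three waves, so multiplication by [kernel]
    preserves orthogonality to all waves. The induction carries this stronger property, and the
    constant wave gives the conclusion. *)
Lemma mean_kernel_orthogonal u h n : contper h ->
  (forall xi phi, mean (fun z => h z * wave xi phi z) = 0) ->
  mean (fun z => h z * kernel u z ^+ n) = 0.
Proof.
move=> ch.
suff H (g : 'rV[R]_3 -> R) : contper g -> (forall xi phi, mean (fun z => g z * wave xi phi z) = 0) ->
    forall xi phi, mean (fun z => g z * kernel u z * wave xi phi z) = 0.
  move=> h0; have [] : contper (fun z => h z * kernel u z ^+ n) /\ (forall xi phi, mean (fun z => h z * kernel u z ^+ n * wave xi phi z) = 0).
    elim: n => [|n [cn IHn]]; first last.
      have E : (fun z => h z * kernel u z ^+ n.+1) = (fun z => h z * kernel u z ^+ n * kernel u z).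
        by apply/funext => z; rewrite exprSr mulrA.
      split; first by rewrite E; apply: contperM => //; exact: contper_kernel.
      move=> xi phi; rewrite -[RHS](H _ cn IHn xi phi); congr mean; apply/funext => z.
      by rewrite exprSr mulrA.
    have E : (fun z => h z * kernel u z ^+ 0) = h by apply/funext => z; rewrite mulr1.
    rewrite E; split=> // xi phi; rewrite -[RHS](h0 xi phi); congr mean; apply/funext => z.
    by rewrite mulr1.
  move=> _ /(_ 0 0) <-; congr mean; apply/funext => z.
  by rewrite /wave /phase big1 ?mul0r ?addr0 ?cos0 ?mulr1 // => i _; rewrite mxE mul0r.
have step i (f : 'rV[R]_3 -> R) : contper f -> (forall xi phi, mean (fun z => f z * wave xi phi z) = 0) ->
    forall xi phi, mean (fun z => f z * bump u i z * wave xi phi z) = 0.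
  move=> cf f0 xi phi; set eta := delta_mx 0 i : 'rV[int]_3; set psi := - (u 0 i * (pi *+ 2)).
  have -> : (fun z => f z * bump u i z * wave xi phi z) = (fun z => 1 / 2 * (f z * wave xi phi z) +
     1 / 4 * (f z * wave (eta + xi) (psi + phi) z + f z * wave (eta - xi) (psi - phi) z)).
    apply/funext => z; rewrite bump_wave -/eta -/psi.
    have := waveM eta psi xi phi z; set a := wave eta _ _; set b := wave xi _ _.
    set c := wave _ _ _; set d := wave _ _ _ => E.
    have -> : f z * (1 / 2 + 1 / 2 * a) * b = f z * (1 / 2 * b + 1 / 2 * (a * b)) by ring.
    by rewrite E; field.
  have cw xi' phi' := contperM cf (contper_wave xi' phi').
  have cw2 : contper (fun z => f z * wave (eta + xi) (psi + phi) z + f z * wave (eta - xi) (psi - phi) z).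
    by apply: contperD; exact: cw.
  rewrite meanD; [|by apply: contperZ; exact: cw|exact: contperZ].
  rewrite meanZ; last exact: cw.
  by rewrite meanZ // meanD ?f0 ?addr0 ?mulr0 ?addr0.
move=> cg g0 xi phi.
have -> : (fun z => g z * kernel u z * wave xi phi z) = 
  (fun z => g z * bump u ord0 z * bump u (lift ord0 ord0) z * bump u (lift ord0 (lift ord0 ord0)) z * wave xi phi z).
  by apply/funext => z; rewrite /kernel !big_ord_recl big_ord0 mulr1 !mulrA.
have cb := contper_bump u.
apply: (step _ _); first by apply: contperM => //; apply: contperM.
apply: (step _ _); first exact: contperM.
exact: (step _ _).
Qed.

End Mean.
Arguments wallis {R} n.
Arguments ivec {R} xi.
Arguments unitv {R} i.
Arguments wallis_ge {R} n.

(** * Uniqueness of Fourier coefficients *)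

Section FourierUniqueness.
Variable R : realType.
Implicit Types (h g : 'rV[R]_3 -> R) (z : 'rV[R]_3).

Lemma kernel_ge0 u z : 0 <= kernel u z.
Proof. by apply: prodr_ge0 => i _; exact: bump_ge0. Qed.

Lemma round_half (t : R) : exists k : int, `|t + k%:~R| <= 1 / 2.
Proof.
exists (- Num.floor (t + 1 / 2)).
have /andP[] := floor_itv (t + 1 / 2); rewrite rmorphD rmorphN /=.
set f := (_%:~R : R); move=> h1 h2; rewrite ler_norml; apply/andP; split; lra.
Qed.

(** One factor is at most the bound because the cosine decreases on [[0, pi]]; the other factors are
    at most one. *)
Lemma kernel_le_off (u z : 'rV[R]_3) (r : R) : 0 < r <= 1 / 2 ->
  (exists2 i, r <= `|z 0 i - u 0 i| & `|z 0 i - u 0 i| <= 1 / 2) ->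
  kernel u z <= (1 + cos (r * (pi *+ 2))) / 2.
Proof.
move=> /andP[r0 r1] [i h1 h2]; rewrite /kernel (bigD1 i) //=.
have pi0 := @pi_gt0 R.
apply: (@le_trans _ _ (bump u i z)).
  rewrite ler_piMr ?bump_ge0 //.
  suff /andP[] : 0 <= \prod_(j < 3 | j != i) bump u j z <= 1 by [].
  apply: (big_ind (fun x => 0 <= x <= 1)); first by rewrite ler01 lexx.
    by move=> x y /andP[x0 x1] /andP[y0 y1]; rewrite mulr_ge0 //= mulr_ile1.
  by move=> j _; rewrite bump_ge0 bump_le1.
rewrite /bump ler_pM2r ?invr_gt0 // lerD2l -(cos_norm (_ * _)) normrM (@ger0_norm _ (pi *+ 2)); last first.
  by rewrite mulrn_wge0 // ltW.
have a0 : 0 <= `|z 0 i - u 0 i| by [].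
rewrite le_eqVlt; case: (ltrgtP r `|z 0 i - u 0 i|) h1 => // [h|-> _]; last by rewrite eqxx.
move=> _; have b0 : 0 <= r * (pi *+ 2) by apply: mulr_ge0; [exact: ltW|apply: mulrn_wge0; exact: ltW].
have b1 : r * (pi *+ 2) < `|z 0 i - u 0 i| * (pi *+ 2) by rewrite ltr_pM2r // mulrn_wgt0.
have b2 : `|z 0 i - u 0 i| * (pi *+ 2) <= pi by rewrite -mulr_natr; nra.
have i1 : r * (pi *+ 2) \in `[0, pi] by rewrite in_itv /= b0 ltW // (lt_le_trans b1).
have i2 : `|z 0 i - u 0 i| * (pi *+ 2) \in `[0, pi] by rewrite in_itv /= b2 (le_trans b0) ?ltW.
by rewrite (ltr_cos i1 i2) b1 orbT.
Qed.

Lemma cos_lt1 (r : R) : 0 < r <= 1 / 2 -> cos (r * (pi *+ 2)) < 1.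
Proof.
move=> /andP[r0 r1]; have pi0 := @pi_gt0 R.
have a0 : 0 < r * (pi *+ 2) by rewrite mulr_gt0 // mulrn_wgt0.
have a1 : r * (pi *+ 2) <= pi by rewrite -mulr_natr; nra.
have h1 : r * (pi *+ 2) \in `[0, pi] by rewrite in_itv /= (ltW a0).
have h2 : (0 : R) \in `[0, pi] by rewrite in_itv /= lexx ltW.
by rewrite -[ltRHS]cos0 (ltr_cos h2 h1).
Qed.

Lemma bernoulli_ineq (x : R) n : 0 <= x -> 1 + n%:R * x <= (1 + x) ^+ n.
Proof.
move=> x0; elim: n => [|n IHn]; first by rewrite mul0r addr0.
rewrite exprS; apply: (@le_trans _ _ ((1 + x) * (1 + n%:R * x))).
  rewrite mulrDl mul1r mulrDr mulr1 -(natr1 n); have : 0 <= n%:R :> R by []; nra.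
by rewrite ler_wpM2l // addr_ge0.
Qed.

(** Exponential decay against the cubic lower bound from [wallis_ge]. In the application the left
    side bounds a contribution far from the centre of the kernel, and the right side is the mean of
    [d] times the [n]-th power of the kernel. *)
Lemma geometric_lt_wallis (q C d : R) : 0 <= q < 1 -> 0 <= C -> 0 < d ->
  exists n, C * q ^+ n < d * wallis n ^+ 3.
Proof.
move=> /andP[q0 q1] C0 d0.
(* [x] is chosen so that [q <= (1 + x) ^- 4], which beats the cubic decay of [wallis n ^+ 3]. *)
have [x [x0 x1 xq]] : exists x : R, [/\ 0 < x, x <= 1 & 15 * x = 1 - q].
  by exists ((1 - q) / 15); split; [lra|lra|field].
have qx : q * (1 + x) ^+ 4 <= 1.
  have : (1 + x) ^+ 4 <= 1 + 15 * x.
    have -> : (1 + x) ^+ 4 = 1 + 4 * x + 6 * x ^+ 2 + 4 * x ^+ 3 + x ^+ 4 by ring.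
    have hx k : x ^+ k.+1 <= x by rewrite -[leRHS]expr1 ler_wiXn2l // ltW.
    by have := hx 1%N; have := hx 2%N; have := hx 3%N; lra.
  have -> : 1 + 15 * x = 2 - q by rewrite xq; ring.
  by move=> h; nra.
(* The 27 is the cube of the 3 in [2 n + 1 <= 3 n]; comparing with the fourth power of [n * x]
   leaves one factor [n] once the cube is cancelled. *)
have [N HN] : exists N : nat, 27 * C < d * x ^+ 4 * N.+1%:R.
  have dx : 0 < d * x ^+ 4 by rewrite mulr_gt0 // exprn_gt0.
  exists (Num.truncn (27 * C / (d * x ^+ 4))).
  by rewrite [ltRHS]mulrC -ltr_pdivrMr // truncnS_gt.
exists N.+1; set n := N.+1.
have n0 : 0 < n%:R :> R by rewrite ltr0n.
have n1 : 1 <= n%:R :> R by rewrite ler1n.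
have h1 := @wallis_ge R n.
have h2 := bernoulli_ineq n (ltW x0).
set X := (1 + x) ^+ n in h2.
have X0 : 0 < X by rewrite exprn_gt0 // addr_gt0.
have qX : q ^+ n * X ^+ 4 <= 1.
  by rewrite /X -exprM mulnC exprM -exprMn exprn_ile1 // mulr_ge0 // exprn_ge0 // addr_ge0 // ltW.
have nx : (n%:R * x) ^+ 4 <= X ^+ 4.
  rewrite lerXn2r ?nnegrE ?mulr_ge0 ?(ltW n0) ?(ltW x0) ?(ltW X0) //.
  by apply: le_trans h2; rewrite lerDr.
have w0 : 0 < (n.*2.+1%:R : R)^-1 by rewrite invr_gt0 ltr0n.
have hw : (3 * n%:R)^-1 <= wallis n :> R.
  have E : n.*2.+1%:R = 2 * n%:R + 1 :> R by rewrite -natr1 -mul2n natrM.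
  apply: le_trans h1; rewrite E lef_pV2 ?posrE; lra.
have W3 : (3 * n%:R)^-1 ^+ 3 <= wallis n ^+ 3 :> R.
  by rewrite lerXn2r ?nnegrE ?invr_ge0 ?mulr_ge0 ?(ltW n0) // (le_trans _ hw) ?invr_ge0 ?mulr_ge0 ?(ltW n0).
apply: (@lt_le_trans _ _ (d * (3 * n%:R)^-1 ^+ 3)); last by rewrite ler_pM2l.
rewrite -(@ltr_pM2r _ ((n%:R * x) ^+ 4)) ?exprn_gt0 ?mulr_gt0 //.
apply: (@le_lt_trans _ _ C).
  rewrite -mulrA ler_piMr //; apply: le_trans qX.
  by rewrite ler_wpM2l // exprn_ge0.
have -> : d * (3 * n%:R)^-1 ^+ 3 * (n%:R * x) ^+ 4 = d * x ^+ 4 * n%:R / 27 :> R.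
  by field; rewrite gt_eqF.
by rewrite ltr_pdivlMr // mulrC.
Qed.

(* Testing [h] against powers of a trigonometric kernel which is largest on the lattice translates
   of a point where [h] is positive. *)
Lemma fourier_uniqueness h : contper h ->
  (forall xi phi, mean (fun z => h z * wave xi phi z) = 0) -> forall z, h z = 0.
Proof.
suff H g : contper g -> (forall xi phi, mean (fun z => g z * wave xi phi z) = 0) ->
    forall u, g u <= 0.
  move=> ch h0 z; apply/eqP; rewrite eq_le H //= -oppr_le0.
  apply: (H (fun z => - h z)) => [|xi phi]; first exact: contperN.
  rewrite -[RHS]oppr0 -(h0 xi phi) -meanN; last exact/contperM/contper_wave.
  by congr mean; apply/funext => w; rewrite mulNr.
move=> cg g0 u; rewrite leNgt; apply/negP => gu.
pose d := g u / 2; have d0 : 0 < d by rewrite divr_gt0.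
have [r r01 Hr] : exists2 r : R, 0 < r <= 1 / 2 & forall z, (forall i, `|z 0 i - u 0 i| < r) -> d <= g z.
  have /cvgrPdist_lt /(_ d d0) := cg.1 u.
  move=> /nbhs_ballP[e /= e0 He].
  exists (Num.min e (1 / 2)); first by rewrite lt_min e0 ge_min lexx orbT; apply/andP; split=> //; lra.
  move=> z hz; have /He : ball u e z.
    split=> // i j; rewrite ord1 /ball /= distrC; apply: lt_le_trans (hz j) _.
    by rewrite ge_min lexx.
  by rewrite /d /= ltr_norml => /andP[_]; lra.
pose q := (1 + cos (r * (pi *+ 2))) / 2.
have q01 : 0 <= q < 1.
  have := cos_lt1 r01; have := cos_geN1 (r * (pi *+ 2)); rewrite /q => *; apply/andP; split; lra.
(* An integer translation brings every coordinate of [z] within [1 / 2] of [u]: either all of them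
   are within [r], or one of them makes the kernel small. *)
have dich z : d <= g z \/ kernel u z <= q.
  pose k : 'rV[int]_3 := \row_i projT1 (cid (round_half (z 0 i - u 0 i))).
  have hk i : `|(z + ivec k) 0 i - u 0 i| <= 1 / 2.
    by rewrite !mxE; case: cid => /= l; rewrite addrAC.
  have [near|] := pselect (forall i, `|(z + ivec k) 0 i - u 0 i| < r).
    by left; rewrite -(cg.2 z k); exact: Hr.
  move=> /existsNP[i /negP]; rewrite -leNgt => far; right.
  by rewrite -((contper_kernel u).2 z k); apply: kernel_le_off => //; exists i.
have [C HC] := contper_bounded cg.
have C0 : 0 <= C by apply: le_trans (HC u).
have [n] := geometric_lt_wallis q01 (addr_ge0 C0 (ltW d0)) d0.
apply/negP; rewrite -leNgt.
have ck := contperX n (contper_kernel u).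
(* The contradiction is the mean of the pointwise bound [d * kernel u z ^+ n - (C + d) * q ^+ n <= g
   z * kernel u z ^+ n], whose right side has mean zero. *)
rewrite -(mean_kernel u) -(meanZ d ck) -subr_le0 -(mean_kernel_orthogonal u n cg g0).
rewrite -(mean_cst ((C + d) * q ^+ n)) -meanB; [|exact: contperZ|exact: contper_cst].
apply: mean_le; [by apply: contperB; [exact: contperZ|exact: contper_cst]|exact: contperM|].
move=> z; have k0 : 0 <= kernel u z ^+ n by rewrite exprn_ge0 // kernel_ge0.
have /andP[q0 _] := q01; have qn : 0 <= q ^+ n by rewrite exprn_ge0.
have [dg|kq] := dich z.
  apply: (@le_trans _ _ (d * kernel u z ^+ n)); last by rewrite ler_wpM2r.
  by rewrite gerBl mulr_ge0 // addr_ge0 // ltW.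
have : kernel u z ^+ n <= q ^+ n by rewrite lerXn2r ?nnegrE ?kernel_ge0.
have := HC z; rewrite ler_norml => /andP[gC _] kqn.
have Cd : 0 <= C + d by rewrite addr_ge0 // ltW.
have : (C + d) * kernel u z ^+ n <= (C + d) * q ^+ n by rewrite ler_wpM2l.
have : 0 <= (g z + C) * kernel u z ^+ n by rewrite mulr_ge0 // -lerBlDr sub0r.
rewrite !mulrDl; lra.
Qed.

End FourierUniqueness.

(** * Fourier coefficients *)

Section Fourier.
Local Open Scope complex_scope.
Variable R : realType.
Implicit Types (h g : 'rV[R]_3 -> R) (z : 'rV[R]_3) (phi psi : R) (xi eta : 'rV[int]_3).

(** The mean of [h] times the conjugate of [cwave xi], as [wave xi (pi / 2)] is minus the sine. *)
Definition fourier h (xi : 'rV[int]_3) : R[i] :=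
  mean (fun z => h z * wave xi 0 z) +i* mean (fun z => h z * wave xi (pi / 2) z).

Definition cwave (xi : 'rV[int]_3) z : R[i] := cos (phase xi z) +i* sin (phase xi z).

Lemma cwaveD xi eta z : cwave (xi + eta) z = cwave xi z * cwave eta z.
Proof.
rewrite /cwave phase_addl cosD sinD; apply/eqP; rewrite eq_complex /=.
by rewrite eqxx /= addrC [sin _ * _]mulrC.
Qed.

Lemma cwaveN xi z : cwave (- xi) z = conjc (cwave xi z).
Proof. by rewrite /cwave phaseN cosN sinN. Qed.

Lemma wave0 xi z : wave xi 0 z = cos (phase xi z).
Proof. by rewrite /wave addr0. Qed.

Lemma wave_pihalf xi z : wave xi (pi / 2) z = - sin (phase xi z).
Proof. by rewrite /wave cosDpihalf. Qed.

Lemma contper_hwave h xi phi : contper h -> contper (fun z => h z * wave xi phi z).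
Proof. by move=> ch; apply: contperM => //; exact: contper_wave. Qed.

Lemma mean_hwave_pderiv i h g xi phi : pderiv i h g -> contper h -> contper g ->
  mean (fun z => g z * wave xi phi z) =
  - ((xi 0 i)%:~R * (pi *+ 2)) * mean (fun z => h z * wave xi (phi + pi / 2) z).
Proof.
move=> d ch cg; apply/eqP; rewrite mulNr -addr_eq0 -meanZ -?meanD; first last.
- exact: contper_hwave.
- by apply: contperZ; exact: contper_hwave.
- exact: contper_hwave.
apply/eqP; apply: (@mean_pderiv _ i (fun z => h z * wave xi phi z)).
- move=> z s; have H := is_deriveM (d z s) (pderiv_wave i xi phi z s).
  by apply: is_derive_eq H _; rewrite /GRing.scale /=; ring.
- exact: contper_hwave.
- by apply: contperD; [|apply: contperZ]; exact: contper_hwave.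
Qed.

Lemma fourier_pderiv i h g xi : pderiv i h g -> contper h -> contper g ->
  fourier g xi = (0 +i* ((xi 0 i)%:~R * (pi *+ 2))) * fourier h xi.
Proof.
move=> d ch cg; rewrite /fourier !(mean_hwave_pderiv _ _ d) // add0r.
apply/eqP; rewrite eq_complex /= !mul0r sub0r add0r mulNr eqxx /=.
have -> : (fun z => h z * wave xi (pi / 2 + pi / 2) z) = (fun z => - (h z * wave xi 0 z)).
  by apply/funext => z; rewrite /wave addr0 addrA !cosDpihalf sinDpihalf mulrN.
rewrite meanN; last exact: contper_hwave.
by rewrite mulrNN.
Qed.

Lemma fourierN h xi : contper h -> fourier h (- xi) = conjc (fourier h xi).
Proof.
move=> ch; apply/eqP; rewrite eq_complex /=; apply/andP; split; apply/eqP.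
  by congr mean; apply/funext => z; rewrite !wave0 phaseN cosN.
rewrite -meanN; last exact: contper_hwave.
by congr mean; apply/funext => z; rewrite !wave_pihalf phaseN sinN mulrN.
Qed.

Lemma fourierD h g xi : contper h -> contper g ->
  fourier (fun z => h z + g z) xi = fourier h xi + fourier g xi.
Proof.
move=> ch cg; apply/eqP; rewrite eq_complex /= -!meanD; try exact: contper_hwave.
by apply/andP; split; apply/eqP; congr mean; apply/funext => z; rewrite mulrDl.
Qed.

Lemma fourierZ a h xi : contper h -> fourier (fun z => a * h z) xi = a%:C * fourier h xi.
Proof.
move=> ch; apply/eqP; rewrite eq_complex /= !mul0r subr0 addr0 -!meanZ; try exact: contper_hwave.
by apply/andP; split; apply/eqP; congr mean; apply/funext => z; rewrite mulrA.
Qed.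

Lemma fourierB h g xi : contper h -> contper g ->
  fourier (fun z => h z - g z) xi = fourier h xi - fourier g xi.
Proof.
move=> ch cg; rewrite fourierD //; last exact: contperN.
congr (_ + _); have := fourierZ (-1) xi cg.
under eq_fun do rewrite mulN1r; move=> ->.
by rewrite rmorphN1 mulN1r.
Qed.

Lemma fourier_sum (I : Type) (s : seq I) (F : I -> 'rV[R]_3 -> R) xi :
  (forall i, contper (F i)) ->
  fourier (fun z => \sum_(i <- s) F i z) xi = \sum_(i <- s) fourier (F i) xi.
Proof.
move=> cF; elim: s => [|i s IHs].
  rewrite big_nil; under eq_fun do rewrite big_nil -(mul0r 0).
  rewrite (@fourierZ 0 (fun=> 0)); last exact: contper_cst.
  by rewrite rmorph0 mul0r.
rewrite big_cons -IHs -fourierD //; last exact: contper_sum.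
by congr fourier; apply/funext => z; rewrite big_cons.
Qed.

Lemma fourier_eq0 h : contper h -> (forall xi, fourier h xi = 0) -> forall z, h z = 0.
Proof.
move=> ch h0; apply: fourier_uniqueness => // xi phi.
have /eqP := h0 xi; rewrite eq_complex /= => /andP[/eqP m0 /eqP m1].
have -> : (fun z => h z * wave xi phi z) =
    (fun z => cos phi * (h z * wave xi 0 z) + sin phi * (h z * wave xi (pi / 2) z)).
  by apply/funext => z; rewrite wave0 wave_pihalf /wave cosD; ring.
rewrite meanD ?meanZ ?m0 ?m1 ?mulr0 ?addr0 //; try exact: contper_hwave.
- by apply: contperZ; exact: contper_hwave.
- by apply: contperZ; exact: contper_hwave.
Qed.

Lemma mean_wave_if xi phi : mean (wave xi phi) = cos phi *+ (xi == 0).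
Proof.
case: eqVneq => [->|x0]; last exact: mean_wave.
rewrite mulr1n -[RHS]mean_cst; congr mean; apply/funext => z.
by rewrite /wave /phase big1 ?mul0r ?add0r // => i _; rewrite mxE mul0r.
Qed.

Lemma mean_wave_wave xi phi eta psi :
  mean (fun z => wave xi phi z * wave eta psi z) =
  1 / 2 * (cos (phi + psi) *+ (xi == - eta) + cos (phi - psi) *+ (xi == eta)).
Proof.
rewrite (funext (waveM xi phi eta psi)) meanZ; last by apply: contperD; exact: contper_wave.
by rewrite (meanD (contper_wave _ _) (contper_wave _ _)) !mean_wave_if addr_eq0 subr_eq0.
Qed.

Lemma fourier_wave0 xi eta :
  fourier (wave xi 0) eta = (1 / 2 * ((xi == - eta)%:R + (xi == eta)%:R))%:C.
Proof.
rewrite /fourier !mean_wave_wave !add0r oppr0 cosN cos0 cos_pihalf.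
by rewrite !mul0rn addr0 mulr0.
Qed.

Lemma fourier_wave_pihalf xi eta :
  fourier (wave xi (pi / 2)) eta = 0 +i* (1 / 2 * ((xi == eta)%:R - (xi == - eta)%:R)).
Proof.
rewrite /fourier !mean_wave_wave subr0 addr0 subrr -splitr cospi cos0 cos_pihalf.
by rewrite !mul0rn addr0 mulr0 addrC mulNrn.
Qed.

Lemma Re_cwave (c : R[i]) xi z :
  complex.Re (c * cwave xi z) = complex.Re c * wave xi 0 z + complex.Im c * wave xi (pi / 2) z.
Proof. by rewrite wave0 wave_pihalf mulrN; case: c. Qed.

Lemma sum_eq_uniq (V : nmodType) (T : eqType) (s : seq T) (F : T -> V) (x : T) : uniq s ->
  \sum_(y <- s) F y *+ (y == x) = F x *+ (x \in s).
Proof.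
move=> us; case: (boolP (x \in s)) => xs.
  rewrite (bigD1_seq x) //= eqxx big1 ?addr0 // => y /negbTE ->; exact: mulr0n.
rewrite big1_seq // => y /andP[_ ys]; by case: eqP => // yx; rewrite -yx ys in xs.
Qed.

(** The trigonometric polynomial [F] has the same coefficients as [h], so [fourier_eq0] identifies
    the two. The complex sum is real because negation permutes [Y] and conjugates the terms. *)
Lemma fourier_inversion h (Y : seq 'rV[int]_3) : contper h -> uniq Y ->
  (forall xi, (- xi \in Y) = (xi \in Y)) ->
  (forall xi, xi \notin Y -> fourier h xi = 0) ->
  forall z, (h z)%:C = \sum_(xi <- Y) fourier h xi * cwave xi z.
Proof.
move=> ch uY nY hY z.
pose c := fourier h.
pose F z := \sum_(xi <- Y) (complex.Re (c xi) * wave xi 0 z + complex.Im (c xi) * wave xi (pi / 2) z).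
have cw a xi phi : contper (fun z => a * wave xi phi z) by apply/contperZ/contper_wave.
have cF : contper F.
  by apply: contper_sum => xi; apply: contperD.
have fF eta : fourier F eta = c eta.
  rewrite fourier_sum; last by move=> xi; apply: contperD.
  transitivity (\sum_(xi <- Y) ((1 / 2)%:C * c xi *+ (xi == eta) + (1 / 2)%:C * conjc (c xi) *+ (xi == - eta))).
    apply: eq_bigr => xi _; rewrite fourierD // !fourierZ; try exact: contper_wave.
    rewrite fourier_wave0 fourier_wave_pihalf.
    case: (c xi) => a b; apply/eqP; rewrite eq_complex /=.
    by case: (xi == eta); case: (xi == - eta); rewrite /= ?mulr1n ?mulr0n; apply/andP; split; apply/eqP => /=; ring.
  have E1 := sum_eq_uniq (fun xi => (1 / 2)%:C * c xi) eta uY.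
  have E2 := sum_eq_uniq (fun xi => (1 / 2)%:C * conjc (c xi)) (- eta) uY.
  have cN : c (- eta) = conjc (c eta) by exact: fourierN.
  rewrite big_split /= E1 E2 nY cN conjcK -mulrnDl -mulrDl.
  case: (boolP (eta \in Y)) => [_|/hY]; last by rewrite /c => ->; rewrite mulr0n.
  by rewrite -rmorphD /= -splitr mul1r mulr1n.
have hF : h z = F z.
  apply/eqP; rewrite -subr_eq0; apply/eqP.
  apply: (@fourier_eq0 (fun z => h z - F z)) => [|xi]; first exact: contperB.
  by rewrite fourierB // fF subrr.
have FE : F z = complex.Re (\sum_(xi <- Y) c xi * cwave xi z).
  by rewrite raddf_sum; apply: eq_bigr => xi _; exact/esym/Re_cwave.
rewrite hF FE -/c.
have : conjc (\sum_(xi <- Y) c xi * cwave xi z) = \sum_(xi <- Y) c xi * cwave xi z.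
  rewrite rmorph_sum.
  have pY : perm_eq Y (map -%R Y).
    apply: uniq_perm => //; first by rewrite map_inj_uniq //; exact: oppr_inj.
    by move=> xi; rewrite -[xi in RHS]opprK (mem_map oppr_inj) nY.
  rewrite [RHS](perm_big _ pY) big_map; apply: eq_bigr => xi _.
  by rewrite rmorphM cwaveN /c fourierN.
case: (\sum_(xi <- Y) _) => a b /eqP; rewrite eq_complex /= => /andP[_ /eqP b0].
by apply/eqP; rewrite eq_complex /= eqxx /=; apply/eqP; lra.
Qed.

(** Linear independence of characters. The frequencies [zeta i] may repeat, since the application
    sums over pairs, so coefficients are collected at each [eta]; multiplication by the wave of
    [- eta] reduces this to a mean value. *)
Lemma cwave_indep (I : Type) (s : seq I) (C : I -> R[i]) (zeta : I -> 'rV[int]_3) (K : R[i]) :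
  (forall z, \sum_(i <- s) C i * cwave (zeta i) z = K) ->
  forall eta, \sum_(i <- s) C i *+ (zeta i == eta) = K *+ (eta == 0).
Proof.
have ReH (J : Type) (t : seq J) (D : J -> R[i]) (xi : J -> 'rV[int]_3) :
    mean (fun z => complex.Re (\sum_(j <- t) D j * cwave (xi j) z)) =
    \sum_(j <- t) complex.Re (D j) *+ (xi j == 0).
  under eq_fun do rewrite raddf_sum.
  have cw a x phi : contper (fun z => a * wave x phi z) by apply/contperZ/contper_wave.
  rewrite mean_sum => [|j]; last by rewrite (funext (Re_cwave _ _)); exact: contperD.
  apply: eq_bigr => j _; rewrite (funext (Re_cwave _ _)) meanD // !meanZ; try exact: contper_wave.
  by rewrite !mean_wave_if cos0 cos_pihalf mul0rn mulr0 addr0 mulrnAr mulr1.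
have H (J : Type) (t : seq J) (D : J -> R[i]) (xi : J -> 'rV[int]_3) :
    (forall z, \sum_(j <- t) D j * cwave (xi j) z = 0) -> \sum_(j <- t) D j *+ (xi j == 0) = 0.
  move=> D0; apply/eqP; rewrite eq_complex; apply/andP; split; apply/eqP.
    rewrite raddf_sum -[RHS](mean_cst 0); under [in RHS]eq_fun => z do rewrite -[0](raddf0 (@complex.Re R)) -(D0 z).
    rewrite ReH; apply: eq_bigr => j _; exact: raddfMn.
  (* Multiplication by [- 'i] moves the imaginary part of a coefficient to the real part. *)
  have D1 z : \sum_(j <- t) (- 'i * D j) * cwave (xi j) z = 0.
    by under eq_bigr do rewrite -mulrA; rewrite -mulr_sumr D0 mulr0.
  rewrite raddf_sum -[RHS](mean_cst 0); under [in RHS]eq_fun => z do rewrite -[0](raddf0 (@complex.Re R)) -(D1 z).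
  rewrite ReH; apply: eq_bigr => j _; rewrite raddfMn /=; congr (_ *+ _).
  by case: (D j) => a b /=; ring.
move=> CK eta.
(* The index [None] stands for the constant, as a term with coefficient [- K] and frequency zero. *)
have /H : forall z, \sum_(j <- rcons (map Some s) None) (if j is Some i then C i else - K) *
    cwave ((if j is Some i then zeta i else 0) - eta) z = 0.
  move=> z; under eq_bigr do rewrite cwaveD mulrA.
  rewrite -mulr_suml big_rcons big_map /= CK.
  have -> : cwave 0 z = 1.
    rewrite /cwave /phase big1 ?mul0r ?cos0 ?sin0 // => i _; by rewrite mxE mul0r.
  by rewrite mulr1 subrr mul0r.
rewrite big_rcons big_map /= => /eqP; rewrite sub0r oppr_eq0 mulNrn.
under eq_bigr do rewrite subr_eq0.
by rewrite subr_eq0 => /eqP.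
Qed.

End Fourier.

(** * Rational linear algebra *)

Section Rational.
Variable R : realType.
Implicit Types (x y t : R).

Definition israt x := exists r : rat, x = ratr r.

Lemma israt_int (k : int) : israt k%:~R.
Proof. by exists k%:~R; rewrite ratr_int. Qed.

Lemma israt_nat (n : nat) : israt n%:R.
Proof. exact: (israt_int n). Qed.

Lemma israt0 : israt 0. Proof. exact: (israt_nat 0). Qed.

Lemma israt1 : israt 1. Proof. exact: (israt_nat 1). Qed.

Lemma isratD x y : israt x -> israt y -> israt (x + y).
Proof. by move=> [r ->] [s ->]; exists (r + s); rewrite rmorphD. Qed.

Lemma isratN x : israt x -> israt (- x).
Proof. by move=> [r ->]; exists (- r); rewrite rmorphN. Qed.

Lemma isratM x y : israt x -> israt y -> israt (x * y).
Proof. by move=> [r ->] [s ->]; exists (r * s); rewrite rmorphM. Qed.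

Lemma isratV x : israt x -> israt x^-1.
Proof. by move=> [r ->]; exists r^-1; rewrite fmorphV. Qed.

Lemma isratB x y : israt x -> israt y -> israt (x - y).
Proof. by move=> rx ry; apply: isratD => //; exact: isratN. Qed.

Lemma isratX x n : israt x -> israt (x ^+ n).
Proof. by move=> [r ->]; exists (r ^+ n); rewrite rmorphXn. Qed.

End Rational.

Ltac ratt := repeat first [assumption | apply: isratD | apply: isratB | apply: isratN | apply: isratM
  | apply: isratV | apply: isratX | exact: israt1 | exact: israt0 | exact: israt_nat].

Section QuadraticField.
Variable R : realType.
Implicit Types (x y t : R).

Definition rat_span t : set R := [set x | exists a b, [/\ israt a, israt b & x = a + b * t]].

Lemma rat_span_rat t x : israt x -> rat_span t x.
Proof. by move=> rx; exists x, 0; split; [|exact: israt0|rewrite mul0r addr0]. Qed.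

(** The equation may be reducible, so rational [t] are included. *)
Definition quadratic t := exists p q, [/\ israt p, israt q & t ^+ 2 = p * t + q].

Lemma quadratic0 : quadratic 0.
Proof. by exists 0, 0; split; [exact: israt0|exact: israt0|rewrite expr2 !mulr0 addr0]. Qed.

Lemma rat_spanB t x y : rat_span t x -> rat_span t y -> rat_span t (x - y).
Proof.
move=> [a [b [ra rb ->]]] [c [d [rc rd ->]]]; exists (a - c), (b - d).
by split; [ratt|ratt|ring].
Qed.

Lemma rat_spanM t x y : quadratic t -> rat_span t x -> rat_span t y -> rat_span t (x * y).
Proof.
move=> [p [q [rp rq E]]] [a [b [ra rb ->]]] [c [d [rc rd ->]]].
exists (a * c + b * d * q), (a * d + b * c + b * d * p); split; [by ratt|by ratt|].
have -> : (a + b * t) * (c + d * t) = a * c + (a * d + b * c) * t + b * d * t ^+ 2 by ring.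
by rewrite E; ring.
Qed.

Lemma rat_spanV t x : quadratic t -> rat_span t x -> rat_span t x^-1.
Proof.
move=> [p [q [rp rq E]]] [a [b [ra rb ->]]].
have [->|x0] := eqVneq (a + b * t) 0; first by rewrite invr0; exact/rat_span_rat/israt0.
pose N := a ^+ 2 + a * b * p - b ^+ 2 * q.
have EN : (a + b * t) * (a + b * p - b * t) = N.
  have -> : (a + b * t) * (a + b * p - b * t) = a ^+ 2 + a * b * p + b ^+ 2 * p * t - b ^+ 2 * t ^+ 2 by ring.
  by rewrite E /N; ring.
have rN : israt N by rewrite /N; ratt.
(* The norm [N] can vanish when the equation of [t] is reducible; then the conjugate factor is zero
   and [b * t] is rational. *)
have [N0|N0] := eqVneq N 0; last first.
  exists ((a + b * p) / N), (- b / N); split; [by ratt|by ratt|].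
  apply: (mulfI x0); rewrite divff //.
  have -> : (a + b * t) * ((a + b * p) / N + - b / N * t) = ((a + b * t) * (a + b * p - b * t)) / N by ring.
  by rewrite EN divff.
have {}EN : a + b * p - b * t = 0.
  by move/eqP: EN; rewrite N0 mulf_eq0 (negbTE x0) => /eqP.
have bt : b * t = a + b * p by lra.
by apply: rat_span_rat; rewrite bt; ratt.
Qed.

Lemma rat_spanD t x y : rat_span t x -> rat_span t y -> rat_span t (x + y).
Proof.
move=> [a [b [ra rb ->]]] [c [d [rc rd ->]]]; exists (a + c), (b + d).
by split; [ratt|ratt|ring].
Qed.

Lemma rat_span_mulmx t m n p (A : 'M[R]_(m, n)) (B : 'M[R]_(n, p)) : quadratic t ->
  (forall i j, rat_span t (A i j)) -> (forall i j, rat_span t (B i j)) ->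
  forall i j, rat_span t ((A *m B) i j).
Proof.
move=> qt hA hB i j; rewrite mxE; apply: big_ind; first exact/rat_span_rat/israt0.
  exact: rat_spanD.
by move=> k _; exact: rat_spanM.
Qed.

Lemma rat_span_subfield t : quadratic t -> subfield (rat_span t).
Proof.
move=> qt; split=> [|x y|x y]; rewrite !inE.
- exact/rat_span_rat/israt1.
- exact: rat_spanB.
- by move=> sx sy; apply: rat_spanM => //; exact: rat_spanV.
Qed.

(** The coordinates of the [d] basis elements with respect to [1] and [t] form a rational matrix
    with two columns; for [d > 2] a relation between its rows gives zero a second representation in
    the basis. *)
Lemma degree_rat_span (K : set R) t d : subfield K -> degree_over_rat K d -> (2 < d)%N ->
  ~ K `<=` rat_span t.
Proof.
move=> sK [b [bK ub]] d2 Kt.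
have /choice[f Hf] : forall i, exists uv : rat * rat, b i = ratr uv.1 + ratr uv.2 * t.
  by move=> i; have [u [v [[u' ->] [v' ->] E]]] := Kt _ (bK i); exists (u', v').
pose M : 'M[rat]_(d, 2) := \matrix_(i, j) if j == 0 then (f i).1 else (f i).2.
have /rowV0Pn[r /sub_kermxP rM r0] : kermx M != 0.
  by rewrite -mxrank_eq0 mxrank_ker -lt0n subn_gt0 (leq_ltn_trans (rank_leq_col M)).
have K0 : K 0.
  by case: sK => [K1 KB _]; have := KB 1 1 K1 K1; rewrite subrr inE.
have [a [_ ua]] := ub 0 K0.
have a0 : a = 0.
  by apply: ua; rewrite big1 // => i _; rewrite mxE rmorph0 mul0r.
case/eqP: r0; rewrite -a0; apply/esym/ua.
have S (g : rat * rat -> rat) (j : 'I_2) : (forall i, M i j = g (f i)) -> \sum_i ratr (r 0 i) * ratr (g (f i)) = 0 :> R.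
  move=> Hg; transitivity (ratr ((r *m M) 0 j) : R); last by rewrite rM mxE rmorph0.
  by rewrite mxE rmorph_sum; apply: eq_bigr => i _; rewrite Hg rmorphM.
have S0 : \sum_i ratr (r 0 i) * ratr (f i).1 = 0 :> R by apply: (S fst 0) => i; rewrite mxE.
have S1 : \sum_i ratr (r 0 i) * ratr (f i).2 = 0 :> R by apply: (S snd 1) => i; rewrite mxE.
under eq_bigr do rewrite Hf mulrDr mulrA.
by rewrite big_split /= -mulr_suml S0 S1 mul0r addr0.
Qed.

Lemma unit_sq_lt1 x y : `|x| < 1 -> y = x ^+ 2 * y -> y = 0.
Proof.
move=> x1 E; have : x ^+ 2 < 1 by rewrite -real_normK ?num_real // expr_lt1.
have /eqP : (1 - x ^+ 2) * y = 0 by rewrite mulrBl mul1r -E subrr.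
by rewrite mulf_eq0 subr_eq0 => /orP[/eqP <-|/eqP //]; rewrite ltxx.
Qed.

(** Three linear equations solved by cross products, with the contribution of [C] kept apart: if [A]
    and [B] are rational and nothing is known of [C], the formulas describe a line whose direction
    is the cross product of the first two rows, with parameter [C / D]. *)
Lemma cramer3 (x1 x2 x3 a1 a2 a3 b1 b2 b3 c1 c2 c3 : R) :
  let D := (a2 * b3 - a3 * b2) * c1 + (a3 * b1 - a1 * b3) * c2 + (a1 * b2 - a2 * b1) * c3 in
  let A := x1 * a1 + x2 * a2 + x3 * a3 in
  let B := x1 * b1 + x2 * b2 + x3 * b3 in
  let C := x1 * c1 + x2 * c2 + x3 * c3 in
  D != 0 ->
  [/\ x1 = (A * (b2 * c3 - b3 * c2) + B * (c2 * a3 - c3 * a2)) / D + C / D * (a2 * b3 - a3 * b2),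
      x2 = (A * (b3 * c1 - b1 * c3) + B * (c3 * a1 - c1 * a3)) / D + C / D * (a3 * b1 - a1 * b3) &
      x3 = (A * (b1 * c2 - b2 * c1) + B * (c1 * a2 - c2 * a1)) / D + C / D * (a1 * b2 - a2 * b1)].
Proof. by move=> D A B C D0; split; rewrite /A /B /C /D; field; exact: D0. Qed.

Lemma two_mul_lt (g a b : R) : `|g| < 1 -> a ^+ 2 + b ^+ 2 = 2 * g * a * b -> a = 0 /\ b = 0.
Proof.
rewrite ltr_norml => /andP[g1 g2] E.
have : 0 < (1 - g) / 2 by lra.
have : 0 < (1 + g) / 2 by lra.
have := sqr_ge0 (a - b); have := sqr_ge0 (a + b) => h1 h2 h3 h4.
have : (1 - g) / 2 * (a + b) ^+ 2 + (1 + g) / 2 * (a - b) ^+ 2 = 0.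
  by transitivity (a ^+ 2 + b ^+ 2 - 2 * g * a * b); [field|rewrite E subrr].
move=> S0; have k1 := mulr_ge0 (ltW h4) h1; have k2 := mulr_ge0 (ltW h3) h2.
have /eqP : (1 - g) / 2 * (a + b) ^+ 2 = 0 by lra.
have /eqP : (1 + g) / 2 * (a - b) ^+ 2 = 0 by lra.
rewrite !(mulf_eq0 _ (_ ^+ 2)) !sqrf_eq0 (gt_eqF h3) (gt_eqF h4) /= => /eqP ? /eqP ?.
by split; lra.
Qed.

(* [(o1 w, o2 w, o3 w)] stands for the off-diagonal entries of [w^T w] and [(al, be, ga)] for those of
   a positive definite matrix with unit diagonal, whose adjugate has off-diagonal entries
   [(be * ga - al, al * ga - be, al * be - ga)]. If the vectors [(o1 w, o2 w, o3 w)] span a plane with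
   normal [n], then [(al, be, ga)] lies on a rational line with direction [n], and orthogonality of [n]
   to the adjugate entries is a rational quadratic equation for the parameter on that line. *)
Lemma off_diagonal_line (T : eqType) (Y : seq T) (Z : set T) (o1 o2 o3 b : T -> R) (al be ga : R) :
  `|al| < 1 -> `|be| < 1 -> `|ga| < 1 ->
  (forall t, quadratic t -> ~ [/\ rat_span t al, rat_span t be & rat_span t ga]) ->
  (forall w, Z w -> [/\ israt (o1 w), israt (o2 w) & israt (o3 w)]) ->
  (forall w, Z w -> israt (al * o1 w + be * o2 w + ga * o3 w)) ->
  (forall w, w \in Y -> Z w) ->
  be * ga - al = \sum_(w <- Y) b w * o1 w ->
  al * ga - be = \sum_(w <- Y) b w * o2 w ->
  al * be - ga = \sum_(w <- Y) b w * o3 w ->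
  exists2 v, v \in Y & [/\ (o1 v != 0) || (o2 v != 0), (o1 v != 0) || (o3 v != 0), (o2 v != 0) || (o3 v != 0) &
    forall w, Z w -> [/\ o2 v * o3 w = o3 v * o2 w, o3 v * o1 w = o1 v * o3 w &
                      o1 v * o2 w = o2 v * o1 w]].
Proof.
move=> al1 be1 ga1 irr rZ rho YZ q1 q2 q3.
have notrat : ~ [/\ israt al, israt be & israt ga].
  by move=> [ra rb rg]; apply: (irr 0 quadratic0); split; apply: rat_span_rat.
have sum0 (o : T -> R) : (forall w, w \in Y -> o w = 0) -> \sum_(y <- Y) b y * o y = 0.
  by move=> o0; rewrite big1_seq // => y /andP[_ yY]; rewrite o0 // mulr0.
(* If all off-diagonal entries were zero, the adjugate would be diagonal, which forces [al], [be]
   and [ga] to vanish. *)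
have [v vY ov] : exists2 v, v \in Y & (o1 v != 0) || (o2 v != 0) || (o3 v != 0).
  apply: contrapT => H; have o0 (y : T) : y \in Y -> [/\ o1 y = 0, o2 y = 0 & o3 y = 0].
    move=> yY; have : ~~ ((o1 y != 0) || (o2 y != 0) || (o3 y != 0)).
      by apply/negP => h; apply: H; exists y.
    by rewrite !negb_or !negbK => /andP[/andP[/eqP ? /eqP ?] /eqP ?]; split.
  move: q1 q2 q3; rewrite !sum0; try by move=> y /o0[].
  move=> q1 q2 q3; apply: notrat.
  have a0 : al = 0.
    apply: (unit_sq_lt1 ga1); transitivity (be * ga); first by lra.
    by rewrite (_ : be = al * ga); [ring|lra].
  have b0 : be = 0 by rewrite a0 in q2; lra.
  have g0 : ga = 0 by rewrite a0 in q3; lra.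
  by rewrite a0 b0 g0; split; exact: israt0.
have [r1 r2 r3] := rZ _ (YZ _ vY); have r4 := rho _ (YZ _ vY).
have par w : Z w -> [/\ o2 v * o3 w = o3 v * o2 w, o3 v * o1 w = o1 v * o3 w &
                      o1 v * o2 w = o2 v * o1 w].
  move=> Zw; apply: contrapT => ncol.
  have [s1 s2 s3] := rZ _ Zw; have r5 := rho _ Zw.
  pose n1 := o2 v * o3 w - o3 v * o2 w.
  pose n2 := o3 v * o1 w - o1 v * o3 w.
  pose n3 := o1 v * o2 w - o2 v * o1 w.
  have [rn1 rn2 rn3] : [/\ israt n1, israt n2 & israt n3] by split; rewrite /n1 /n2 /n3; ratt.
  have N0 : n1 ^+ 2 + n2 ^+ 2 + n3 ^+ 2 != 0.
    apply/eqP => N0; apply: ncol.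
    have [z1 z2 z3] : [/\ n1 ^+ 2 = 0, n2 ^+ 2 = 0 & n3 ^+ 2 = 0].
      by have := sqr_ge0 n1; have := sqr_ge0 n2; have := sqr_ge0 n3; split; lra.
    by move/eqP: z1; move/eqP: z2; move/eqP: z3; rewrite !sqrf_eq0 !subr_eq0 => /eqP ? /eqP ? /eqP ?.
  (* A vector outside the plane would give three independent rational equations for
     [(al, be, ga)]. *)
  have [n0|] := pselect (forall u, Z u -> n1 * o1 u + n2 * o2 u + n3 * o3 u = 0); last first.
    move=> /existsNP[u /not_implyP[Zu /eqP D]]; apply: notrat.
    have [t1 t2 t3] := rZ _ Zu; have r6 := rho _ Zu.
    have [E1 E2 E3] := @cramer3 al be ga _ _ _ _ _ _ _ _ _ D.
    by split; [rewrite E1|rewrite E2|rewrite E3]; ratt.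
  have nq : n1 * (be * ga - al) + n2 * (al * ga - be) + n3 * (al * be - ga) = 0.
    rewrite q1 q2 q3 !mulr_sumr -!big_split /= big1_seq // => u /andP[_ uY].
    transitivity (b u * (n1 * o1 u + n2 * o2 u + n3 * o3 u)); first by ring.
    by rewrite n0 ?mulr0 //; exact: YZ.
  have Nn : n1 * n1 + n2 * n2 + n3 * n3 != 0 by rewrite -!expr2.
  (* With the normal itself as third row, the determinant is its squared length [N], and [tau] is
     the parameter on the line. *)
  have := @cramer3 al be ga (o1 v) (o2 v) (o3 v) (o1 w) (o2 w) (o3 w) n1 n2 n3 Nn.
  rewrite -/n1 -/n2 -/n3; set N := (n1 * n1 + _ + _) in Nn *.
  set tau := (al * n1 + be * n2 + ga * n3) / N.
  set A := al * o1 v + _ + _ in r4 *; set B := al * o1 w + _ + _ in r5 *.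
  set c1 := (_ / N); set c2 := ((_ + B * (n3 * _ - _)) / N); set c3 := ((_ + B * (n1 * _ - _)) / N).
  move=> [E1 E2 E3].
  have rN : israt N by rewrite /N; ratt.
  have [rc1 rc2 rc3] : [/\ israt c1, israt c2 & israt c3] by split; rewrite /c1 /c2 /c3; ratt.
  pose P2 := 3 * n1 * n2 * n3.
  pose P1 := 2 * (c3 * n1 * n2 + c2 * n1 * n3 + c1 * n2 * n3) - N.
  pose P0 := n1 * (c2 * c3 - c1) + n2 * (c1 * c3 - c2) + n3 * (c1 * c2 - c3).
  have [rP2 rP1 rP0] : [/\ israt P2, israt P1 & israt P0] by split; rewrite /P2 /P1 /P0; ratt.
  have poly : P2 * tau ^+ 2 + P1 * tau + P0 = 0.
    by rewrite -nq E1 E2 E3 /P2 /P1 /P0 /N; ring.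
  have inspan x c n : x = c + tau * n -> israt c -> israt n -> rat_span tau x.
    by move=> -> rc rn; exists c, n; split=> //; rewrite mulrC.
  (* The equation makes [tau] quadratic if [P2] is nonzero, and rational if [P2] vanishes but [P1]
     does not. The degenerate case, where both vanish, remains. *)
  have [P20|P20] := eqVneq P2 0; last first.
    apply: (irr tau); last by split; [exact: inspan E1 _ _|exact: inspan E2 _ _|exact: inspan E3 _ _].
    exists (- P1 / P2), (- P0 / P2); split; [by ratt|by ratt|].
    apply: (mulfI P20); transitivity (- P1 * tau - P0); first by lra.
    by field.
  have [P10|P10] := eqVneq P1 0; last first.
    have rt : israt tau.
      rewrite (_ : tau = - P0 / P1); first by ratt.
      by apply: (mulfI P10); transitivity (- P0); [rewrite P20 in poly; lra|field].
    by apply: notrat; rewrite E1 E2 E3; split; ratt.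
  (* Because [P2 = 0], the rational [c1], [c2], [c3] may be replaced by [al], [be], [ga] in
     [P1 = 0]. One coordinate of the normal is zero, so this is the vanishing of a definite binary
     form at the other two, and the normal would be zero. *)
  have {P10} NE : N = 2 * (ga * n1 * n2 + be * n1 * n3 + al * n2 * n3).
    have : N = 2 * (c3 * n1 * n2 + c2 * n1 * n3 + c1 * n2 * n3) by move: P10; rewrite /P1; lra.
    move=> ->; rewrite E1 E2 E3.
    transitivity (2 * (c3 * n1 * n2 + c2 * n1 * n3 + c1 * n2 * n3) + 2 * tau * P2); last by rewrite /P2; ring.
    by rewrite P20; ring.
  move/eqP: P20; rewrite /P2 !mulf_eq0 pnatr_eq0 /= -!orbA => /or3P[] /eqP z.
  - have [z1 z2] : n2 = 0 /\ n3 = 0.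
      by apply: (two_mul_lt al1); move: NE; rewrite /N z => NE; transitivity (0 * 0 + n2 * n2 + n3 * n3); [ring|rewrite NE; ring].
    by case/eqP: Nn; rewrite /N z z1 z2 !mul0r !addr0.
  - have [z1 z2] : n1 = 0 /\ n3 = 0.
      by apply: (two_mul_lt be1); move: NE; rewrite /N z => NE; transitivity (n1 * n1 + 0 * 0 + n3 * n3); [ring|rewrite NE; ring].
    by case/eqP: Nn; rewrite /N z z1 z2 !mul0r !addr0.
  - have [z1 z2] : n1 = 0 /\ n2 = 0.
      by apply: (two_mul_lt ga1); move: NE; rewrite /N z => NE; transitivity (n1 * n1 + n2 * n2 + 0 * 0); [ring|rewrite NE; ring].
    by case/eqP: Nn; rewrite /N z z1 z2 !mul0r !addr0.
(* If two of the three entries at [v] were zero, they would be zero at every [w] by parallelism. Two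
   adjugate entries would then vanish, hence two of [al], [be], [ga], and the rational condition at
   [v] would make the third one rational. *)
exists v => //; split=> //.
- apply/negPn; rewrite negb_or !negbK; apply/negP => /andP[/eqP z1 /eqP z2].
  have z3 : o3 v != 0 by move: ov; rewrite z1 z2 eqxx.
  apply: notrat.
  have [h1 h2] : be * ga - al = 0 /\ al * ga - be = 0.
    rewrite q1 q2; split; apply: sum0 => w /YZ /par [] H1 H2 _; apply: (mulfI z3); rewrite mulr0.
      by rewrite H2 z1 mul0r.
    by rewrite -H1 z2 mul0r.
  have a0 : al = 0.
    apply: (unit_sq_lt1 ga1); transitivity (be * ga); first by lra.
    by rewrite (_ : be = al * ga); [ring|lra].
  have b0 : be = 0 by rewrite a0 in h2; lra.
  rewrite a0 b0; split; [exact: israt0|exact: israt0|].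
  rewrite (_ : ga = (al * o1 v + be * o2 v + ga * o3 v) / o3 v); first by ratt.
  by rewrite a0 b0 !mul0r !add0r mulfK.
- apply/negPn; rewrite negb_or !negbK; apply/negP => /andP[/eqP z1 /eqP z2].
  have z3 : o2 v != 0 by move: ov; rewrite z1 z2 eqxx orbF.
  apply: notrat.
  have [h1 h2] : be * ga - al = 0 /\ al * be - ga = 0.
    rewrite q1 q3; split; apply: sum0 => w /YZ /par [] H1 _ H2; apply: (mulfI z3); rewrite mulr0.
      by rewrite -H2 z1 mul0r.
    by rewrite H1 z2 mul0r.
  have a0 : al = 0.
    apply: (unit_sq_lt1 be1); transitivity (be * ga); first by lra.
    by rewrite (_ : ga = al * be); [ring|lra].
  have b0 : ga = 0 by rewrite a0 in h2; lra.
  rewrite a0 b0; split; [exact: israt0| |exact: israt0].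
  rewrite (_ : be = (al * o1 v + be * o2 v + ga * o3 v) / o2 v); first by ratt.
  by rewrite a0 b0 !mul0r add0r addr0 mulfK.
- apply/negPn; rewrite negb_or !negbK; apply/negP => /andP[/eqP z1 /eqP z2].
  have z3 : o1 v != 0 by move: ov; rewrite z1 z2 eqxx !orbF.
  apply: notrat.
  have [h1 h2] : al * ga - be = 0 /\ al * be - ga = 0.
    rewrite q2 q3; split; apply: sum0 => w /YZ /par [] _ H1 H2; apply: (mulfI z3); rewrite mulr0.
      by rewrite H2 z1 mul0r.
    by rewrite -H1 z2 mul0r.
  have a0 : be = 0.
    apply: (unit_sq_lt1 al1); transitivity (al * ga); first by lra.
    by rewrite (_ : ga = al * be); [ring|lra].
  have b0 : ga = 0 by rewrite a0 in h2; lra.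
  rewrite a0 b0; split; [|exact: israt0|exact: israt0].
  rewrite (_ : al = (al * o1 v + be * o2 v + ga * o3 v) / o1 v); first by ratt.
  by rewrite a0 b0 !mul0r !addr0 mulfK.
Qed.

End QuadraticField.

(** * Rigidity of the spectrum *)

Section Spectrum.
Variable R : realType.
Ltac span := repeat first [assumption | apply: rat_spanB | apply: rat_spanD | apply: rat_spanM => // | apply: rat_spanV => //].

Lemma sum3 (V : nmodType) (F : 'I_3 -> V) : \sum_i F i = F 0 + F 1 + F 2.
Proof.
rewrite !big_ord_recl big_ord0 addr0 addrA.
by congr (_ + F _ + F _); apply: val_inj.
Qed.

Lemma ord3P (P : 'I_3 -> Prop) : P 0 -> P 1 -> P 2 -> forall i, P i.
Proof.
move=> p0 p1 p2 [[|[|[|i]]] hi] //.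
- by rewrite (_ : Ordinal hi = 0) //; apply: val_inj.
- by rewrite (_ : Ordinal hi = 1) //; apply: val_inj.
- by rewrite (_ : Ordinal hi = 2) //; apply: val_inj.
Qed.

Lemma gramE (B : 'M[R]_3) : gram B = B *m B^T.
Proof.
apply/matrixP => i j; rewrite !mxE; apply: eq_bigr => k _.
by rewrite !mxE.
Qed.

Lemma gram_unit (B : 'M[R]_3) : B \in unitmx -> gram B \in unitmx.
Proof. by move=> uB; rewrite gramE unitmx_mul unitmx_tr uB. Qed.

Lemma gram_sym (B : 'M[R]_3) : (gram B)^T = gram B.
Proof. by rewrite gramE trmx_mul trmxK. Qed.

Definition form (A : 'M[R]_3) (v : 'rV[R]_3) : R := (v *m A *m v^T) 0 0.

Lemma formZ A (s : R) v : form A (s *: v) = s ^+ 2 * form A v.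
Proof. by rewrite /form -scalemxAl linearZ /= -scalemxAl -scalemxAr scalerA mxE expr2. Qed.

Lemma delta_form (A : 'M[R]_3) i j : ((delta_mx 0 i : 'rV_3) *m A *m (delta_mx 0 j : 'rV_3)^T) 0 0 = A i j.
Proof. by rewrite trmx_delta -rowE -colE [LHS]mxE mxE. Qed.

Lemma form_delta2 (A : 'M[R]_3) i j (e : R) : A^T = A ->
  form A (delta_mx 0 i + e *: delta_mx 0 j) = A i i + 2 * e * A i j + e ^+ 2 * A j j.
Proof.
move=> sA; have ji : A j i = A i j by rewrite -{1}sA mxE.
rewrite /form linearD /= linearZ /= !mulmxDl !mulmxDr -!scalemxAl -!scalemxAr.
have h (c : R) (M N : 'M[R]_1) : (M + c *: N) 0 0 = M 0 0 + c * N 0 0 by rewrite !mxE.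
have h1 (M N : 'M[R]_1) : (M + N) 0 0 = M 0 0 + N 0 0 by rewrite mxE.
have h2 (c : R) (N : 'M[R]_1) : (c *: N) 0 0 = c * N 0 0 by rewrite mxE.
by rewrite h1 !h !h2 !delta_form ji; ring.
Qed.

Lemma form_gram (B : 'M[R]_3) v : B \in unitmx ->
  form (invmx (gram B)) v = \sum_i (v *m (invmx B)^T) 0 i ^+ 2.
Proof.
move=> uB; have uBt : B^T \in unitmx by rewrite unitmx_tr.
have -> : invmx (gram B) = invmx B^T *m invmx B.
  have uG := gram_unit uB; rewrite -[LHS]mulmx1 -(mulmxV uBt) -[in RHS](mul1mx (invmx B^T *m _)) -(mulVmx uG) gramE.
  by rewrite -!mulmxA (mulmxA B^T) (mulmxV uBt) mul1mx (mulmxV uB) mulmx1.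
rewrite /form mulmxA -mulmxA -trmx_inv.
have -> : invmx B *m v^T = (v *m (invmx B)^T)^T by rewrite trmx_mul trmxK.
move: (v *m _) => w; rewrite mxE; apply: eq_bigr => i _.
by rewrite [w^T _ _]mxE expr2.
Qed.

Lemma form_gt0 (B : 'M[R]_3) v : B \in unitmx -> v != 0 -> 0 < form (invmx (gram B)) v.
Proof.
move=> uB v0; rewrite form_gram //.
rewrite lt_neqAle eq_sym; apply/andP; split; last by apply: sumr_ge0 => i _; exact: sqr_ge0.
apply: contraNneq v0 => /psumr_eq0P H.
have uBt : (invmx B)^T \in unitmx by rewrite unitmx_tr unitmx_inv.
rewrite -[v](mulmxK uBt) (_ : v *m _ = 0) ?mul0mx //; apply/rowP => i.
apply/eqP; rewrite [X in _ == X]mxE -sqrf_eq0; apply/eqP; apply: H => // j _; exact: sqr_ge0.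
Qed.

Lemma form3 A v : A^T = A ->
  form A v = A 0 0 * v 0 0 ^+ 2 + A 1 1 * v 0 1 ^+ 2 + A 2 2 * v 0 2 ^+ 2 +
    2 * (A 0 1 * (v 0 0 * v 0 1) + A 0 2 * (v 0 0 * v 0 2) + A 1 2 * (v 0 1 * v 0 2)).
Proof.
move=> sA; have e i j : A j i = A i j by rewrite -{1}sA mxE.
by rewrite /form mxE sum3 !mxE !sum3 (e 0 1) (e 0 2) (e 1 2); ring.
Qed.

Definition sq (v : 'rV[R]_3) : 'M[R]_3 := v^T *m v.

Lemma sqE v i j : sq v i j = v 0 i * v 0 j.
Proof. by rewrite mxE big_ord_recl big_ord0 addr0 !mxE. Qed.

(** The value of the form is linear in [sq v], so relations between squares become relations between
    values. *)
Lemma sq_form A v : mxvec (sq v) *m (mxvec A)^T = (form A v)%:M.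
Proof. by rewrite mxvec_dotmul [LHS]mx11_scalar. Qed.

(** The real kernel of a rational matrix is spanned by rational vectors, so a linear form that is
    nonzero somewhere on it is nonzero at a rational vector. *)
Lemma rational_relation (m n : nat) (X : 'M[rat]_(m, n)) (h : 'cV[rat]_m) (v : 'rV[R]_m) :
  v *m map_mx ratr X = 0 -> v *m map_mx ratr h != 0 ->
  exists2 r : 'rV[rat]_m, r *m X = 0 & r *m h != 0.
Proof.
move=> /sub_kermxP; rewrite -map_kermx => /submxP[D ->] vh.
have kh : kermx X *m h != 0.
  by apply: contraNneq vh => k0; rewrite -mulmxA -map_mxM k0 map_mx0 mulmx0.
have [i ih] : exists i, row i (kermx X) *m h != 0.
  apply: contrapT => H; case/eqP: kh; apply/row_matrixP => i; rewrite row_mul row0.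
  by apply/eqP; apply/negPn/negP => hi; apply: H; exists i.
exists (row i (kermx X)) => //.
by rewrite -row_mul mulmx_ker row0.
Qed.

Lemma ratr_ivec (xi : 'rV[int]_3) :
  map_mx ratr (map_mx intr xi : 'rV[rat]_3) = ivec xi :> 'rV[R]_3.
Proof. by apply/rowP => i; rewrite !mxE ratr_int. Qed.

(* The squares are rational matrices with the real relation [(kappa' a, - kappa a')], hence with a rational
   relation [(r1, r2)] such that [r1] has nonzero sum; evaluating it at [A] relates [E] and [E']. *)
Lemma energy_ratio (A G : 'M[R]_3) (n n' : nat) (f : 'I_n -> 'rV[int]_3) (f' : 'I_n' -> 'rV[int]_3)
    (a : 'I_n -> R) (a' : 'I_n' -> R) (E E' kappa kappa' : R) :
  E != 0 -> E' != 0 -> kappa' != 0 ->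
  (forall i, form A (ivec (f i)) = E) -> (forall i, form A (ivec (f' i)) = E') ->
  \sum_i a i = 1 ->
  \sum_i a i *: sq (ivec (f i)) = kappa *: G ->
  \sum_i a' i *: sq (ivec (f' i)) = kappa' *: G ->
  israt (E' / E).
Proof.
move=> E0 E'0 k'0 fE f'E' a1 aG a'G.
pose Q k (g : 'I_k -> 'rV[int]_3) : 'M[rat]_(k, 3 * 3) :=
  \matrix_i mxvec ((map_mx intr (g i))^T *m map_mx intr (g i)).
have QR k (g : 'I_k -> 'rV[int]_3) i : row i (map_mx ratr (Q k g)) = mxvec (sq (ivec (g i))).
  by rewrite -map_row rowK map_mxvec map_mxM /= -map_trmx ratr_ivec.
have QS k (g : 'I_k -> 'rV[int]_3) (b : 'rV[R]_k) :
    b *m map_mx ratr (Q k g) = mxvec (\sum_i b 0 i *: sq (ivec (g i))).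
  by rewrite mulmx_sum_row linear_sum; apply: eq_bigr => i _; rewrite QR linearZ.
have QA k (g : 'I_k -> 'rV[int]_3) e (b : 'rV[R]_k) : (forall i, form A (ivec (g i)) = e) ->
    (b *m map_mx ratr (Q k g) *m (mxvec A)^T) 0 0 = e * \sum_i b 0 i.
  move=> ge; rewrite QS linear_sum mulmx_suml summxE mulr_sumr; apply: eq_bigr => i _.
  by rewrite linearZ -scalemxAl mxE sq_form ge !mxE mulr1n mulrC.
pose h : 'cV[rat]_(n + n') := col_mx (const_mx 1) 0.
pose v : 'rV[R]_(n + n') := row_mx (\row_i (kappa' * a i)) (\row_i (- kappa * a' i)).
have [||r rX rh] := @rational_relation _ _ (col_mx (Q n f) (Q n' f')) h v.
- rewrite map_col_mx mul_row_col !QS.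
  under eq_bigr do rewrite mxE -scalerA; under [X in _ + mxvec X]eq_bigr do rewrite mxE -scalerA.
  rewrite -!scaler_sumr aG a'G -linearD /= !scalerA -scalerDl.
  by rewrite [_ * kappa']mulrC mulrN mulrC subrr scale0r linear0.
- rewrite /h map_col_mx mul_row_col map_mx0 mulmx0 addr0.
  apply/eqP => /matrixP/(_ 0 0); rewrite !mxE.
  under eq_bigr do rewrite !mxE rmorph1 mulr1.
  by rewrite -mulr_sumr a1 mulr1; apply/eqP.
pose r1 := lsubmx r; pose r2 := rsubmx r.
have rE : r = row_mx r1 r2 by rewrite hsubmxK.
have S0 : E * ratr (\sum_i r1 0 i) + E' * ratr (\sum_i r2 0 i) = 0.
  have : (map_mx ratr (r *m col_mx (Q n f) (Q n' f')) *m (mxvec A)^T) 0 0 = 0.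
    by rewrite rX map_mx0 mul0mx mxE.
  rewrite rE mul_row_col map_mxD !map_mxM mulmxDl mxE !(QA _ _ _ _ fE, QA _ _ _ _ f'E').
  by move=> <-; rewrite !rmorph_sum; congr (_ * _ + _ * _); apply: eq_bigr => i _; rewrite [in RHS]mxE.
have s1 : ratr (\sum_i r1 0 i) != 0 :> R.
  rewrite fmorph_eq0; apply: contraNneq rh => s0.
  rewrite rE mul_row_col mulmx0 addr0; apply/eqP/matrixP => i j; rewrite !ord1 !mxE -[RHS]s0.
  by apply: eq_bigr => k _; rewrite [const_mx _ _ _]mxE mulr1.
have s2 : ratr (\sum_i r2 0 i) != 0 :> R.
  apply: contra_eq_neq S0 => ->; rewrite mulr0 addr0 mulf_neq0 //.
exists (- (\sum_i r1 0 i) / (\sum_i r2 0 i)).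
rewrite rmorphM rmorphN fmorphV.
apply: (mulIf E0); apply: (mulIf s2); rewrite mulfVK // mulrAC mulfVK //.
by rewrite mulNr; apply/eqP; rewrite -addr_eq0 addrC [_ * E]mulrC S0.
Qed.

(** The sum factors the invertible [G] through the matrix of all vectors of [Y], which therefore has
    rank three. *)
Lemma spanning_frame (G : 'M[R]_3) (Y : seq 'rV[int]_3) (a : 'rV[int]_3 -> R) :
  G \in unitmx -> \sum_(xi <- Y) a xi *: sq (ivec xi) = G ->
  exists2 f : 'I_3 -> 'rV[int]_3, forall i, f i \in Y &
    (\matrix_i ivec (f i) : 'M[R]_3) \in unitmx.
Proof.
move=> uG aG; pose g := tnth (in_tuple Y).
pose M : 'M[R]_(size Y, 3) := \matrix_i ivec (g i).
have MG : (\matrix_i (a (g i) *: ivec (g i)))^T *m M = G.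
  rewrite -aG big_tnth; apply/matrixP => i j; rewrite mxE summxE; apply: eq_bigr => k _.
  by rewrite [in RHS]mxE sqE !mxE mulrA.
have fM : row_full M.
  apply/row_fullP; exists (invmx G *m (\matrix_i (a (g i) *: ivec (g i)))^T).
  by rewrite -mulmxA MG mulVmx.
exists (fun i => g (fullrankfun fM i)); first by move=> i; exact: mem_tnth.
have := fullrowsub_unit fM; congr (_ \in unitmx).
by apply/row_matrixP => i; rewrite row_rowsub !rowK.
Qed.

(** The origin of the four lines: three coordinate axes, on which all products of two coordinates
    vanish, and the line of [(p, q, r)]. *)
Lemma off_parallel (p q r u0 u1 u2 : R) : p != 0 -> q != 0 -> r != 0 ->
  p * r * (u1 * u2) = q * r * (u0 * u2) -> q * r * (u0 * u1) = p * q * (u1 * u2) ->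
  [\/ u1 = 0 /\ u2 = 0, u0 = 0 /\ u2 = 0, u0 = 0 /\ u1 = 0 | u1 = u0 / p * q /\ u2 = u0 / p * r].
Proof.
move=> p0 q0 r0 h1 h2.
have k1 : p * (u1 * u2) = q * (u0 * u2) by apply: (mulfI r0); lra.
have k2 : r * (u0 * u1) = p * (u1 * u2) by apply: (mulfI q0); lra.
have [z0|n0] := eqVneq u0 0.
  have /eqP : p * (u1 * u2) = 0 by rewrite k1 z0 mul0r mulr0.
  rewrite !mulf_eq0 (negbTE p0) /= => /orP[]/eqP z; first by constructor 3.
  by constructor 2.
have [z1|n1] := eqVneq u1 0.
  have /eqP : q * (u0 * u2) = 0 by rewrite -k1 z1 mul0r mulr0.
  by rewrite !mulf_eq0 (negbTE q0) (negbTE n0) /= => /eqP z; constructor 1.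
have [z2|n2] := eqVneq u2 0.
  have /eqP : r * (u0 * u1) = 0 by rewrite k2 z2 !mulr0.
  by rewrite !mulf_eq0 (negbTE r0) (negbTE n0) (negbTE n1).
constructor 4; split.
- apply: (mulfI p0); apply: (mulIf n2); rewrite -mulrA k1; field; exact: p0.
- apply: (mulfI p0); apply: (mulIf n1); rewrite -mulrA [u2 * _]mulrC -k2; field; exact: p0.
Qed.

Local Notation iv := (@ivec R).

Lemma spectrum_rigidity (B : 'M[R]_3) (Y Y' : seq 'rV[int]_3) (a a' : 'rV[int]_3 -> R) (E E' kappa kappa' : R) :
  B \in unitmx -> cubic_irrational B \/ quartic_irrational B ->
  0 < E -> 0 < E' -> 0 < kappa -> 0 < kappa' ->
  (forall xi, xi \in Y -> form (invmx (gram B)) (iv xi) = E) ->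
  (forall xi, xi \in Y' -> form (invmx (gram B)) (iv xi) = E') ->
  \sum_(xi <- Y) a xi = 1 -> \sum_(xi <- Y') a' xi = 1 ->
  \sum_(xi <- Y) a xi *: sq (iv xi) = kappa *: gram B ->
  \sum_(xi <- Y') a' xi *: sq (iv xi) = kappa' *: gram B ->
  exists (t : rat) (X : 'I_4 -> 'rV[int]_3),
    [/\ 0 < t, E' = ratr t ^+ 2 * E, forall i, X i \in Y,
      forall b : 'I_4 -> R, \sum_i b i *: sq (iv (X i)) = 0 -> forall i, b i = 0 &
      (forall xi, xi \in Y -> exists i, xi = X i \/ xi = - X i) /\
      (forall xi, xi \in Y' -> exists i,
        iv xi = ratr t *: iv (X i) \/ iv xi = - (ratr t *: iv (X i)))].
Proof.
move=> uB irrB E0 E'0 k0 k'0 YE Y'E' a1 a'1 aG a'G.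
set A := invmx (gram B) in YE Y'E'.
have uG := gram_unit uB.
have sA : A^T = A by rewrite /A trmx_inv gram_sym.
have En : E != 0 by rewrite gt_eqF.
have kn : kappa != 0 by rewrite gt_eqF.
have rE : israt (E' / E).
  apply: (@energy_ratio A (gram B) _ _ (tnth (in_tuple Y)) (tnth (in_tuple Y'))
    (fun i => a (tnth (in_tuple Y) i)) (fun i => a' (tnth (in_tuple Y') i)) E E' kappa kappa').
  - by [].
  - by rewrite gt_eqF.
  - by rewrite gt_eqF.
  - by move=> i; rewrite YE // mem_tnth.
  - by move=> i; rewrite Y'E' // mem_tnth.
  - by rewrite -a1 [RHS]big_tnth.
  - by rewrite -aG [RHS]big_tnth.
  - by rewrite -a'G [RHS]big_tnth.
have [f fY uS] : exists2 f : 'I_3 -> 'rV[int]_3, forall i, f i \in Y & (\matrix_i iv (f i) : 'M[R]_3) \in unitmx.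
  by apply: (@spanning_frame (kappa *: gram B) Y a) => //; rewrite unitmxZ ?unitfE.
set S : 'M[R]_3 := \matrix_i _ in uS.
pose y (xi : 'rV[int]_3) : 'rV[R]_3 := iv xi *m invmx S.
have yS xi : iv xi = y xi *m S by rewrite /y mulmxKV.
have ry xi i : israt (y xi 0 i).
  exists ((map_mx intr xi *m invmx (\matrix_i map_mx intr (f i) : 'M[rat]_3)) 0 i).
  rewrite /y; have -> : S = map_mx ratr (\matrix_i map_mx intr (f i) : 'M[rat]_3).
    by apply/row_matrixP => k; rewrite -map_row !rowK ratr_ivec.
  by rewrite /y -ratr_ivec -map_invmx -map_mxM mxE.
have yf i : y (f i) = delta_mx 0 i.
  by rewrite /y -(_ : row i S = iv (f i)) ?rowE ?mulmxK // -rowE rowK.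
(* The dual form in the basis [f], divided by the common value [E] so that its diagonal is one. *)
pose P := E^-1 *: (S *m A *m S^T).
have formP v : form P v = E^-1 * form A (v *m S).
  by rewrite /form trmx_mul -!scalemxAr -!scalemxAl mxE !mulmxA.
have sP : P^T = P by rewrite /P linearZ /= !trmx_mul trmxK sA mulmxA.
have Pdiag i : P i i = 1.
  have := formP (y (f i)); rewrite -yS YE // mulVf // yf => <-.
  by rewrite /form delta_form.
pose al := P 0 1; pose be := P 0 2; pose ga := P 1 2.
have Pform v : form P v = v 0 0 ^+ 2 + v 0 1 ^+ 2 + v 0 2 ^+ 2 +
    2 * (al * (v 0 0 * v 0 1) + be * (v 0 0 * v 0 2) + ga * (v 0 1 * v 0 2)).
  by rewrite form3 // !Pdiag !mul1r.
have Ppos v : v != 0 -> 0 < form P v.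
  move=> v0; rewrite formP mulr_gt0 ?invr_gt0 // form_gt0 //.
  by apply: contraNneq v0 => vS; rewrite -[v](mulmxK uS) vS mul0mx.
(* Positivity of [P] at the sum and at the difference of two basis vectors. *)
have lt1 (i j : 'I_3) : i != j -> `|P i j| < 1.
  move=> ij; have H (e : R) : e ^+ 2 = 1 -> 0 < 1 + e * P i j.
    move=> e1; have : delta_mx 0 i + e *: delta_mx 0 j != 0 :> 'rV[R]_3.
      apply/eqP => /rowP/(_ i); rewrite !mxE !eqxx (negbTE ij) /= mulr0 addr0 => /eqP.
      by rewrite oner_eq0.
    by move=> /Ppos; rewrite form_delta2 // !Pdiag e1; lra.
  have := H 1 (expr1n _ _); have := H (-1); rewrite sqrrN expr1n => /(_ erefl).
  by rewrite ltr_norml => ? ?; apply/andP; split; lra.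
have rational_val xi r : form A (iv xi) = E * r -> israt r ->
    israt (al * (y xi 0 0 * y xi 0 1) + be * (y xi 0 0 * y xi 0 2) + ga * (y xi 0 1 * y xi 0 2)).
  move=> xr rr; have : form P (y xi) = r by rewrite formP -yS xr mulKf.
  rewrite Pform; set u := al * _ + _ + _ => h.
  have -> : u = (r - (y xi 0 0 ^+ 2 + y xi 0 1 ^+ 2 + y xi 0 2 ^+ 2)) / 2 by rewrite -h; field.
  by have h0 := ry xi 0; have h1 := ry xi 1; have h2 := ry xi 2; ratt.
(* The Gram matrix in the same basis, up to the factor that makes it the inverse of [P]. With [D]
   the determinant of [P], the entries of [D * W] are those of the adjugate; each is found by
   combining the equations of [P *m W = 1%:M] with cofactors. *)
pose W := E *: (invmx S^T *m gram B *m invmx S).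
have PW : P *m W = 1%:M.
  rewrite /P /W -scalemxAl -scalemxAr scalerA mulVf // scale1r.
  rewrite -!mulmxA (mulmxA S^T) mulmxV ?unitmx_tr // mul1mx (mulmxA A) mulVmx // mul1mx.
  by rewrite mulmxV.
have sW : W^T = W by rewrite /W linearZ /= !trmx_mul !trmx_inv trmxK gram_sym mulmxA.
have sqy xi : sq (y xi) = invmx S^T *m sq (iv xi) *m invmx S.
  have := yS xi; move: (y xi) => w ->.
  by rewrite /sq trmx_mul !mulmxA mulVmx ?unitmx_tr // mul1mx mulmxK.
have aW : \sum_(xi <- Y) a xi *: sq (y xi) = (kappa / E) *: W.
  transitivity (invmx S^T *m (\sum_(xi <- Y) a xi *: sq (iv xi)) *m invmx S).
    rewrite mulmx_sumr mulmx_suml; apply: eq_bigr => xi _.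
    by rewrite -scalemxAr -scalemxAl sqy.
  by rewrite aG -scalemxAr -scalemxAl /W scalerA mulfVK.
pose D := 1 - al ^+ 2 - be ^+ 2 - ga ^+ 2 + 2 * al * be * ga.
have PWe i k : P i 0 * W 0 k + P i 1 * W 1 k + P i 2 * W 2 k = (i == k)%:R.
  by have /matrixP/(_ i k) := PW; rewrite [LHS]mxE sum3 [RHS]mxE.
have P10 : P 1 0 = al by rewrite /al -{1}sP mxE.
have P20 : P 2 0 = be by rewrite /be -{1}sP mxE.
have P21 : P 2 1 = ga by rewrite /ga -{1}sP mxE.
have W10 : W 1 0 = W 0 1 by rewrite -{1}sW mxE.
have W20 : W 2 0 = W 0 2 by rewrite -{1}sW mxE.
have W21 : W 2 1 = W 1 2 by rewrite -{1}sW mxE.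
have := (PWe 0 0, PWe 0 1, PWe 0 2, PWe 1 0, PWe 1 1, PWe 1 2, PWe 2 0, PWe 2 1, PWe 2 2).
rewrite !Pdiag P10 P20 P21 -/al -/be -/ga W10 W20 W21 /= => [[[[[[[[[e00 e01] e02] e10] e11] e12] e20] e21] e22]].
have D00 : D * W 0 0 = 1 - ga ^+ 2.
  transitivity ((1 - ga ^+ 2) * (1 * W 0 0 + al * W 0 1 + be * W 0 2) +
     (be * ga - al) * (al * W 0 0 + 1 * W 0 1 + ga * W 0 2) +
     (al * ga - be) * (be * W 0 0 + ga * W 0 1 + 1 * W 0 2)); first by rewrite /D; ring.
  by rewrite e00 e10 e20; ring.
have D11 : D * W 1 1 = 1 - be ^+ 2.
  transitivity ((be * ga - al) * (1 * W 0 1 + al * W 1 1 + be * W 1 2) +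
     (1 - be ^+ 2) * (al * W 0 1 + 1 * W 1 1 + ga * W 1 2) +
     (al * be - ga) * (be * W 0 1 + ga * W 1 1 + 1 * W 1 2)); first by rewrite /D; ring.
  by rewrite e01 e11 e21; ring.
have D22 : D * W 2 2 = 1 - al ^+ 2.
  transitivity ((al * ga - be) * (1 * W 0 2 + al * W 1 2 + be * W 2 2) +
     (al * be - ga) * (al * W 0 2 + 1 * W 1 2 + ga * W 2 2) +
     (1 - al ^+ 2) * (be * W 0 2 + ga * W 1 2 + 1 * W 2 2)); first by rewrite /D; ring.
  by rewrite e02 e12 e22; ring.
have D01 : D * W 0 1 = be * ga - al.
  transitivity ((1 - ga ^+ 2) * (1 * W 0 1 + al * W 1 1 + be * W 1 2) +
     (be * ga - al) * (al * W 0 1 + 1 * W 1 1 + ga * W 1 2) +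
     (al * ga - be) * (be * W 0 1 + ga * W 1 1 + 1 * W 1 2)); first by rewrite /D; ring.
  by rewrite e01 e11 e21; ring.
have D02 : D * W 0 2 = al * ga - be.
  transitivity ((1 - ga ^+ 2) * (1 * W 0 2 + al * W 1 2 + be * W 2 2) +
     (be * ga - al) * (al * W 0 2 + 1 * W 1 2 + ga * W 2 2) +
     (al * ga - be) * (be * W 0 2 + ga * W 1 2 + 1 * W 2 2)); first by rewrite /D; ring.
  by rewrite e02 e12 e22; ring.
have D12 : D * W 1 2 = al * be - ga.
  transitivity ((be * ga - al) * (1 * W 0 2 + al * W 1 2 + be * W 2 2) +
     (1 - be ^+ 2) * (al * W 0 2 + 1 * W 1 2 + ga * W 2 2) +
     (al * be - ga) * (be * W 0 2 + ga * W 1 2 + 1 * W 2 2)); first by rewrite /D; ring.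
  by rewrite e02 e12 e22; ring.
have al1 : `|al| < 1 by exact: lt1.
have be1 : `|be| < 1 by exact: lt1.
have ga1 : `|ga| < 1 by exact: lt1.
have D0 : D != 0.
  apply/eqP => z; move: D00; rewrite z mul0r => h.
  have : ga ^+ 2 < 1 by rewrite -real_normK ?num_real // expr_lt1.
  by lra.
(* Entries of [P] in a field of degree at most two would put [W], then [E *: gram B] and all ratios
   of Gram entries in that field. *)
have irr t : quadratic t -> ~ [/\ rat_span t al, rat_span t be & rat_span t ga].
  move=> qt [sal sbe sga].
  have Fr u : israt u -> rat_span t u by exact: rat_span_rat.
  have F1 : rat_span t 1 by exact/Fr/israt1.
  have F2 : rat_span t 2 by exact/Fr/israt_nat.
  have FD : rat_span t D by rewrite /D !expr2; span.
  have FW i j : rat_span t (W i j).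
    have FDW u : rat_span t (D * u) -> rat_span t u by move=> h; rewrite -[u](mulKf D0); span.
    move: i j; apply: ord3P; apply: ord3P; rewrite ?W10 ?W20 ?W21; apply: FDW;
      rewrite ?D00 ?D01 ?D02 ?D11 ?D12 ?D22 ?expr2; span.
  have EG : E *: gram B = S^T *m W *m S.
    rewrite /W -!scalemxAr -!scalemxAl !mulmxA mulmxV ?unitmx_tr // mul1mx.
    by rewrite mulmxKV.
  have FS i j : rat_span t (S i j) by rewrite mxE mxE; exact/Fr/israt_int.
  have FEG i j : rat_span t (E * gram B i j).
    have -> : E * gram B i j = (E *: gram B) i j by rewrite [RHS]mxE.
    rewrite EG; apply: rat_span_mulmx => // {}i {}j; apply: rat_span_mulmx => // k l.
    by rewrite [_^T _ _]mxE.
  have KF : gram_ratio_field B `<=` rat_span t.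
    apply: smallest_sub; first exact: rat_span_subfield.
    move=> _ [i [j ->]].
    have -> : gram B i j / gram B 0 0 = (E * gram B i j) / (E * gram B 0 0).
      by rewrite invfM mulrACA divff // mul1r.
    by span.
  have sK : subfield (gram_ratio_field B).
    split=> [|u v|u v]; rewrite ?inE.
    - by move=> H [[]]; rewrite inE.
    - by move=> Ku Kv H HH; have := Ku _ HH; have := Kv _ HH; case: HH => -[_ h _] _ vH uH;
        have := h u v; rewrite !inE; apply.
    - by move=> Ku Kv H HH; have := Ku _ HH; have := Kv _ HH; case: HH => -[_ _ h] _ vH uH;
        have := h u v; rewrite !inE; apply.
  by case: irrB => dK; apply: (degree_rat_span sK dK _ KF).
have Z_rat (xi : 'rV[int]_3) : xi \in Y \/ xi \in Y' -> exists2 r, israt r & form A (iv xi) = E * r.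
  move=> [xY|xY']; first by exists 1; [exact: israt1|rewrite YE // mulr1].
  by exists (E' / E) => //; rewrite Y'E' // mulrC mulfVK.
have qsum i j : D * W i j = \sum_(xi <- Y) D * (E / kappa) * a xi * (y xi 0 i * y xi 0 j).
  have /matrixP/(_ i j) := aW; rewrite summxE [in RHS]mxE => h.
  transitivity (D * (E / kappa) * (kappa / E * W i j)); first by field; rewrite En.
  rewrite -h mulr_sumr; apply: eq_bigr => xi _; rewrite mxE sqE; ring.
(* Only [Y] enters the adjugate identities, but parallelism is obtained on both spectra; on [Y'] the
   rational condition comes from [rE]. *)
have [||||||v vY [v12 v13 v23 vpar]] := @off_diagonal_line R _ Y [set xi | xi \in Y \/ xi \in Y']
   (fun xi => y xi 0 0 * y xi 0 1) (fun xi => y xi 0 0 * y xi 0 2) (fun xi => y xi 0 1 * y xi 0 2)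
   (fun xi => D * (E / kappa) * a xi) al be ga al1 be1 ga1 irr.
- by move=> xi _; split; apply: isratM.
- by move=> xi /Z_rat[r rr /rational_val]; apply.
- by move=> xi; left.
- by rewrite -D01 qsum.
- by rewrite -D02 qsum.
- by rewrite -D12 qsum.
have [p0 q0 r0] : [/\ y v 0 0 != 0, y v 0 1 != 0 & y v 0 2 != 0].
  move: v12 v13 v23; rewrite !mulf_eq0 !negb_or.
  by move=> /orP[/andP[-> ->]|/andP[-> ->]] /orP[/andP[? ?]|/andP[? ?]] /orP[/andP[? ?]|/andP[? ?]].
(* The fourth vector is the default value [v]. *)
pose X (i : 'I_4) := nth v [:: f 0; f 1; f 2] i.
have yX s xi i : y xi = s *: y (X i) -> iv xi = s *: iv (X i).
  by move=> h; rewrite yS h -scalemxAl -yS.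
have coord (u : 'rV[R]_3) (k : 'I_3) : (forall j, j != k -> u 0 j = 0) -> u = u 0 k *: delta_mx 0 k.
  move=> h; apply/rowP => j; rewrite !mxE eqxx /=.
  by case: (eqVneq j k) => [->|/h ->]; rewrite ?mulr1 ?mulr0.
have line xi : xi \in Y \/ xi \in Y' -> exists i s, israt s /\ iv xi = s *: iv (X i).
  move=> /vpar[h1 h2 h3].
  have axis (k : 'I_3) : (forall j, j != k -> y xi 0 j = 0) -> exists i s, israt s /\ iv xi = s *: iv (X i).
    move=> h; exists (widen_ord (leqnSn 3) k), (y xi 0 k); split=> //; apply: yX.
    have -> : X (widen_ord (leqnSn 3) k) = f k by rewrite /X /=; move: k {h}; apply: ord3P.
    by rewrite yf; exact: coord.
  have [[z1 z2]|[z0 z2]|[z0 z1]|[E1 E2]] := off_parallel p0 q0 r0 h1 h2.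
  - by apply: (axis 0); apply: ord3P.
  - by apply: (axis 1); apply: ord3P.
  - by apply: (axis 2); apply: ord3P.
  exists ord_max, (y xi 0 0 / y v 0 0); split; first by apply: isratM; [exact: ry|apply: isratV; exact: ry].
  apply: yX; apply/rowP => j; rewrite [RHS]mxE -[X ord_max]/v.
  by move: j; apply: ord3P => //; rewrite mulfVK.
have X_Y i : X i \in Y.
  by rewrite /X; case: i => [[|[|[|[|i]]]] hi] //=; exact: fY.
have val xi i s : iv xi = s *: iv (X i) -> form A (iv xi) = s ^+ 2 * E.
  by move=> ->; rewrite formZ YE.
have [xi0 xi0Y'] : exists xi, xi \in Y'.
  move: a'1; case: (Y') => [|x l]; last by exists x; rewrite mem_head.
  by rewrite big_nil => /esym/eqP; rewrite oner_eq0.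
(* Any frequency of [Y'] determines the ratio up to sign, since the square of the ratio is
   [E' / E]. *)
have [i0 [s0 [[t0 s0E] /val xi0E]]] := line xi0 (or_intror xi0Y').
have tE : E' = s0 ^+ 2 * E by rewrite -xi0E Y'E'.
have t00 : t0 != 0.
  apply/eqP => z; move: tE; rewrite s0E z rmorph0 expr2 !mul0r => z'.
  by move: E'0; rewrite z' ltxx.
exists `|t0|, X; split=> //.
- by rewrite normr_gt0.
- by rewrite -rmorphXn /= real_normK ?num_real // rmorphXn /= -s0E.
- move=> b b0.
  have : \sum_i b i *: sq (y (X i)) = 0.
    under eq_bigr do rewrite sqy scalemxAl scalemxAr.
    by rewrite -mulmx_suml -mulmx_sumr b0 mulmx0 mul0mx.
  move=> /matrixP bm.
  have bE k l : \sum_i b i * (y (X i) 0 k * y (X i) 0 l) = 0.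
    have := bm k l; rewrite summxE [RHS]mxE => h; rewrite -[RHS]h; apply: eq_bigr => i _.
    by rewrite [RHS]mxE sqE.
  (* Among the four squares only the last has a nonzero [(0, 1)] entry; once its coefficient is
     zero, the diagonal entries give the other three. *)
  have := (bE 0 1, bE 0 0, bE 1 1, bE 2 2).
  rewrite /X !big_ord_recl !big_ord0 /= !yf.
  move: (y v) p0 q0 r0 => w p0 q0 r0.
  rewrite !mxE /= !(mulr0, mul0r, mulr1, addr0, add0r) => -[[[z01 z00] z11] z22].
  have b3 : b (lift ord0 (lift ord0 (lift ord0 ord0))) = 0.
    by move/eqP: z01; rewrite !mulf_eq0 (negbTE p0) (negbTE q0) !orbF => /eqP.
  rewrite b3 !mul0r !addr0 in z00 z11 z22.
  by case=> [[|[|[|[|i]]]] hi] //; [rewrite -[RHS]z00|rewrite -[RHS]z11|rewrite -[RHS]z22|rewrite -[RHS]b3];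
    congr b; apply: val_inj.
split=> xi.
  move=> xY; have [i [s [_ xs]]] := line xi (or_introl xY); exists i.
  have iv_inj : injective iv by move=> x1 x2 /rowP h; apply/rowP => k; have := h k; rewrite !mxE => /intr_inj.
  have /eqP : s ^+ 2 = 1 by apply: (mulIf En); rewrite mul1r -(val _ _ _ xs) YE.
  rewrite sqrf_eq1 => /orP[]/eqP s1; [left|right]; apply: iv_inj; rewrite xs s1 ?scale1r //.
  by rewrite scaleN1r; apply/rowP => k; rewrite !mxE rmorphN.
move=> xY; have [i [s [_ xs]]] := line xi (or_intror xY); exists i.
have /eqP : s ^+ 2 = s0 ^+ 2 by apply: (mulIf En); rewrite -tE -(val _ _ _ xs) Y'E'.
have nE : ratr `|t0| = `|s0| :> R.
  by rewrite s0E; case: (lerP 0 t0) => ht; [rewrite !ger0_norm ?ler0q|rewrite !ltr0_norm ?ltrq0 ?rmorphN].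
rewrite xs nE eqf_sqr => /orP[]/eqP ->; have [hs|hs] := lerP 0 s0;
  rewrite ?(ger0_norm hs) ?(ltr0_norm hs) ?scaleNr ?opprK; first [by left|by right].
Qed.

End Spectrum.

(** * The Laplace equation of a minimal immersion *)

Section Immersion.
Local Open Scope complex_scope.
Variable R : realType.
Implicit Types (u v w z : 'rV[R]_3) (xi eta : 'rV[int]_3).

Lemma is_derive_line (g : 'rV[R]_3 -> R) u v (s d : R) :
  is_derive (u + s *: v) v g d -> is_derive s 1 (fun t => g (u + t *: v)) d.
Proof.
have E : (fun h : R => h^-1 *: (((fun t => g (u + t *: v)) \o shift s) (h *: 1) - g (u + s *: v))) =
         (fun h : R => h^-1 *: ((g \o shift (u + s *: v)) (h *: v) - g (u + s *: v))).
  apply/funext => h /=; rewrite [h *: 1]mulr1.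
  by rewrite scalerDl addrCA.
move=> [dg <-]; split.
  by rewrite /derivable E.
by rewrite /derive E.
Qed.

Section Smooth.
Variables (n : nat) (B : 'M[R]_3).
Implicit Types (f g : 'rV[R]_3 -> 'rV[R]_n.+1).

Definition C1periodic f := [/\ forall u, differentiable f u,
  forall v, continuous ('D_v f) & forall u l, lattice B l -> f (u + l) = f u].

(** In lattice coordinates the periods become the integer vectors. *)
Definition coordinate f (k : 'I_n.+1) z : R := f (z *m B) 0 k.

Lemma ivec_lattice xi : lattice B (ivec xi *m B).
Proof. by exists xi. Qed.

Lemma derive_periodic f v : (forall u l, lattice B l -> f (u + l) = f u) ->
  forall u l, lattice B l -> 'D_v f (u + l) = 'D_v f u.
Proof.
move=> pf u l Bl; 
have E : (fun h : R => h^-1 *: ((f \o shift (u + l)) (h *: v) - f (u + l))) =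
         (fun h : R => h^-1 *: ((f \o shift u) (h *: v) - f u)).
  by apply/funext => h /=; rewrite addrA !(pf _ _ Bl).
by rewrite /derive E.
Qed.

Lemma continuous_mulmxr : continuous (fun z => z *m B).
Proof.
have cs (s : seq 'I_3) : continuous (fun z : 'rV[R]_3 => \sum_(i <- s) z 0 i *: row i B).
  elim: s => [|i s IHs].
    by under eq_fun do rewrite big_nil; exact: cst_continuous.
  under eq_fun do rewrite big_cons; move=> z.
  apply: (@continuousD _ _ _ (fun z => z 0 i *: _)); last exact: IHs.
  have ci : {for z, continuous (fun z : 'rV[R]_3 => z 0 i)} by exact: coord_continuous.
  exact: (@cvgZr_tmp _ _ _ (nbhs z) _ (fun z => z 0 i)).
by under eq_fun do rewrite mulmx_sum_row; exact: cs.
Qed.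

Lemma contper_coordinate f k : continuous f -> (forall u l, lattice B l -> f (u + l) = f u) ->
  contper (coordinate f k).
Proof.
move=> cf pf; split=> [z|z xi].
  apply: (@continuous_comp _ _ _ (fun z => f (z *m B)) (fun M : 'rV[R]_n.+1 => M 0 k)); last exact: coord_continuous.
  apply: (@continuous_comp _ _ _ (fun z => z *m B) f); last exact: cf.
  exact: continuous_mulmxr.
by rewrite /coordinate mulmxDl pf //; exact: ivec_lattice.
Qed.

Lemma is_derive_coord f u v k : derivable f u v -> is_derive u v (fun u => f u 0 k) ('D_v f u 0 k).
Proof.
move=> df; split; first by have /derivable_mxP := df; apply.
by rewrite (derive_mx df) mxE.
Qed.

Lemma pderiv_coordinate f k i : (forall u, differentiable f u) ->
  pderiv i (coordinate f k) (coordinate ('D_(row i B) f) k).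
Proof.
move=> df z s; rewrite /coordinate.
under eq_fun do rewrite mulmxDl -scalemxAl -rowE.
rewrite mulmxDl -scalemxAl -rowE.
apply: (is_derive_line (g := fun u => f u 0 k)); apply: is_derive_coord; exact: diff_derivable.
Qed.

Lemma derive_linear f u v (a : 'I_3 -> R) (b : 'I_3 -> 'rV[R]_3) : differentiable f u ->
  v = \sum_i a i *: b i -> 'D_v f u = \sum_i a i *: 'D_(b i) f u.
Proof.
move=> df ->; rewrite deriveE // linear_sum; apply: eq_bigr => i _.
by rewrite linearZ deriveE.
Qed.

Lemma fourier_coordinate_derive f v k xi : B \in unitmx -> C1periodic f ->
  fourier (coordinate ('D_v f) k) xi =
  (0 +i* phase xi (v *m invmx B)) * fourier (coordinate f k) xi.
Proof.
move=> uB [df cf pf].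
have cD w : contper (coordinate ('D_w f) k) by apply: contper_coordinate; [exact: cf|exact: derive_periodic].
have cF : contper (coordinate f k).
  by apply: contper_coordinate => // u; exact: differentiable_continuous.
pose a := v *m invmx B.
have vE : v = \sum_i a 0 i *: row i B by rewrite -mulmx_sum_row /a mulmxKV.
have -> : coordinate ('D_v f) k = (fun z => \sum_i a 0 i * coordinate ('D_(row i B) f) k z).
  apply/funext => z; rewrite /coordinate (derive_linear (df _) vE) summxE.
  by apply: eq_bigr => i _; rewrite mxE.
rewrite fourier_sum => [|i]; last exact: contperZ.
under eq_bigr => i _ do rewrite fourierZ // (fourier_pderiv _ (pderiv_coordinate k i df)) // mulrA.
rewrite -mulr_suml; congr (_ * _).
have -> : phase xi a = \sum_i a 0 i * ((xi 0 i)%:~R * (pi *+ 2)).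
  by rewrite /phase mulr_suml; apply: eq_bigr => i _; rewrite mulrCA mulrA.
rewrite -[RHS]/(0 +i* _) (_ : \sum_i _ = \sum_i (0 +i* (a 0 i * ((xi 0 i)%:~R * (pi *+ 2))))).
  apply/eqP; rewrite eq_complex /= !raddf_sum /= big1 // eqxx /=. apply/eqP.
  by [].
by apply: eq_bigr => i _; apply/eqP; rewrite eq_complex /= !mul0r mulr0 subr0 addr0 !eqxx.
Qed.

Lemma coordinate_inj f g : B \in unitmx ->
  (forall k z, coordinate f k z = coordinate g k z) -> f = g.
Proof.
move=> uB h; apply/funext => u; apply/rowP => k.
by have := h k (u *m invmx B); rewrite /coordinate mulmxKV.
Qed.

Lemma derive_dot f g u v : derivable f u v -> derivable g u v ->
  is_derive u v (fun u => dot (f u) (g u)) (dot ('D_v f u) (g u) + dot (f u) ('D_v g u)).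
Proof.
move=> df dg; rewrite /dot.
have H k : is_derive u v ((fun u => f u 0 k) * (fun u => g u 0 k)) (f u 0 k *: 'D_v g u 0 k + g u 0 k *: 'D_v f u 0 k).
  by apply: is_deriveM; exact: is_derive_coord.
have := is_derive_sum H.
rewrite (_ : \sum_i _ = (fun u => \sum_i f u 0 i * g u 0 i)); last first.
  by apply/funext => t; rewrite fct_sumE.
move=> h; apply: is_derive_eq h _; rewrite -big_split; apply: eq_bigr => k _.
by rewrite /GRing.scale /= addrC [g u 0 k * _]mulrC.
Qed.

Lemma derive_dot_const f g (a : R) u v : derivable f u v -> derivable g u v ->
  (forall u, dot (f u) (g u) = a) -> dot ('D_v f u) (g u) + dot (f u) ('D_v g u) = 0.
Proof.
move=> df dg fga; have := derive_dot df dg.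
have -> : (fun u => dot (f u) (g u)) = cst a by apply/funext => t; rewrite fga.
move=> h; have := @derive_val _ _ _ _ _ _ _ h; rewrite derive_cst; exact: esym.
Qed.

End Smooth.

Lemma dotC n (u v : 'rV[R]_n) : dot u v = dot v u.
Proof. by apply: eq_bigr => i _; rewrite mulrC. Qed.

Lemma dot_eliminate n (a b d p q : 'rV[R]_n) : a = b ->
  dot d q + dot p a = 0 -> dot b p + dot p b = 0 -> dot d q = 0.
Proof. by move=> ->; rewrite (dotC b); lra. Qed.

Lemma smooth_C1periodic (B : 'M[R]_3) m (x : 'rV[R]_3 -> 'rV[R]_m.+1) :
  torus_immersion B x -> C1periodic B x /\ forall v, C1periodic B ('D_v x).
Proof.
move=> [sx px _ _]; have [dx d2x] := sx 2; have px' v := derive_periodic v px.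
split; first by split=> // v; have [dv _] := d2x v => u; exact: differentiable_continuous.
by move=> v; have [dv cv] := d2x v; split=> [u|w|]; [exact: dv|exact: cv|exact: px'].
Qed.

Section Laplace.
Variables (B : 'M[R]_3) (m : nat) (c : R) (x : 'rV[R]_3 -> 'rV[R]_m.+1).
Hypotheses (uB : B \in unitmx) (hx : minimal_homothetic_immersion B c x).
Let c0 : 0 < c. Proof. by case: hx => _ []. Qed.
Let hom u : induced_metric x u = c%:M. Proof. by case: hx => _ []. Qed.
Let ix : torus_immersion B x. Proof. by case: hx. Qed.
Let C1 : C1periodic B x. Proof. by have [] := smooth_C1periodic ix. Qed.
Let C2 v : C1periodic B ('D_v x). Proof. by have [_] := smooth_C1periodic ix. Qed.
Let d1 u v : derivable x u v. Proof. by case: C1 => d _ _; exact: diff_derivable. Qed.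
Let d2 w u v : derivable ('D_w x) u v. Proof. by case: (C2 w) => d _ _; exact: diff_derivable. Qed.

(** Both sides have the same Fourier coefficients: each derivative multiplies a coefficient by a
    scalar, and scalars commute. *)
Lemma second_derivative_sym v w : 'D_w ('D_v x) = 'D_v ('D_w x).
Proof.
apply: (coordinate_inj uB) => k z; apply/eqP; rewrite -subr_eq0; apply/eqP.
have [_ c2 p2] := C2 v; have [_ c2' p2'] := C2 w.
have cvw : contper (coordinate B ('D_w ('D_v x)) k).
  by apply: contper_coordinate; [exact: c2|exact: derive_periodic].
have cwv : contper (coordinate B ('D_v ('D_w x)) k).
  by apply: contper_coordinate; [exact: c2'|exact: derive_periodic].
have F a b xi := fourier_coordinate_derive b k xi uB (C2 a).
have F1 a xi := fourier_coordinate_derive a k xi uB C1.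
apply: (@fourier_eq0 _ (fun z => coordinate B ('D_w ('D_v x)) k z - coordinate B ('D_v ('D_w x)) k z)).
  exact: contperB.
move=> xi.
apply: etrans (fourierB xi cvw cwv) _.
apply: etrans (congr2 (fun a b => a - b) (etrans (F v w xi) (congr1 _ (F1 v xi)))
  (etrans (F w v xi) (congr1 _ (F1 w xi)))) _.
by rewrite mulrCA subrr.
Qed.

Lemma dot_partial i j u : dot (partial i x u) (partial j x u) = c *+ (i == j).
Proof. by have /matrixP/(_ i j) := hom u; rewrite !mxE. Qed.

Lemma dot_partial_self i u : dot (partial i x u) (x u) = 0.
Proof.
have sx v : dot (x v) (x v) = 1 by case: ix => _ _ s _; exact: s.
have := derive_dot_const (@d1 u (delta_mx 0 i)) (@d1 u (delta_mx 0 i)) sx.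
by rewrite [X in _ + X]dotC -/(partial i x u) => h; lra.
Qed.

Lemma dot_second_self i u : dot (partial i (partial i x) u) (x u) = - c.
Proof.
have := derive_dot_const (@d2 (delta_mx 0 i) u (delta_mx 0 i)) (@d1 u (delta_mx 0 i)) (dot_partial_self i).
rewrite -[dot ('D__ x u) _]/(dot (partial i x u) (partial i x u)) dot_partial eqxx mulr1n => h.
by apply/eqP; rewrite -addr_eq0; apply/eqP.
Qed.

(** Flatness: the metric is constant, so the product of the [i]-th partial with its [k]-th
    derivative is zero, and by symmetry of second derivatives this is, up to sign, the product in
    question. *)
Lemma dot_second_partial i k u : dot (partial i (partial i x) u) (partial k x u) = 0.
Proof.
have D (l a b : 'I_3) : dot (partial l (partial a x) u) (partial b x u) +
    dot (partial a x u) (partial l (partial b x) u) = 0.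
  exact: derive_dot_const (@d2 _ u _) (@d2 _ u _) (dot_partial a b).
have S (a b : 'I_3) : partial a (partial b x) u = partial b (partial a x) u.
  exact: (congr1 (fun f => f u) (second_derivative_sym (delta_mx 0 b) (delta_mx 0 a))).
exact: dot_eliminate (S i k) (D i i k) (D k i i).
Qed.

(** Takahashi's equation. A repeated second derivative has no tangential part and component [- c]
    along [x], so minimality says that the sum of these derivatives has no further normal part. *)
Lemma laplace_eigen u : \sum_i partial i (partial i x) u = - (3 * c) *: x u.
Proof.
have [_ _ /(_ u)] := hx; rewrite /mean_curvature hom invmx_scalar => /eqP.
rewrite scaler_eq0 invr_eq0 pnatr_eq0 /= => /eqP mc.
have {mc} : \sum_(i < 3) c^-1 *: second_fundamental_form x u i i = 0.
  rewrite -[RHS]mc; apply: eq_bigr => i _; rewrite (bigD1 i) //= big1 ?addr0 => [|j ji].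
    by rewrite mxE eqxx mulr1n.
  by rewrite mxE eq_sym (negbTE ji) mulr0n scale0r.
rewrite -scaler_sumr => /eqP; rewrite scaler_eq0 invr_eq0 gt_eqF //= => /eqP.
have E i : second_fundamental_form x u i i = partial i (partial i x) u + c *: x u.
  rewrite /second_fundamental_form dot_second_self scaleNr opprK big1 ?subr0 // => k _.
  by rewrite big1 // => l _; rewrite dot_second_partial mulr0 scale0r.
rewrite (eq_bigr _ (fun i _ => E i)) big_split /= sumr_const card_ord => /eqP.
by rewrite addr_eq0 => /eqP ->; rewrite scaleNr -scalerA scaler_nat.
Qed.

End Laplace.

End Immersion.

(** * Quadratic relations between the amplitudes *)

Section Amplitudes.
Local Open Scope complex_scope.
Variable R : realType.
Implicit Types (u v w z : 'rV[R]_3) (xi eta : 'rV[int]_3).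

Lemma form_level_finite (B : 'M[R]_3) (E : R) : B \in unitmx ->
  exists Y : seq 'rV[int]_3, forall xi, form (invmx (gram B)) (ivec xi) = E -> xi \in Y.
Proof.
move=> uB.
(* [1 + E] dominates the square root of [E], hence the coordinates of [w]; summing over all entries
   of [B] gives one bound for every coordinate of [xi]. *)
pose K : R := \sum_i \sum_j (1 + E) * `|B i j|.
pose N := (Num.truncn K).+1.
(* The indices from [0] to [2 N] encode the integers from [- N] to [N]. *)
pose g (k : 'rV['I_(N + N).+1]_3) : 'rV[int]_3 := \row_i ((k 0 i : nat)%:Z - N%:Z).
exists [seq g k | k : 'rV['I_(N + N).+1]_3] => xi hxi.
pose w := ivec xi *m (invmx B)^T : 'rV[R]_3.
have wE : \sum_i w 0 i ^+ 2 = E by rewrite -form_gram.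
have w1 j : `|w 0 j| <= 1 + E.
  have : w 0 j ^+ 2 <= E.
    by rewrite -wE (bigD1 j) //= lerDl; apply: sumr_ge0 => i _; exact: sqr_ge0.
  rewrite -[_ ^+ 2]real_normK ?num_real // => h.
  by have : 0 <= (`|w 0 j| - 1) ^+ 2 by [exact: sqr_ge0]; have : 0 <= `|w 0 j| by []; nra.
have E0 : 0 <= E by rewrite -wE; apply: sumr_ge0 => i _; exact: sqr_ge0.
have xiw : ivec xi = w *m B^T by rewrite /w -mulmxA -trmx_mul mulmxV // trmx1 mulmx1.
have xiK i : `|(xi 0 i)%:~R : R| <= K.
  have -> : (xi 0 i)%:~R = (ivec xi : 'rV[R]_3) 0 i by rewrite mxE.
  rewrite xiw mxE; apply: le_trans (ler_norm_sum _ _ _) _.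
  apply: (@le_trans _ _ (\sum_j (1 + E) * `|B i j|)).
    by apply: ler_sum => j _; rewrite normrM [B^T _ _]mxE; apply: ler_wpM2r => //; exact: w1.
  rewrite /K [leRHS](bigD1 i) //= lerDl.
  by apply: sumr_ge0 => k _; apply: sumr_ge0 => l _; rewrite mulr_ge0 // addr_ge0.
have xiN i : (`|xi 0%R i| <= N)%N.
  rewrite -(ler_nat R) natr_absz intr_norm; apply: le_trans (xiK i) _.
  by apply/ltW; exact: truncnS_gt.
have kb i : (`|(xi 0 i + N%:Z)%R| < (N + N).+1)%N by have := xiN i; lia.
apply/mapP; exists (\row_i Ordinal (kb i)); first by rewrite mem_enum.
by apply/rowP => i; rewrite !mxE /=; have := xiN i; lia.
Qed.

(** At the frequency [zeta] only [eta = zeta - xi] contributes; since [C] vanishes for [eta] outside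
    [Y], no membership condition on [zeta - xi] remains. *)
Lemma cwave_indep2 (Y : seq 'rV[int]_3) (C : 'rV[int]_3 -> 'rV[int]_3 -> R[i]) (K : R[i]) :
  (forall z, \sum_(xi <- Y) \sum_(eta <- Y) C xi eta * (cwave xi z * cwave eta z) = K) ->
  uniq Y -> (forall xi eta, eta \notin Y -> C xi eta = 0) ->
  forall zeta, \sum_(xi <- Y) C xi (zeta - xi) = K *+ (zeta == 0).
Proof.
move=> CK uY C0 zeta.
pose s := [seq (xi, eta) | xi <- Y, eta <- Y].
have /(@cwave_indep R _ s (fun p => C p.1 p.2) (fun p => p.1 + p.2)) : forall z,
    \sum_(p <- s) C p.1 p.2 * cwave (p.1 + p.2) z = K.
  move=> z; rewrite -(CK z) big_allpairs /=; apply: eq_bigr => xi _; apply: eq_bigr => eta _.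
  by rewrite cwaveD.
move=> /(_ zeta) <-; rewrite big_allpairs /=; apply: eq_bigr => xi _.
have E eta : (xi + eta == zeta) = (eta == zeta - xi) by rewrite eq_sym addrC -subr_eq eq_sym.
under eq_bigr => eta _ do rewrite E.
rewrite sum_eq_uniq //; case: (boolP (zeta - xi \in Y)) => [_|/C0 ->]; first by rewrite mulr1n.
by rewrite mulr0n.
Qed.

Lemma dot_suml n (I : Type) (s : seq I) (a : I -> R) (f : I -> 'rV[R]_n) (v : 'rV[R]_n) :
  dot (\sum_(i <- s) a i *: f i) v = \sum_(i <- s) a i * dot (f i) v.
Proof.
rewrite /dot; under eq_bigr do rewrite summxE mulr_suml.
rewrite exchange_big; apply: eq_bigr => i _; rewrite mulr_sumr; apply: eq_bigr => k _.
by rewrite mxE mulrA.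
Qed.

Section Data.
Variables (B : 'M[R]_3) (m : nat) (c : R) (x : 'rV[R]_3 -> 'rV[R]_m.+1).
Hypotheses (uB : B \in unitmx) (hx : minimal_homothetic_immersion B c x).
Let ix : torus_immersion B x. Proof. by case: hx. Qed.
Let C1 : C1periodic B x. Proof. by have [] := smooth_C1periodic ix. Qed.
Let C2 v : C1periodic B ('D_v x). Proof. by have [_] := smooth_C1periodic ix. Qed.

Definition amplitude (k : 'I_m.+1) xi : R[i] := fourier (coordinate B x k) xi.

Let contper_x k : contper (coordinate B x k).
Proof.
have [d _ p] := C1; apply: contper_coordinate => // u; exact: differentiable_continuous.
Qed.

Let contper_dx v k : contper (coordinate B ('D_v x) k).
Proof.
have [_ c1 p] := C1; apply: contper_coordinate; [exact: c1|exact: derive_periodic].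
Qed.

Lemma amplitudeN k xi : amplitude k (- xi) = conjc (amplitude k xi).
Proof. exact: fourierN. Qed.

Lemma phase_delta xi i : phase xi (delta_mx 0 i *m invmx B) = (ivec xi *m (invmx B)^T) 0 i * (pi *+ 2).
Proof.
rewrite /phase mxE; congr (_ * _); apply: eq_bigr => j _.
by rewrite -rowE !mxE.
Qed.

(** The Laplace equation read on coefficients: at [xi] the Laplacian is multiplication by minus
    [(2 pi) ^ 2] times the dual form. *)
Lemma amplitude_energy k xi : amplitude k xi != 0 ->
  form (invmx (gram B)) (ivec xi) = 3 * c / (pi *+ 2) ^+ 2.
Proof.
move=> A0.
have L : fourier (fun z => \sum_i coordinate B (partial i (partial i x)) k z) xi = (- (3 * c))%:C * amplitude k xi.
  rewrite -fourierZ //; congr fourier; apply/funext => z.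
  have /rowP/(_ k) := laplace_eigen uB hx (z *m B); rewrite summxE mxE => <-.
  by apply: eq_bigr.
have F i : fourier (coordinate B (partial i (partial i x)) k) xi =
    (- (phase xi (delta_mx 0 i *m invmx B)) ^+ 2)%:C * amplitude k xi.
  apply: etrans (fourier_coordinate_derive _ k xi uB (C2 (delta_mx 0 i))) _.
  apply: etrans (congr1 _ (fourier_coordinate_derive (delta_mx 0 i) k xi uB C1)) _.
  rewrite mulrA; congr (_ * _); apply/eqP; rewrite eq_complex /= !mul0r mulr0 addr0 sub0r expr2.
  by rewrite !eqxx.
have pi2 : (pi *+ 2 : R) != 0 by rewrite mulrn_eq0 /= gt_eqF // pi_gt0.
have cpp i : contper (coordinate B (partial i (partial i x)) k).
  have [_ c2 p2] := C2 (delta_mx 0 i).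
  apply: contper_coordinate; [exact: c2|exact: derive_periodic].
move: L; rewrite fourier_sum // (eq_bigr _ (fun i _ => F i)) -mulr_suml => /(mulIf A0).
rewrite -rmorph_sum => /complexI /=; rewrite sumrN => /oppr_inj E.
apply: (mulIf (expf_neq0 2 pi2)); rewrite mulfVK ?expf_neq0 // -E form_gram // mulr_suml.
by apply: eq_bigr => i _; rewrite phase_delta exprMn.
Qed.

Lemma spectrum_exists : exists Y : seq 'rV[int]_3,
  uniq Y /\ forall xi, xi \in Y <-> exists k, amplitude k xi != 0.
Proof.
have [Y HY] := form_level_finite (3 * c / (pi *+ 2) ^+ 2) uB.
exists (undup [seq xi <- Y | `[< exists k, amplitude k xi != 0 >]]); split; first exact: undup_uniq.
move=> xi; rewrite mem_undup mem_filter; split; first by move=> /andP[/asboolP].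
move=> ex; apply/andP; split; first exact/asboolP.
by case: ex => k /amplitude_energy/HY.
Qed.

Variable Y : seq 'rV[int]_3.
Hypotheses (uY : uniq Y) (HY : forall xi, xi \in Y <-> exists k, amplitude k xi != 0).

Lemma amplitude_out k xi : xi \notin Y -> amplitude k xi = 0.
Proof. by apply: contraNeq => h; apply/HY; exists k. Qed.

Lemma spectrumN xi : (- xi \in Y) = (xi \in Y).
Proof.
have H eta : eta \in Y -> - eta \in Y.
  move=> /HY[k h]; apply/HY; exists k; rewrite amplitudeN.
  by apply: contraNneq h => h; rewrite -[amplitude k eta]conjcK h conjc0.
by apply/idP/idP => [/H|/H //]; rewrite opprK.
Qed.

Lemma spectrum_energy xi : xi \in Y -> form (invmx (gram B)) (ivec xi) = 3 * c / (pi *+ 2) ^+ 2.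
Proof. by move=> /HY[k /amplitude_energy]. Qed.

Lemma coordinate_expansion k z :
  (coordinate B x k z)%:C = \sum_(xi <- Y) amplitude k xi * cwave xi z.
Proof.
apply: fourier_inversion => //; [exact: spectrumN|].
by move=> xi; exact: amplitude_out.
Qed.

Lemma derivative_expansion v k z :
  (coordinate B ('D_v x) k z)%:C =
  \sum_(xi <- Y) (0 +i* phase xi (v *m invmx B)) * amplitude k xi * cwave xi z.
Proof.
rewrite (@fourier_inversion _ _ Y) //.
- by apply: eq_bigr => xi _; rewrite (fourier_coordinate_derive v k xi uB C1).
- exact: spectrumN.
- move=> xi xiY; rewrite (fourier_coordinate_derive v k xi uB C1) -/(amplitude k xi).
  by rewrite amplitude_out // mulr0.
Qed.

(** Bilinear, without conjugation: by [amplitudeN] the Hermitian product of two amplitude vectors is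
    [pairing xi (- eta)]. *)
Definition pairing xi eta : R[i] := \sum_k amplitude k xi * amplitude k eta.

Lemma pairingC xi eta : pairing xi eta = pairing eta xi.
Proof. by apply: eq_bigr => k _; rewrite mulrC. Qed.

Lemma pairing_out xi eta : eta \notin Y -> pairing xi eta = 0.
Proof. by move=> eY; rewrite /pairing big1 // => k _; rewrite [amplitude k eta]amplitude_out // mulr0. Qed.

Lemma pairing_sphere zeta : \sum_(xi <- Y) pairing xi (zeta - xi) = 1 *+ (zeta == 0).
Proof.
apply: cwave_indep2 => // [z|]; last exact: pairing_out.
have : \sum_k (coordinate B x k z)%:C * (coordinate B x k z)%:C = 1.
  case: ix => _ _ s _; have := s (z *m B); rewrite /sphere /= /dot => h.
  by rewrite -[RHS]/(1%:C) -h rmorph_sum; apply: eq_bigr => k _; rewrite rmorphM.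
under eq_bigr do rewrite !coordinate_expansion mulr_suml.
rewrite exchange_big /= => <-; apply: eq_bigr => xi _.
under [RHS]eq_bigr do rewrite mulr_sumr.
rewrite [RHS]exchange_big /=; apply: eq_bigr => eta _.
by rewrite /pairing mulr_suml; apply: eq_bigr => k _; rewrite mulrACA.
Qed.

(** Coefficients of the scalar product of the derivatives along two lattice vectors, which is the
    constant [c * gram B i j]; the two imaginary factors cause the sign. *)
Lemma pairing_metric zeta (i j : 'I_3) :
  \sum_(xi <- Y) (xi 0 i)%:~R * ((zeta - xi) 0 j)%:~R * pairing xi (zeta - xi) =
  - (c / (pi *+ 2) ^+ 2 * gram B i j)%:C *+ (zeta == 0).
Proof.
have pi2 : (pi *+ 2 : R) != 0 by rewrite mulrn_eq0 /= gt_eqF // pi_gt0.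
apply: (@cwave_indep2 Y (fun xi eta => (xi 0 i)%:~R * (eta 0 j)%:~R * pairing xi eta)) => // [z|]; last first.
  by move=> xi eta eY; rewrite pairing_out // mulr0.
have dE (l : 'I_3) u : 'D_(row l B) x u = \sum_a B l a *: partial a x u.
  have [d _ _] := C1; apply: derive_linear => //.
  by apply/rowP => a; rewrite mxE summxE (bigD1 a) //= big1 => [|b ba]; rewrite !mxE ?eqxx ?mulr1 ?addr0 // eq_sym (negbTE ba) mulr0.
have G u : dot ('D_(row i B) x u) ('D_(row j B) x u) = c * gram B i j.
  rewrite !dE dot_suml.
  transitivity (\sum_a c * (B i a * B j a)); last first.
    by rewrite -mulr_sumr; congr (_ * _); rewrite mxE; apply: eq_bigr => a _; rewrite !mxE.
  apply: eq_bigr => a _; rewrite dotC dot_suml (bigD1 a) //= big1 => [|b ba].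
    by rewrite (dot_partial hx) eqxx mulr1n addr0; ring.
  by rewrite (dot_partial hx) (negbTE ba) mulr0n mulr0.
have ph xi (l : 'I_3) : phase xi (row l B *m invmx B) = (xi 0 l)%:~R * (pi *+ 2).
  by rewrite rowE mulmxK // -[delta_mx 0 l]scale1r -/(unitv l) phase_unitv mul1r.
have E : \sum_k (coordinate B ('D_(row i B) x) k z)%:C * (coordinate B ('D_(row j B) x) k z)%:C =
    (c * gram B i j)%:C.
  by rewrite -(G (z *m B)) rmorph_sum; apply: eq_bigr => k _; rewrite rmorphM.
have p2 : ((pi *+ 2) ^+ 2)%:C != 0 :> R[i] by rewrite fmorph_eq0 expf_neq0.
apply: (mulfI p2); rewrite mulrN -rmorphM /=.
have -> : (pi *+ 2) ^+ 2 * (c / (pi *+ 2) ^+ 2 * gram B i j) = c * gram B i j.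
  by rewrite mulrA mulrCA mulfV ?expf_neq0 // mulr1.
rewrite -E; under [in RHS]eq_bigr do rewrite !derivative_expansion mulr_suml.
rewrite [in RHS]exchange_big mulr_sumr -sumrN /=; apply: eq_bigr => xi _.
under [in RHS]eq_bigr do rewrite mulr_sumr.
rewrite [in RHS]exchange_big mulr_sumr -sumrN /=; apply: eq_bigr => eta _.
rewrite /pairing mulr_sumr mulr_suml mulr_sumr -sumrN; apply: eq_bigr => k _.
rewrite !ph.
have e : (0 +i* ((xi 0 i)%:~R * (pi *+ 2))) * (0 +i* ((eta 0 j)%:~R * (pi *+ 2))) =
   - (((pi *+ 2) ^+ 2)%:C * ((xi 0 i)%:~R * (eta 0 j)%:~R)) :> R[i].
  rewrite -2!(rmorph_int (real_complex R)) -!rmorphM -rmorphN /=.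
  by apply/eqP; rewrite eq_complex /= !mul0r mulr0 addr0 sub0r eqxx andbT; apply/eqP; ring.
transitivity (- ((0 +i* ((xi 0 i)%:~R * (pi *+ 2))) * (0 +i* ((eta 0 j)%:~R * (pi *+ 2)))) *
  (amplitude k xi * amplitude k eta) * (cwave xi z * cwave eta z)); last by ring.
by rewrite e opprK; ring.
Qed.

End Data.

End Amplitudes.

(** * Congruence *)

Section Congruence.
Local Open Scope complex_scope.
Variable R : realType.
Implicit Types (u v z : 'rV[R]_3) (xi eta : 'rV[int]_3).

Lemma dotE n (u v : 'rV[R]_n) : dot u v = (u *m v^T) 0 0.
Proof. by rewrite mxE; apply: eq_bigr => i _; rewrite mxE. Qed.

Lemma orthogonal_isometry N (O : 'M[R]_N.+1) : O *m O^T = 1%:M ->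
  sphere_isometry (fun p : 'rV[R]_N.+1 => p *m O).
Proof.
move=> OO; have dO (p q : 'rV[R]_N.+1) : dot (p *m O) (q *m O) = dot p q.
  by rewrite !dotE trmx_mul mulmxA -(mulmxA p) OO mulmx1.
have OtO : O^T *m O = 1%:M by exact: mulmx1C.
split; last by move=> p q _ _; rewrite /sphere_dist dO.
split=> [p|p q _ _ pq|p sp].
- by rewrite /sphere /= dO.
- by rewrite -[p]mulmx1 -[q]mulmx1 -OO !mulmxA pq.
- exists (p *m O^T); last by rewrite -mulmxA OtO mulmx1.
  by rewrite /sphere /= -dO -mulmxA OtO mulmx1.
Qed.

Lemma reflection_involutive n (P : 'M[R]_n) : P *m P = P + P -> (1%:M - P) *m (1%:M - P) = 1%:M.
Proof.
move=> PP; rewrite mulmxBl mul1mx mulmxBr mulmx1 PP.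
by rewrite opprB addrK subrK.
Qed.

(* The two orthonormal systems are placed in orthogonal summands and exchanged by the reflection
   in the orthogonal complement of their differences. *)
Lemma congruent_orthonormal r m m' (x : 'rV[R]_3 -> 'rV[R]_m.+1) (x' : 'rV[R]_3 -> 'rV[R]_m'.+1)
    (f : 'rV[R]_3 -> 'rV[R]_r) (C : 'M[R]_(r, m.+1)) (C' : 'M[R]_(r, m'.+1)) :
  C *m C^T = 1%:M -> C' *m C'^T = 1%:M ->
  (forall u, x u = f u *m C) -> (forall u, x' u = f u *m C') -> congruent x x'.
Proof.
move=> CC C'C' xC x'C'.
pose E : 'M[R]_(m.+1, m.+1 + m'.+1) := row_mx 1%:M 0.
pose E' : 'M[R]_(m'.+1, m.+1 + m'.+1) := row_mx 0 1%:M.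
have EE : E *m E^T = 1%:M by rewrite tr_row_mx mul_row_col !trmx0 trmx1 mulmx1 mulmx0 addr0.
have E'E' : E' *m E'^T = 1%:M by rewrite tr_row_mx mul_row_col !trmx0 trmx1 mulmx1 mulmx0 add0r.
have EE' : E *m E'^T = 0 by rewrite tr_row_mx mul_row_col trmx0 mulmx0 mul0mx addr0.
have E'E : E' *m E^T = 0 by rewrite -[LHS]trmxK trmx_mul trmxK EE' trmx0.
pose D := C *m E - C' *m E'.
have MD : (C *m E) *m D^T = 1%:M.
  rewrite /D linearB /= !trmx_mul mulmxBr !mulmxA -(mulmxA C) EE mulmx1 CC.
  by rewrite -(mulmxA C) EE' mulmx0 mul0mx subr0.
have M'D : (C' *m E') *m D^T = - 1%:M.
  rewrite /D linearB /= !trmx_mul mulmxBr !mulmxA -(mulmxA C') E'E mulmx0 mul0mx.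
  by rewrite -(mulmxA C') E'E' mulmx1 C'C' sub0r.
(* Hence the reflection that negates the row space of [D] is [1%:M - D^T *m D]. *)
have DD : D *m D^T = 2%:M by rewrite {1}/D mulmxBl MD M'D opprK -raddfD.
pose O : 'M[R]_(m.+1 + m'.+1) := 1%:M - D^T *m D.
have Ot : O^T = O by rewrite /O linearB /= trmx1 trmx_mul trmxK.
have OO : O *m O^T = 1%:M.
  rewrite Ot /O; apply: reflection_involutive.
  by rewrite mulmxA -(mulmxA D^T D) DD mul_mx_scalar -scalemxAl scaler_nat mulr2n.
(* The successor of [m + m'.+1] is convertible to [m.+1 + m'.+1], the size of [O]. *)
exists (m + m'.+1)%N, E, E', (fun p => p *m O); split=> //; first exact: orthogonal_isometry.
move=> u; rewrite xC x'C' -!mulmxA; congr (_ *m _).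
by rewrite mulmxA /O mulmxBr mulmx1 mulmxA MD mul1mx /D subKr.
Qed.

Lemma ivec_inj : injective (@ivec R).
Proof. by move=> x1 x2 /rowP h; apply/rowP => k; have := h k; rewrite !mxE => /intr_inj. Qed.

Local Notation iv := (@ivec R).

Lemma ivecD xi eta : iv (xi + eta) = iv xi + iv eta :> 'rV[R]_3.
Proof. by apply/rowP => k; rewrite !mxE rmorphD. Qed.

Lemma ivecN xi : iv (- xi) = - iv xi :> 'rV[R]_3.
Proof. by apply/rowP => k; rewrite !mxE rmorphN. Qed.

Lemma sqN (v : 'rV[R]_3) : sq (- v) = sq v.
Proof. by apply/matrixP => i j; rewrite !sqE !mxE mulrNN. Qed.

Definition square_independent (X : 'I_4 -> 'rV[int]_3) := forall b : 'I_4 -> R,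
  \sum_i b i *: sq (iv (X i)) = 0 -> forall i, b i = 0.

Definition frame (Y : seq 'rV[int]_3) (X : 'I_4 -> 'rV[int]_3) :=
  [/\ forall l, X l \in Y, forall xi, xi \in Y -> exists l, xi = X l \/ xi = - X l &
      square_independent X].

Lemma square_independent_inj X i j : square_independent X ->
  sq (iv (X i)) = sq (iv (X j)) -> i = j.
Proof.
move=> iX h; apply/eqP; apply: contraT => ij.
have := iX (fun l => (l == i)%:R - (l == j)%:R).
under eq_bigr do rewrite scalerBl.
rewrite sumrB [X in X - _](bigD1 i) //= [X in _ - X](bigD1 j) //= !eqxx !scale1r h.
rewrite !big1 => [|l lj|l li]; last 2 first.
- by rewrite (negbTE lj) scale0r.
- by rewrite (negbTE li) scale0r.
rewrite !addr0 subrr => /(_ erefl i); rewrite eqxx (negbTE ij) subr0 => /eqP.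
by rewrite oner_eq0.
Qed.

Lemma square_independent_neq0 X i : square_independent X -> X i != 0.
Proof.
move=> iX; apply/eqP => X0; have := iX (fun l => (l == i)%:R).
rewrite (bigD1 i) //= X0 big1 => [|l li]; last by rewrite (negbTE li) scale0r.
have -> : iv 0 = 0 :> 'rV[R]_3 by apply/rowP => k; rewrite !mxE.
rewrite /sq mulmx0 scaler0 addr0 => /(_ erefl i); rewrite eqxx => /eqP.
by rewrite oner_eq0.
Qed.

Lemma frame_neq X i j : square_independent X -> X i != - X j.
Proof.
move=> iX; apply/eqP => h.
have ij : i = j by apply: (square_independent_inj iX); rewrite h ivecN sqN.
have := square_independent_neq0 i iX; rewrite -ij in h.
have : X i + X i = 0 by rewrite {1}h addNr.
move=> h2 /eqP; apply; apply/rowP => k; rewrite mxE.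
have /eqP : X i 0 k + X i 0 k = 0 by have := congr1 (fun v : 'rV[int]_3 => v 0 k) h2; rewrite mxE [RHS]mxE.
by rewrite -mulr2n mulrn_eq0 /= => /eqP.
Qed.

Lemma frame_sum (V : nmodType) Y X (F : 'rV[int]_3 -> V) : uniq Y ->
  (forall xi, (- xi \in Y) = (xi \in Y)) -> frame Y X ->
  \sum_(xi <- Y) F xi = \sum_l (F (X l) + F (- X l)).
Proof.
move=> uY nY [XY YX iX].
have Xinj : injective X by move=> i j h; apply: (square_independent_inj iX); rewrite h.
rewrite (perm_big ([seq X l | l <- index_enum 'I_4] ++ [seq - X l | l <- index_enum 'I_4])).
  by rewrite big_cat !big_map big_split.
apply: uniq_perm => //.
  rewrite cat_uniq !map_inj_uniq ?index_enum_uniq //=; last by move=> i j /oppr_inj/Xinj.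
  rewrite andbT; apply/hasPn => _ /mapP[j _ ->]; apply/negP => /mapP[i _ h].
  by have := frame_neq i j iX; rewrite -h eqxx.
move=> xi; rewrite mem_cat; apply/idP/orP.
  move=> /YX[l [->|->]]; [left|right]; apply: map_f; exact: mem_index_enum.
by move=> [] /mapP[l _ ->]; rewrite ?nY XY.
Qed.

Lemma form_parallelogram (A : 'M[R]_3) (u v : 'rV[R]_3) :
  form A (u + v) + form A (u - v) = 2 * form A u + 2 * form A v.
Proof.
have E (w w' : 'rV[R]_3) : form A (w + w') = form A w + form A w' + ((w *m A *m w'^T) 0 0 + (w' *m A *m w^T) 0 0).
  rewrite /form linearD /= !mulmxDl !mulmxDr.
  have h (M N P Q : 'M[R]_1) : (M + N + (P + Q)) 0 0 = M 0 0 + Q 0 0 + (N 0 0 + P 0 0) by rewrite !mxE; ring.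
  exact: h.
rewrite !E; have -> : form A (- v) = form A v by rewrite -scaleN1r formZ sqrrN expr1n mul1r.
have -> : (u *m A *m (- v)^T) 0 0 = - (u *m A *m v^T) 0 0 by rewrite linearN /= mulmxN mxE.
have -> : (- v *m A *m u^T) 0 0 = - (v *m A *m u^T) 0 0 by rewrite !mulNmx mxE.
ring.
Qed.

Section Pairing.
Variables (B : 'M[R]_3) (m : nat) (c : R) (x : 'rV[R]_3 -> 'rV[R]_m.+1).
Hypotheses (uB : B \in unitmx) (hx : minimal_homothetic_immersion B c x).
Variable Y : seq 'rV[int]_3.
Hypotheses (uY : uniq Y) (HY : forall xi, xi \in Y <-> exists k, amplitude B x k xi != 0).
Local Notation pair := (pairing B x).
Let nY := spectrumN hx HY.
Let kappa := c / (pi *+ 2) ^+ 2.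
Let c0 : 0 < c. Proof. by case: hx => _ []. Qed.
Let pi2 : (pi *+ 2 : R) != 0. Proof. by rewrite mulrn_eq0 /= gt_eqF // pi_gt0. Qed.

Definition weight xi : R := \sum_k (complex.Re (amplitude B x k xi) ^+ 2 + complex.Im (amplitude B x k xi) ^+ 2).

Lemma pairing_weight xi : pair xi (- xi) = (weight xi)%:C.
Proof.
rewrite rmorph_sum; apply: eq_bigr => k _; rewrite (amplitudeN hx).
by case: (amplitude _ _ _ _) => a b; apply/eqP; rewrite eq_complex /=; apply/andP; split; apply/eqP; ring.
Qed.

Lemma weightN xi : weight (- xi) = weight xi.
Proof.
by apply: eq_bigr => k _; rewrite (amplitudeN hx); case: (amplitude _ _ _ _) => a b /=; rewrite sqrrN.
Qed.

Lemma weight_gt0 xi : xi \in Y -> 0 < weight xi.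
Proof.
move=> /HY[k h]; rewrite /weight (bigD1 k) //; apply: ltr_pwDl; last first.
  by apply: sumr_ge0 => l _; rewrite addr_ge0 ?sqr_ge0.
move: h; move: (amplitude B x k xi) => [a b]; rewrite eq_complex /= negb_and => /orP[] h.
  by apply: ltr_pwDl; rewrite ?sqr_ge0 // lt_neqAle sqr_ge0 andbT eq_sym sqrf_eq0.
by apply: ltr_wpDl; rewrite ?sqr_ge0 // lt_neqAle sqr_ge0 andbT eq_sym sqrf_eq0.
Qed.

Lemma weight_sum : \sum_(xi <- Y) weight xi = 1.
Proof.
have := pairing_sphere hx uY HY 0; rewrite eqxx mulr1n => h.
apply: complexI; rewrite rmorph1 -[RHS]h rmorph_sum; apply: eq_bigr => xi _.
by rewrite sub0r pairing_weight.
Qed.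

Lemma weight_gram : \sum_(xi <- Y) weight xi *: sq (iv xi) = kappa *: gram B.
Proof.
apply/matrixP => i j; have := pairing_metric uB hx uY HY 0 i j; rewrite eqxx mulr1n => h.
apply: complexI; rewrite [in RHS]mxE -[RHS]opprK -/kappa -h summxE rmorph_sum -sumrN.
apply: eq_bigr => xi _; rewrite sub0r pairing_weight [in LHS]mxE sqE !mxE !rmorphN.
by rewrite !rmorphM !rmorph_int; ring.
Qed.

Lemma kappa_gt0 : 0 < kappa.
Proof. by rewrite /kappa divr_gt0 // exprn_even_gt0 //= pi2. Qed.

(* The quadratic relations give [p (X l) + p (- X l) = 0] for each line; if neither term vanishes, then
   [X l] and [zeta + X l], [zeta - X l] have equal norms, which the parallelogram law forbids. *)
Lemma pairing_orthogonal X xi eta : frame Y X -> xi != - eta -> pair xi eta = 0.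
Proof.
move=> fX xe; have [XY YX iX] := fX.
pose zeta := xi + eta; have z0 : zeta != 0 by rewrite addr_eq0.
pose p (w : 'rV[int]_3) := pair w (zeta - w).
have p_out (w : 'rV[int]_3) : w \notin Y -> p w = 0.
  by move=> wY; rewrite /p (pairingC B x) (pairing_out HY).
have p_out' (w : 'rV[int]_3) : zeta - w \notin Y -> p w = 0.
  by move=> wY; rewrite /p (pairing_out HY).
have p_sym (w : 'rV[int]_3) : p (zeta - w) = p w by rewrite /p subKr (pairingC B x).
have S0 : \sum_(w <- Y) p w = 0.
  by rewrite (pairing_sphere hx uY HY) (negbTE z0) mulr0n.
have S2 i j : \sum_(w <- Y) (w 0 i)%:~R * ((zeta - w) 0 j)%:~R * p w = 0.
  by rewrite (pairing_metric uB hx uY HY) (negbTE z0) mulr0n.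
(* The involution sending [w] to [zeta - w] acts on those [w] of [Y] for which [zeta - w] is in [Y];
   the other summands vanish. *)
have reindexY (F : 'rV[int]_3 -> R[i]) : (forall w : 'rV[int]_3, w \notin Y -> F w = 0) -> (forall w : 'rV[int]_3, zeta - w \notin Y -> F w = 0) ->
    \sum_(w <- Y) F w = \sum_(w <- Y) F (zeta - w).
  move=> F0 F0'.
  pose Z := [seq w <- Y | zeta - w \in Y].
  have H (G : 'rV[int]_3 -> R[i]) : (forall w : 'rV[int]_3, zeta - w \notin Y -> G w = 0) -> \sum_(w <- Y) G w = \sum_(w <- Z) G w.
    move=> G0; rewrite big_filter [RHS]big_mkcond; apply: eq_bigr => w _.
    by case: (boolP (zeta - w \in Y)) => // /G0.
  rewrite H // [RHS]H; last by move=> w /F0.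
  have sub_inj : injective (fun w => zeta - w) by move=> w w' /addrI /oppr_inj.
  rewrite (perm_big [seq zeta - w | w <- Z]) ?big_map //.
  apply: uniq_perm; rewrite ?map_inj_uniq ?filter_uniq // => w.
  apply/idP/mapP => [|[w' + ->]]; rewrite !mem_filter.
    by move=> /andP[h1 h2]; exists (zeta - w); rewrite ?mem_filter ?subKr ?h1 ?h2.
  by move=> /andP[h1 h2]; rewrite subKr h1 h2.
(* By [S0] the involution turns the first moment into its negative, so it vanishes; [S2] then
   reduces to the vanishing of the second moments. *)
have S1 i : \sum_(w <- Y) (w 0 i)%:~R * p w = 0.
  have h : \sum_(w <- Y) (w 0 i)%:~R * p w = - \sum_(w <- Y) (w 0 i)%:~R * p w.
    rewrite [LHS]reindexY => [|w /p_out ->|w /p_out' ->]; rewrite ?mulr0 //.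
    transitivity ((zeta 0 i)%:~R * (\sum_(w <- Y) p w) - \sum_(w <- Y) (w 0 i)%:~R * p w); last first.
      by rewrite S0 mulr0 sub0r.
    rewrite mulr_sumr -sumrB; apply: eq_bigr => w _.
    by rewrite p_sym !mxE rmorphB mulrBl.
  by move/eqP: h; rewrite -addr_eq0 -mulr2n mulrn_eq0 /= => /eqP.
have S3 i j : \sum_(w <- Y) (w 0 i)%:~R * (w 0 j)%:~R * p w = 0.
  have := S2 i j.
  under eq_bigr => w _ do rewrite !mxE rmorphB mulrBr mulrBl mulrAC.
  by rewrite sumrB -mulr_suml S1 mul0r sub0r => /eqP; rewrite oppr_eq0 => /eqP.
have PX l : p (X l) + p (- X l) = 0.
  (* [g] is the real or the imaginary part, since independence of the squares is over the reals. *)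
  have ind (g : R[i] -> R) : (forall a b, g (a + b) = g a + g b) -> g 0 = 0 -> (forall (r : R) a, g (r%:C * a) = r * g a) ->
      g (p (X l) + p (- X l)) = 0.
    move=> gD g0 gZ; apply: (iX (fun l => g (p (X l) + p (- X l)))).
    apply/matrixP => i j; rewrite summxE [RHS]mxE -[RHS]g0 -(S3 i j) (frame_sum _ uY nY fX).
    rewrite (big_morph g gD g0); apply: eq_bigr => k _; rewrite mxE sqE !mxE.
    transitivity (g (((X k 0 i)%:~R * (X k 0 j)%:~R)%:C * (p (X k) + p (- X k)))).
      by rewrite gZ mulrC.
    by congr (g _); rewrite rmorphM !rmorph_int !rmorphN mulrNN mulrDr.
  apply/eqP; rewrite eq_complex; apply/andP; split; apply/eqP.
  - by apply: ind => // [[a b] [a' b']|r [a b]] //=; rewrite mul0r subr0.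
  - by apply: ind => // [[a b] [a' b']|r [a b]] //=; rewrite mul0r addr0.
have pX l : p (X l) = 0 /\ p (- X l) = 0.
  have [z|n1] := eqVneq (p (X l)) 0; first by have := PX l; rewrite z add0r.
  have [z|n2] := eqVneq (p (- X l)) 0; first by have := PX l; rewrite z addr0.
  have Y1 : zeta - X l \in Y by apply: contraNT n1 => /p_out' ->.
  have Y2 : zeta + X l \in Y by rewrite -[X l]opprK; apply: contraNT n2 => /p_out' ->.
  have E (w : 'rV[int]_3) : w \in Y -> form (invmx (gram B)) (iv w) = 3 * c / (pi *+ 2) ^+ 2 by exact: (spectrum_energy uB hx HY).
  have := form_parallelogram (invmx (gram B)) (iv zeta) (iv (X l)).
  rewrite -ivecN -!ivecD (E _ Y1) (E _ Y2) (E _ (XY l)) => h.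
  have iz : iv zeta != 0.
    by apply: contraNneq z0 => h0; apply/eqP/ivec_inj; rewrite h0; apply/rowP => k; rewrite !mxE.
  by exfalso; have := form_gt0 uB iz; lra.
have <- : p xi = pair xi eta by rewrite /p /zeta addrAC subrr add0r.
have [|/p_out //] := boolP (xi \in Y).
by move=> /YX[l [->|->]]; case: (pX l).
Qed.

End Pairing.

End Congruence.

(** * Normal form of an immersion and comparison of two immersions *)

Section Uniqueness.
Local Open Scope complex_scope.
Variable R : realType.
Implicit Types (u v z : 'rV[R]_3) (xi eta : 'rV[int]_3).
Local Notation iv := (@ivec R).

Lemma sum_complex (I : finType) (F G : I -> R) :
  \sum_i (F i +i* G i) = (\sum_i F i) +i* (\sum_i G i).
Proof. by elim/big_rec3: _ => // i p q r _ ->. Qed.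

Definition wave_frame (rho : 'I_4 -> R) (X : 'I_4 -> 'rV[int]_3) z : 'rV[R]_(4 + 4) :=
  row_mx (\row_l (rho l * cos (phase (X l) z))) (\row_l (rho l * sin (phase (X l) z))).

Section Canonical.
Variables (B : 'M[R]_3) (m : nat) (c : R) (x : 'rV[R]_3 -> 'rV[R]_m.+1).
Hypotheses (uB : B \in unitmx) (hx : minimal_homothetic_immersion B c x).
Variable Y : seq 'rV[int]_3.
Hypotheses (uY : uniq Y) (HY : forall xi, xi \in Y <-> exists k, amplitude B x k xi != 0).
Variable X : 'I_4 -> 'rV[int]_3.
Hypothesis fX : frame R Y X.
Let nY := spectrumN hx HY.
Let a l k := complex.Re (amplitude B x k (X l)).
Let b l k := complex.Im (amplitude B x k (X l)).

Lemma frame_gram :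
  \sum_l (2 * weight B x (X l)) *: sq (iv (X l)) = (c / (pi *+ 2) ^+ 2) *: gram B.
Proof.
rewrite -(weight_gram uB hx uY HY) (frame_sum _ uY nY fX); apply: eq_bigr => l _.
by rewrite (weightN hx) ivecN sqN -scalerDl mulr_natl mulr2n.
Qed.

(** The real and imaginary parts of the products with [X l'] and with [- X l'] are four linear
    equations for the four real products of [a] and [b]. *)
Lemma amplitude_relations l l' :
  [/\ \sum_k a l k * a l' k = (weight B x (X l) / 2) *+ (l == l'),
      \sum_k b l k * b l' k = (weight B x (X l) / 2) *+ (l == l') &
      \sum_k a l k * b l' k = 0].
Proof.
have [XY YX iX] := fX.
have P1 : pairing B x (X l) (X l') = 0.
  by apply: (pairing_orthogonal uB hx uY HY fX); exact: (frame_neq l l' iX).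
have P2 : pairing B x (X l) (- X l') = ((weight B x (X l)) *+ (l == l'))%:C.
  have [->|ll'] := eqVneq l l'; first by rewrite (pairing_weight hx) mulr1n.
  rewrite (pairing_orthogonal uB hx uY HY fX) ?opprK //; apply: contra_neq ll' => h.
  by apply: (square_independent_inj iX); rewrite h.
have : pairing B x (X l) (X l') =
    (\sum_k a l k * a l' k - \sum_k b l k * b l' k) +i* (\sum_k a l k * b l' k + \sum_k b l k * a l' k).
  rewrite -sumrB -big_split -sum_complex; apply: eq_bigr => k _.
  by rewrite /a /b; case: (amplitude B x k (X l)); case: (amplitude B x k (X l')).
have : pairing B x (X l) (- X l') =
    (\sum_k a l k * a l' k + \sum_k b l k * b l' k) +i* (\sum_k b l k * a l' k - \sum_k a l k * b l' k).
  rewrite -sumrB -big_split -sum_complex; apply: eq_bigr => k _.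
  rewrite (amplitudeN hx) /a /b.
  case: (amplitude B x k (X l)) => p q; case: (amplitude B x k (X l')) => p' q'.
  by apply/eqP; rewrite eq_complex /=; apply/andP; split; apply/eqP; ring.
rewrite P1 P2 -mulrnAl; set w := weight _ _ _ *+ _.
move=> /eqP; rewrite eq_complex /= => /andP[/eqP h1 /eqP h2].
move=> /eqP; rewrite eq_complex /= => /andP[/eqP h3 /eqP h4].
by split; lra.
Qed.

(** Opposite frequencies add up to [2 a] times the cosine minus [2 b] times the sine. By
    [amplitude_relations] these vectors are orthogonal with squared length twice the weight, so
    division by [rho] makes them orthonormal. *)
Lemma canonical_form : exists C : 'M[R]_(4 + 4, m.+1), C *m C^T = 1%:M /\
  forall z, x (z *m B) = wave_frame (fun l => Num.sqrt (2 * weight B x (X l))) X z *m C.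
Proof.
have [XY YX iX] := fX.
pose rho l : R := Num.sqrt (2 * weight B x (X l)).
have w0 l : 0 < weight B x (X l) by exact: (weight_gt0 HY).
have rho0 l : rho l != 0 by rewrite sqrtr_eq0 -ltNge mulr_gt0.
have rho2 l : rho l * rho l = 2 * weight B x (X l).
  by rewrite -expr2 sqr_sqrtr // mulr_ge0 // ltW.
pose Ca : 'M[R]_(4, m.+1) := \matrix_(l, k) (2 * a l k / rho l).
pose Cb : 'M[R]_(4, m.+1) := \matrix_(l, k) (- (2 * b l k) / rho l).
have half l l' (s : R) : s = (weight B x (X l) / 2) *+ (l == l') ->
    4 / (rho l * rho l') * s = (l == l')%:R.
  move=> ->; have [<-|_] := eqVneq l l'; rewrite !mulrb ?mulr0 //= rho2.
  by field; exact: lt0r_neq0.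
exists (col_mx Ca Cb); split.
  rewrite tr_col_mx mul_col_row; have -> : 1%:M = block_mx 1%:M 0 0 1%:M :> 'M[R]_(4 + 4) by rewrite -scalar_mx_block.
  have Z : Ca *m Cb^T = 0.
    apply/matrixP => l l'; rewrite !mxE; have [_ _ h] := amplitude_relations l l'.
    transitivity (- (4 / (rho l * rho l') * (\sum_k a l k * b l' k))); last by rewrite h mulr0 oppr0.
    by rewrite mulr_sumr -sumrN; apply: eq_bigr => k _; rewrite !mxE; field; rewrite !rho0.
  have Z' : Cb *m Ca^T = 0 by rewrite -[LHS]trmxK trmx_mul trmxK Z trmx0.
  rewrite Z Z'; congr block_mx; apply/matrixP => l l'; rewrite !mxE; have [h1 h2 _] := amplitude_relations l l'.
    rewrite -(half _ _ _ h1) mulr_sumr; apply: eq_bigr => k _; rewrite !mxE; field; by rewrite !rho0.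
  rewrite -(half _ _ _ h2) mulr_sumr; apply: eq_bigr => k _; rewrite !mxE; field; by rewrite !rho0.
move=> z; rewrite /wave_frame mul_row_col; apply/rowP => k.
have := coordinate_expansion hx uY HY k z; rewrite (frame_sum _ uY nY fX) => h.
have -> : x (z *m B) 0 k = complex.Re (coordinate B x k z)%:C by [].
rewrite h !mxE -big_split /=.
rewrite (big_morph (@complex.Re R) (id1 := 0) (op1 := +%R)) => [|[? ?] [? ?]|] //.
apply: eq_bigr => l _; rewrite !mxE (amplitudeN hx) cwaveN /cwave /a /b -/(rho l).
case: (amplitude B x k (X l)) => p q /=; field; exact: rho0.
Qed.

End Canonical.
Lemma sqZ (t : R) u : sq (t *: u) = t ^+ 2 *: sq u.
Proof. by apply/matrixP => i j; rewrite [RHS]mxE !sqE !mxE; ring. Qed.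

Lemma square_independent_eq X (p q : 'I_4 -> R) : square_independent R X ->
  \sum_l p l *: sq (iv (X l)) = \sum_l q l *: sq (iv (X l)) -> p =1 q.
Proof.
move=> iX h l; apply/eqP; rewrite -subr_eq0; apply/eqP.
apply: (iX (fun l => p l - q l)); under eq_bigr do rewrite scalerBl.
by rewrite sumrB h subrr.
Qed.

(** A line missed by [Y'] would have coefficient zero in the expansion by independent squares,
    against [0 < p l]. *)
Lemma line_representative (Y' : seq 'rV[int]_3) X (t : R) (w' : 'rV[int]_3 -> R) (p : 'I_4 -> R) :
  square_independent R X -> (forall l, 0 < p l) ->
  (forall xi, xi \in Y' -> exists l, iv xi = t *: iv (X l) \/ iv xi = - (t *: iv (X l))) ->
  \sum_(xi <- Y') w' xi *: sq (iv xi) = \sum_l p l *: sq (iv (X l)) ->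
  forall l, exists2 xi, xi \in Y' & iv xi = t *: iv (X l) \/ iv xi = - (t *: iv (X l)).
Proof.
move=> iX p0 Y'X h.
have /choice[d Hd] : forall xi, exists l, xi \in Y' -> iv xi = t *: iv (X l) \/ iv xi = - (t *: iv (X l)).
  by move=> xi; have [/Y'X[l hl]|] := boolP (xi \in Y'); [exists l|exists ord0].
have E : (fun l => t ^+ 2 * \sum_(xi <- Y' | d xi == l) w' xi) =1 p.
  apply: (square_independent_eq iX); rewrite -h.
  transitivity (\sum_l \sum_(xi <- Y' | d xi == l) w' xi *: sq (iv xi)); last first.
    by rewrite (exchange_big_dep xpredT) //=; apply: eq_bigr => xi _; rewrite (big_pred1 (d xi)).
  apply: eq_bigr => l _; rewrite mulr_sumr scaler_suml big_seq_cond [RHS]big_seq_cond.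
  apply: eq_bigr => xi /andP[/Hd + /eqP dl]; rewrite dl => -[->|->]; rewrite ?sqN sqZ scalerA mulrC //.
move=> l; have := p0 l; rewrite -(E l) big_seq_cond.
have [/hasP[xi xY /eqP dl] _|/hasPn H] := boolP (has (fun xi => d xi == l) Y').
  by exists xi => //; rewrite -dl; exact: Hd.
by rewrite big1 ?mulr0 ?ltxx // => xi /andP[/H/negbTE ->].
Qed.

Lemma congruent_dilation (B : 'M[R]_3) (m m' : nat) (c c' : R)
    (x : 'rV[R]_3 -> 'rV[R]_m.+1) (x' : 'rV[R]_3 -> 'rV[R]_m'.+1) :
  B \in unitmx -> cubic_irrational B \/ quartic_irrational B ->
  minimal_homothetic_immersion B c x -> minimal_homothetic_immersion B c' x' ->
  exists t : rat, [/\ 0 < t, c' = ratr t ^+ 2 * c & congruent (fun u => x (ratr t *: u)) x'].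
Proof.
move=> uB irr hx hx'.
have [Y [uY HY]] := spectrum_exists uB hx; have [Y' [uY' HY']] := spectrum_exists uB hx'.
have c0 : 0 < c by case: hx => _ [].
have c'0 : 0 < c' by case: hx' => _ [].
have pi2 : 0 < (pi *+ 2 : R) ^+ 2 by rewrite exprn_gt0 // pmulrn_lgt0 // pi_gt0.
have pi2' : (pi *+ 2 : R) ^+ 2 != 0 by rewrite gt_eqF.
have E0 : 0 < 3 * c / (pi *+ 2) ^+ 2 by rewrite divr_gt0 // mulr_gt0.
have E'0 : 0 < 3 * c' / (pi *+ 2) ^+ 2 by rewrite divr_gt0 // mulr_gt0.
have [t [X [t0 Et XY iX [YX Y'X]]]] := spectrum_rigidity uB irr E0 E'0 (kappa_gt0 hx) (kappa_gt0 hx')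
  (@spectrum_energy _ _ _ _ _ uB hx _ HY) (@spectrum_energy _ _ _ _ _ uB hx' _ HY')
  (weight_sum hx uY HY) (weight_sum hx' uY' HY') (weight_gram uB hx uY HY) (weight_gram uB hx' uY' HY').
have rt0 : 0 < ratr t :> R by rewrite ltr0q.
have Ec : c' = ratr t ^+ 2 * c.
  have h (P p q r : R) : P != 0 -> 3 * p / P = q * (3 * r / P) -> p = q * r.
    by move=> P0 e; have -> : p = 3 * p / P * (P / 3); [field|rewrite e; field].
  exact: h pi2' Et.
have fX : frame R Y X by split.
have cc : (c' / (pi *+ 2) ^+ 2) *: gram B = \sum_l (ratr t ^+ 2 * (2 * weight B x (X l))) *: sq (iv (X l)).
  rewrite Ec -mulrA -scalerA -(frame_gram uB hx uY HY fX) scaler_sumr.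
  by apply: eq_bigr => l _; rewrite scalerA.
have w0 l : 0 < weight B x (X l) by exact: (weight_gt0 HY).
have p0 l : 0 < ratr t ^+ 2 * (2 * weight B x (X l)) by rewrite mulr_gt0 ?exprn_gt0 // mulr_gt0.
(* Symmetry of [Y'] allows the positive sign on every line, so the two frames correspond index by
   index. *)
have /choice[X' HX'] : forall l, exists xi, xi \in Y' /\ iv xi = ratr t *: iv (X l).
  move=> l; have [xi xY' [e|e]] := line_representative iX p0 Y'X (etrans (weight_gram uB hx' uY' HY') cc) l.
  - by exists xi.
  - by exists (- xi); rewrite (spectrumN hx' HY') xY' ivecN e opprK.
have fX' : frame R Y' X'.
  split=> [l|xi /Y'X[l [e|e]]|p h l].
  - by case: (HX' l).
  - by exists l; left; apply: (@ivec_inj R); rewrite e; case: (HX' l).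
  - by exists l; right; apply: (@ivec_inj R); rewrite e ivecN; case: (HX' l) => _ ->.
  - have := iX (fun l => p l * ratr t ^+ 2); under eq_bigr do rewrite -scalerA -sqZ -(HX' _).2.
    by move=> /(_ h l)/eqP; rewrite mulf_eq0 expf_eq0 /= (gt_eqF rt0) orbF => /eqP.
(* Both metrics are expanded in the same independent squares, and the factor [ratr t ^+ 2] from [c']
   cancels the one from the squares of [X']. *)
have Ew l : weight B x' (X' l) = weight B x (X l).
  have := frame_gram uB hx' uY' HY' fX'; rewrite cc.
  under eq_bigr => k _ do rewrite (HX' k).2 sqZ scalerA mulrC.
  move=> /(square_independent_eq iX) /(_ l) /mulfI h.
  have /mulfI : (2 : R) != 0 by rewrite pnatr_eq0.
  by apply; apply: h; rewrite expf_neq0 // gt_eqF.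
exists t; split=> //.
have [C [CC xC]] := canonical_form uB hx uY HY fX.
have [C' [C'C' x'C']] := canonical_form uB hx' uY' HY' fX'.
(* As [X' l] is [t] times [X l], the waves of [x'] at [u] are those of [x] at [ratr t *: u]. *)
pose f u := wave_frame (fun l => Num.sqrt (2 * weight B x (X l))) X (ratr t *: u *m invmx B).
apply: (@congruent_orthonormal _ _ _ _ _ _ f C C') => // u.
  by rewrite /f -xC mulmxKV.
rewrite -{1}(mulmxKV uB u) x'C' /f; congr (_ *m _); rewrite /wave_frame.
have ph l : phase (X' l) (u *m invmx B) = phase (X l) (ratr t *: u *m invmx B).
  rewrite /phase -scalemxAl; congr (_ * _); apply: eq_bigr => k _.
  have /rowP/(_ k) := (HX' l).2; rewrite [iv (X' l) 0 k]mxE => ->.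
  by move: (u *m invmx B) => v; rewrite !mxE; ring.
by congr row_mx; apply/rowP => l; rewrite !mxE Ew ph.
Qed.

End Uniqueness.

Unset Implicit Arguments.
Set Strict Implicit.
Set Printing Implicit Defensive.

(** Congruent maps induce the same metric, so congruence of [x] and [x'] themselves requires equal
    constants, and then [t] must be one. For different constants the dilated map has the same image
    as [x], so the two images still agree up to an isometry. *)
Theorem theorem4p7 (R : realType) (B : 'M[R]_3) (hB : B \in unitmx)
    (hirr : cubic_irrational B \/ quartic_irrational B)
    (m m' : nat) (c c' : R)
    (x : 'rV[R]_3 -> 'rV[R]_m.+1) (x' : 'rV[R]_3 -> 'rV[R]_m'.+1)
    (hx : minimal_homothetic_immersion B c x)
    (hx' : minimal_homothetic_immersion B c' x') :
  (c = c' -> congruent x x') /\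
  (exists t : rat,
     [/\ 0 < t, c' = ratr t ^+ 2 * c &
         congruent (fun u => x (ratr t *: u)) x']).
Proof.
have [t [t0 ct h]] := congruent_dilation hB hirr hx hx'; split; last by exists t.
move=> cc'; have t1 : (ratr t : R) = 1.
  have c0 : c != 0 by case: hx => _ [c0 _] _; rewrite gt_eqF.
  apply/eqP; rewrite -(@eqrXn2 _ 2) // ?ler0q ?ltW // expr1n.
  by rewrite -(inj_eq (mulIf c0)) mul1r -ct cc'.
by move: h; rewrite t1; have -> : (fun u => x (1 *: u)) = x by apply/funext => u; rewrite scale1r.
Qed.
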